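(* Let $n_X,n_Y$ be positive integers and let $S$ be a homogeneous polynomial on $\mathbb{R}^{n_X}\times\mathbb{R}^{n_Y}$ with real coefficients and degree $d>n_X+n_Y$. Let $\varphi$ be a smooth cut-off function with compact support near the origin in $\mathbb{R}^{n_X}\times\mathbb{R}^{n_Y}$, and for $\lambda\in\mathbb{R}$ define \[ T_{\lambda}f(x)=\int_{\mathbb{R}^{n_Y}}e^{i\lambda S(x,y)}\varphi(x,y)f(y)\,dy,\qquad x\in\mathbb{R}^{n_X}. \] Suppose $S$ satisfies the rank one condition, i.e. there is no $(x,y)\in(\mathbb{R}^{n_X}\times\mathbb{R}^{n_Y})\setminus\{(0,0)\}$ with $\partial_{x_i}\partial_{y_j}S(x,y)=0$ for all $1\le i\le n_X$, $1\le j\le n_Y$. Then for every $p$ with \[ \frac{d-n_Y+n_X}{d-n_Y}<p<\frac{d-n_X+n_Y}{n_Y} \] there exists a constant $C=C(S,\varphi,p)$ such that for all $\lambda\neq 0$, \[ \|T_{\lambda}f\|_{L^p(\mathbb{R}^{n_X})}\le C|\lambda|^{-\gamma}\|f\|_{L^p(\mathbb{R}^{n_Y})},\qquad \gamma=\frac{n_X}{d}\cdot\frac1p+\frac{n_Y}{d}\cdot\frac1{p'}, \] where $1/p'=1-1/p$. Moreover, this estimate is sharp if $\varphi$ does not vanish near the origin: in that case there is $c>0$ such that the $L^p$ operator norm of $T_{\lambda}$ is at least $c|\lambda|^{-\gamma}$ for all sufficiently large $|\lambda|$. *)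

(* Defs.v *)
From HB Require Import structures.
From mathcomp Require Import all_boot all_order all_algebra.
From mathcomp Require Import all_classical all_reals all_analysis.
From mathcomp Require mpoly.

Set Implicit Arguments.
Unset Strict Implicit.
Unset Printing Implicit Defensive.

Import Order.TTheory GRing.Theory Num.Theory.
Import numFieldNormedType.Exports.

Local Open Scope classical_set_scope.
Local Open Scope ring_scope.

(* Points of R^n are row vectors 'rV[R]_n (with the matrix normed-space *)
(* structure of MathComp-Analysis).  A point of R^{nX} x R^{nY} is the  *)
(* block row (row_mx x y) : 'rV[R]_(nX + nY).                          *)

Definition rVcons {R : realType} (n : nat) (t : R) (v : 'rV[R]_n) : 'rV[R]_n.+1 :=
  row_mx (\row_(j < 1) t) v.

(* Lebesgue integral over R^n of a nonnegative extended-real function,  *)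
(* realised as the iterated one-dimensional Lebesgue integral           *)
(* (equal to the integral w.r.t. n-dimensional Lebesgue measure for     *)
(* nonnegative measurable functions, by Tonelli).                       *)
Fixpoint lint (R : realType) (n : nat) : ('rV[R]_n -> \bar R) -> \bar R :=
  match n return ('rV[R]_n -> \bar R) -> \bar R with
  | 0 => fun F => F 0
  | n'.+1 => fun F =>
      (\int[@lebesgue_measure R]_(t in setT) @lint R n' (fun v => F (rVcons t v)))%E
  end.
Arguments lint {R} n F.

(* Lebesgue integral over R^n of a real-valued (integrable) function,   *)
(* realised as the iterated one-dimensional Lebesgue integral           *)
(* (equal to the n-dimensional integral for integrable functions, by    *)
(* Fubini).                                                             *)
Fixpoint riint (R : realType) (n : nat) : ('rV[R]_n -> R) -> R :=
  match n return ('rV[R]_n -> R) -> R with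
  | 0 => fun F => F 0
  | n'.+1 => fun F =>
      Rintegral (@lebesgue_measure R) setT (fun t => @riint R n' (fun v => F (rVcons t v)))
  end.
Arguments riint {R} n F.

Definition rV_borel {R : realType} (n : nat) (A : set 'rV[R]_n) : Prop :=
  <<s [set U : set 'rV[R]_n | open U] >> A.

Definition borel_fun {R : realType} (n : nat) (f : 'rV[R]_n -> R) : Prop :=
  forall B : set R, measurable B -> rV_borel (f @^-1` B).

(* A complex-valued function is represented by its real and imaginary  *)
(* parts (fr, fi); its modulus at z is sqrt (fr z ^ 2 + fi z ^ 2).      *)
Definition cmod {R : realType} (a b : R) : R := Num.sqrt (a ^+ 2 + b ^+ 2).

Definition Lpnorm {R : realType} (n : nat) (p : R) (fr fi : 'rV[R]_n -> R) : \bar R :=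
  poweR (lint n (fun z => (powR (cmod (fr z) (fi z)) p)%:E)) p^-1.

Fixpoint Ck {R : realType} (n : nat) (k : nat) (f : 'rV[R]_n -> R) : Prop :=
  match k with
  | 0 => continuous f
  | k'.+1 => continuous f /\
      forall v : 'rV[R]_n, (forall a, derivable f a v) /\ Ck k' (fun a => derive f a v)
  end.

Definition smooth {R : realType} (n : nat) (f : 'rV[R]_n -> R) : Prop :=
  forall k, Ck k f.

Definition compact_support {R : realType} (n : nat) (f : 'rV[R]_n -> R) : Prop :=
  compact (closure [set z | f z != 0]).

(* Polynomials on R^{nX} x R^{nY}: multivariate polynomials in nX + nY *)
(* variables, the first nX being x_1..x_nX and the last nY y_1..y_nY.  *)
Definition peval {R : realType} (N : nat) (P : mpoly.mpoly N R) (z : 'rV[R]_N) : R :=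
  mpoly.meval (fun i => z ord0 i) P.

Definition homogeneous_of_degree {R : realType} (N : nat) (d : nat)
    (P : mpoly.mpoly N R) : Prop :=
  P \is mpoly.ishomog1 d (mpoly.mpoly_mdeg__canonical__mpoly_Measure N).

Definition dxdy {R : realType} (nX nY : nat) (S : mpoly.mpoly (nX + nY) R)
    (i : 'I_nX) (j : 'I_nY) : mpoly.mpoly (nX + nY) R :=
  mpoly.mderiv (rshift nX j) (mpoly.mderiv (lshift nY i) S).

Definition rank_one_condition {R : realType} (nX nY : nat)
    (S : mpoly.mpoly (nX + nY) R) : Prop :=
  ~ exists (x : 'rV[R]_nX) (y : 'rV[R]_nY), (x != 0 \/ y != 0) /\
      forall (i : 'I_nX) (j : 'I_nY), peval (dxdy S i j) (row_mx x y) = 0.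

(* T_lambda f = Tre + i Tim, for f = fr + i fi:                         *)
(*   T_lambda f (x) = int_{R^nY} e^{i lambda S(x,y)} phi(x,y) f(y) dy    *)
Definition Tre {R : realType} (nX nY : nat) (lam : R) (S : mpoly.mpoly (nX + nY) R)
    (phi : 'rV[R]_(nX + nY) -> R) (fr fi : 'rV[R]_nY -> R) (x : 'rV[R]_nX) : R :=
  riint nY (fun y => phi (row_mx x y) *
    (cos (lam * peval S (row_mx x y)) * fr y - sin (lam * peval S (row_mx x y)) * fi y)).

Definition Tim {R : realType} (nX nY : nat) (lam : R) (S : mpoly.mpoly (nX + nY) R)
    (phi : 'rV[R]_(nX + nY) -> R) (fr fi : 'rV[R]_nY -> R) (x : 'rV[R]_nX) : R :=
  riint nY (fun y => phi (row_mx x y) *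
    (sin (lam * peval S (row_mx x y)) * fr y + cos (lam * peval S (row_mx x y)) * fi y)).

Definition gamma_exp {R : realType} (nX nY d : nat) (p : R) : R :=
  (nX%:R / d%:R) * p^-1 + (nY%:R / d%:R) * (1 - p^-1).

(* Main.v *)
(* On the shell r/2 <= |(x, y)| <= r (sup norm), homogeneity and the rank one
   condition bound some mixed derivative of S below by c r^(d-2); after cutting
   the shell into boundedly many cubes, a single S_{x_i y_j} works on each cube.
   Freezing the variables other than x_i and y_j there, T^*T and one integration
   by parts give an L^2 bound r^((nX + nY)/2) (|lam| r^d)^(-k/2) for every
   k < 1. Interpolating with the trivial bound at L^1 or L^oo turns it into
   r^a (|lam| r^d)^(-k/max(p, p')) on L^p, where a = nX/p + nY/p'. The range of
   p is exactly a max(p, p') < d, so that for k close to 1 the minimum of this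
   bound and of the trivial one (k = 0) sums over dyadic r to |lam|^(-a/d).

   The bounds are carried by the real bilinear forms with kernels
   phi cos(lam S) and phi sin(lam S), in the additive form
   |<T f, g>| <= A (int |f|^p + int |g|^p'), which is what level set
   decompositions produce and what duality consumes.

   For the lower bound, T is tested on the indicator of a cube of side
   comparable to |lam|^(-1/d), on which lam S is too small to oscillate. *)

(* The rank one condition provides just one nonvanishing mixed derivative near a point, so a cell
   gains oscillation from a single pair of variables: the L^2 gain is at best (|lam| r^d)^(-1/2),
   whatever nX and nY. The kernel of T^*T in that pair decays like 1 / |s - s'|, which is not
   integrable; the test loses a logarithm, and taking k < 1 absorbs it. The strict inequalities on p
   leave room for this loss.

   Interpolation is done by level sets, with a constant depending on p alone, hence uniform in the
   cells, the shells and lam. The additive bound is as strong as a product bound because f -> t f, g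
   -> g / t leaves the form unchanged.

   Functions are first bounded and measurable, on a cube that carries phi: the measure is finite
   there, so every integral converges and Fubini applies freely; truncation then reaches L^p.
   Homogeneity rescales each shell to the unit one, so one subdivision number K serves all r. *)
Require Import Defs.
From HB Require Import structures.
From mathcomp Require Import all_boot all_order all_algebra.
From mathcomp Require Import all_classical all_reals all_analysis.
From mathcomp Require Import measurable_realfun.
From mathcomp Require mpoly.
Import (canonicals, coercions) mpoly.
From mathcomp Require Import ring lra.
Import Order.TTheory GRing.Theory Num.Theory.
Import numFieldNormedType.Exports.
Local Open Scope classical_set_scope.
Local Open Scope ring_scope.
Set Implicit Arguments.
Unset Strict Implicit.
Unset Printing Implicit Defensive.

(** * Lebesgue measure on row vectors *)

Section borel_rV.
Context {R : realType}.

(** A copy of R^n whose sigma-algebra is by definition that of [rV_borel], so that [borel_fun]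
    becomes measurability between measurable types. *)
Definition rVE (n : nat) := g_sigma_algebraType [set U : set 'rV[R]_n | open U].

Lemma borel_funE n (f : 'rV[R]_n -> R) :
  borel_fun f <-> measurable_fun (setT : set (rVE n)) f.
Proof.
split => [mf _ B mB|mf B mB]; first by rewrite setTI; exact: mf.
by have := mf measurableT B mB; rewrite setTI.
Qed.

Lemma continuous_measurable_rV n (f : 'rV[R]_n -> R) :
  continuous f -> measurable_fun (setT : set (rVE n)) f.
Proof.
move=> cf; apply: (measurability _ (RGenOpens.measurableE R)).
move=> _ [_ [a [b ->]] <-]; rewrite setTI; apply: sub_sigma_algebra => /=.
apply: open_comp => //; exact: interval_open.
Qed.

Definition qbox n (q : 'rV[rat]_n) (k : nat) : set 'rV[R]_n :=
  [set x | forall i, `|x 0 i - ratr (q 0 i)| < k.+1%:R^-1].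

(** Rational boxes form a countable base of the topology; this reduces Borel measurability of a
    vector valued map to that of its coordinates. *)
Lemma open_qboxE n (U : set 'rV[R]_n) : open U ->
  U = \bigcup_(qk in [set qk : 'rV[rat]_n * nat | qbox qk.1 qk.2 `<=` U]) qbox qk.1 qk.2.
Proof.
move=> oU; apply/seteqP; split => [x Ux|x [qk /= + ]]; last exact.
have := open_nbhs_nbhs (conj oU Ux); rewrite nbhs_ballP => -[e /= e0 xeU].
(* Half of [e], because [x] and [y] are compared through the rational centre [q]. *)
have [k ke] : exists k : nat, k.+1%:R^-1 < e / 2.
  have e20 : 0 < e / 2 by rewrite divr_gt0.
  have [N _ /(_ N (leqnn _)) ?] := near_infty_natSinv_lt (PosNum e20).
  by exists N.
have [q xq] : exists q : 'rV[rat]_n, qbox q k x.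
  have H i : exists r : rat, `|x 0 i - ratr r| < k.+1%:R^-1.
    have /rat_in_itvoo[r] : x 0 i - k.+1%:R^-1 < x 0 i + k.+1%:R^-1.
      by rewrite ltrD2l gt0_cp// invr_gt0.
    rewrite in_itv/= => /andP[h1 h2]; exists r.
    by rewrite ltr_distlC h1 h2.
  exists (\row_i projT1 (cid (H i))) => i; rewrite mxE.
  by case: cid.
exists (q, k) => //= y qy; apply: xeU.
split => // i j; rewrite ord1 /ball/=.
rewrite (_ : x 0 j - y 0 j = (x 0 j - ratr (q 0 j)) - (y 0 j - ratr (q 0 j))); last by ring.
apply: le_lt_trans (ler_normB _ _) _.
by rewrite (splitr e) ltrD// (lt_trans _ ke).
Qed.

Lemma measurable_rV d (T : measurableType d) n (f : T -> rVE n) :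
  (forall i, measurable_fun setT (fun t => f t 0 i)) -> measurable_fun setT f.
Proof.
move=> mf; have /measurability : @measurable _ (rVE n) = <<s [set U : set 'rV[R]_n | open U] >> by [].
apply.
move=> _ [U oU <-].
rewrite setTI (open_qboxE oU) preimage_bigcup.
rewrite bigcup_mkcond; apply: countable_bigcupT_measurable => [|[q k]]; first exact: countableP.
case: ifPn => // _.
rewrite (_ : _ @^-1` _ = \bigcap_(i in [set: 'I_n])
   ((fun t => `|f t 0 i - ratr (q 0 i)|) @^-1` `]-oo, k.+1%:R^-1[)).
  apply: fin_bigcap_measurable => // i _; rewrite -[X in measurable X]setTI.
  have : measurable_fun setT (fun t => `|f t 0 i - ratr (q 0 i)|).
    by apply: measurableT_comp => //; apply: measurable_funB.
  by apply => //; exact: measurable_itv.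
apply/seteqP; split => t /=; rewrite /qbox /=.
  by move=> h i _ /=; rewrite in_itv/=.
by move=> h i; have := h i Logic.I; rewrite /= in_itv/=.
Qed.

Lemma measurable_coord n i : measurable_fun (setT : set (rVE n)) (fun x : rVE n => x 0 i).
Proof. by apply: continuous_measurable_rV => x; exact: coord_continuous. Qed.

Lemma rVcons_lift n (t : R) (v : 'rV[R]_n) j : rVcons t v 0 (lift ord0 j) = v 0 j.
Proof.
rewrite -(row_mxEr (\row_(k < 1) t) v 0 j) /rVcons; congr (row_mx _ _ _ _).
exact: val_inj.
Qed.

Lemma rVcons_ord0 n (t : R) (v : 'rV[R]_n) : rVcons t v 0 ord0 = t.
Proof.
transitivity (row_mx (\row_(k < 1) t) v 0 (lshift n ord0)).
  by rewrite /rVcons; congr (row_mx _ _ _ _); exact: val_inj.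
by rewrite row_mxEl mxE.
Qed.

Lemma measurable_rVcons d (T : measurableType d) n (f : T -> R) (g : T -> rVE n) :
  measurable_fun setT f -> measurable_fun setT g ->
  measurable_fun setT (fun t => rVcons (f t) (g t) : rVE n.+1).
Proof.
move=> mf mg; apply: measurable_rV => i.
case: (unliftP ord0 i) => [j|] ->.
  rewrite (_ : (fun t => _) = (fun t => g t 0 j)); last first.
    by apply/funext => t; rewrite rVcons_lift.
  exact: (measurableT_comp (measurable_coord j) mg).
rewrite (_ : (fun t => _) = f)//; by apply/funext => t; rewrite rVcons_ord0.
Qed.

End borel_rV.

Section measurable_Rintegral.
Context {R : realType}.
Local Open Scope ereal_scope.

(** Tonelli is applied to the positive and negative parts separately; measurability survives their
    difference and [fine], including at points where the slice is not integrable. *)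
Lemma measurable_Rintegral d1 d2 (T : measurableType d1) (U : measurableType d2)
  (m : {sigma_finite_measure set U -> \bar R}) (F : T * U -> R) : measurable_fun setT F ->
  measurable_fun setT (fun t => Rintegral m setT (fun u => F (t, u))).
Proof.
move=> mF.
suff h : measurable_fun setT (fun t => \int[m]_u (F (t, u))%:E).
  by apply: measurableT_comp h.
rewrite (_ : (fun t => _) = (fun t => \int[m]_u (EFin \o F)^\+ (t, u)) \-
    (fun t => \int[m]_u (EFin \o F)^\- (t, u))); last first.
  apply: funext => t; rewrite (integralE m setT (fun u => (F (t, u))%:E)).
  by congr (_ - _); apply: eq_integral => u _; rewrite ?funeposE ?funenegE.
apply: emeasurable_funB.
  apply: (@measurable_fun_fubini_tonelli_F _ _ _ _ _ m) => //.
  by apply: measurable_funepos; exact/measurable_EFinP.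
apply: (@measurable_fun_fubini_tonelli_F _ _ _ _ _ m) => //.
by apply: measurable_funeneg; exact/measurable_EFinP.
Qed.

End measurable_Rintegral.

Section vmu_step.
Context {R : realType} (b : {sigma_finite_measure set (measurableTypeR R) -> \bar R})
  (n : nat) (m : {sigma_finite_measure set (@rVE R n) -> \bar R}).

Definition rVcons2 (z : measurableTypeR R * @rVE R n) : @rVE R n.+1 := rVcons z.1 z.2.

Lemma measurable_rVcons2 : measurable_fun setT rVcons2.
Proof. exact: measurable_rVcons. Qed.

Definition rVtail (x : @rVE R n.+1) : @rVE R n := \row_i x 0 (lift ord0 i).

Lemma measurable_rVtail : measurable_fun setT rVtail.
Proof.
apply: measurable_rV => i.
rewrite (_ : (fun t => _) = (fun x : rVE n.+1 => x 0 (lift ord0 i))).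
  exact: measurable_coord.
by apply/funext => x; rewrite mxE.
Qed.

Lemma rVtailK t v : rVtail (rVcons t v) = v.
Proof. by apply/rowP => i; rewrite mxE rVcons_lift. Qed.

Definition vmu_step : set (@rVE R n.+1) -> \bar R :=
  pushforward (b \x m)%E rVcons2.

Let pm : {measure set (@rVE R n.+1) -> \bar R} :=
  measure_function_pushforward__canonical__measure_function_Measure
   (b \x m)%E measurable_rVcons2.

Let vmu_step0 : vmu_step set0 = 0%E. Proof. exact: (measure0 pm). Qed.
Let vmu_step_ge0 A : (0 <= vmu_step A)%E. Proof. exact: (measure_ge0 pm). Qed.
Let vmu_step_sa : semi_sigma_additive vmu_step.
Proof. exact: (@measure_semi_sigma_additive _ _ _ pm). Qed.

HB.instance Definition _ := isMeasure.Build _ _ _ vmu_step vmu_step0 vmu_step_ge0 vmu_step_sa.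

Let vmu_step_sigma_finite : sigma_finite setT vmu_step.
Proof.
have /sigma_finiteP[F [TF ndF Foo]] := sigma_finiteT b.
have /sigma_finiteP[G [TG ndG Goo]] := sigma_finiteT m.
exists (fun k => (fun x : rVE n.+1 => x 0 ord0) @^-1` F k `&` rVtail @^-1` G k).
  apply/seteqP; split => // x _.
  have : (setT : set R) (x 0 ord0) by [].
  rewrite TF => -[i _ Fi].
  have : setT (rVtail x) by [].
  rewrite TG => -[j _ Gj]; exists (maxn i j) => //; split.
    by have /subsetPset := ndF _ _ (leq_maxl i j); exact.
  by have /subsetPset := ndG _ _ (leq_maxr i j); exact.
move=> k; have [mF Fk] := Foo k; have [mG Gk] := Goo k; split.
  apply: measurableI; rewrite -[X in measurable X]setTI.
    exact: (measurable_coord).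
  exact: measurable_rVtail.
rewrite /vmu_step /pushforward (_ : rVcons2 @^-1` _ = F k `*` G k).
  by rewrite product_measure1E// lte_mul_pinfty// ge0_fin_numE.
by apply/seteqP; split => -[t v] /=; rewrite /rVcons2/= rVcons_ord0 rVtailK.
Qed.

HB.instance Definition _ := Measure_isSigmaFinite.Build _ _ _ vmu_step vmu_step_sigma_finite.

End vmu_step.

Section rVins.
Context {R : realType}.

(** [rVcons] exposes the first coordinate only, whereas the pair (i, j) supplied by the rank one
    condition is arbitrary; insertion at position i singles that variable out. *)
Definition rVins n (i : 'I_n.+1) (t : R) (v : 'rV[R]_n) : 'rV[R]_n.+1 :=
  \row_k (if unlift i k is Some j then v 0 j else t).

Lemma rVins0 n t (v : 'rV[R]_n) : rVins ord0 t v = rVcons t v.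
Proof.
apply/rowP => k; rewrite mxE; case: unliftP => [j|] ->.
  by rewrite rVcons_lift.
by rewrite rVcons_ord0.
Qed.

Lemma rVins_lift n (i : 'I_n.+1) t (v : 'rV[R]_n) j : rVins i t v 0 (lift i j) = v 0 j.
Proof. by rewrite mxE liftK. Qed.

Lemma rVins_id n (i : 'I_n.+1) t (v : 'rV[R]_n) : rVins i t v 0 i = t.
Proof. by rewrite mxE unlift_none. Qed.

Lemma rVins_cons n (i : 'I_n.+1) t s (v : 'rV[R]_n) :
  rVins (lift ord0 i) t (rVcons s v) = rVcons s (rVins i t v).
Proof.
apply/rowP => k; case: (unliftP (lift ord0 i) k) => [j|] ->; last first.
  by rewrite rVins_id rVcons_lift rVins_id.
rewrite rVins_lift; case: (unliftP ord0 j) => [l|] ->.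
  rewrite rVcons_lift (_ : @lift n.+2 _ (@lift n.+1 _ l) = @lift n.+2 ord0 (@lift n.+1 i l)).
    by rewrite rVcons_lift rVins_lift.
  by apply: val_inj; rewrite /= /bump !leq0n /= !add1n ltnS addnS.
rewrite rVcons_ord0 (_ : @lift n.+2 _ ord0 = ord0) ?rVcons_ord0//.
by apply: val_inj.
Qed.

Lemma measurable_rVins d (T : measurableType d) n (i : 'I_n.+1) (f : T -> measurableTypeR R)
    (g : T -> @rVE R n) :
  measurable_fun setT f -> measurable_fun setT g ->
  measurable_fun setT (fun t => rVins i (f t) (g t) : @rVE R n.+1).
Proof.
move=> mf mg; apply: measurable_rV => k.
case: (unliftP i k) => [j|] ->.
  rewrite (_ : (fun t => _) = (fun t => g t 0 j)).
    exact: (measurableT_comp (measurable_coord j) mg).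
  by apply/funext => t; rewrite rVins_lift.
rewrite (_ : (fun t => _) = f)//.
by apply/funext => t; rewrite rVins_id.
Qed.

End rVins.

Section vmu.
Context {R : realType} (b : {sigma_finite_measure set (measurableTypeR R) -> \bar R}).
Local Open Scope ereal_scope.

(** The one-dimensional measure [b] is a parameter: Lebesgue measure gives the integrals of the
    statement, its restriction to an interval gives a finite measure for the estimates. *)
Fixpoint vmu (n : nat) : {sigma_finite_measure set (@rVE R n) -> \bar R} :=
  match n with
  | 0 => @dirac _ (@rVE R 0) (0%R : 'rV[R]_0) R
  | n'.+1 => vmu_step b (vmu n')
  end.

Lemma ge0_integral_vmuS n (F : rVE n.+1 -> \bar R) : measurable_fun setT F ->
  (forall x, 0 <= F x) ->
  \int[vmu n.+1]_x F x = \int[b]_t \int[vmu n]_v F (rVcons t v).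
Proof.
move=> mF F0.
have := @ge0_integral_pushforward _ _ _ _ R (@rVcons2 R n) (@measurable_rVcons2 R n)
  (b \x vmu n)%E setT F measurableT mF (fun x _ => F0 x).
rewrite preimage_setT => E; rewrite [LHS]E.
rewrite fubini_tonelli1//=.
exact: (measurableT_comp mF (@measurable_rVcons2 R n)).
Qed.

(** Induction on n: exchanging two one-dimensional integrals by Tonelli carries coordinate i past
    the first one. *)
Lemma ge0_integral_rVins n (i : 'I_n.+1) (F : rVE n.+1 -> \bar R) : measurable_fun setT F ->
  (forall x, 0 <= F x) ->
  \int[vmu n.+1]_x F x = \int[b]_t \int[vmu n]_v F (rVins i t v).
Proof.
elim: n i F => [|n IH] i F mF F0.
  rewrite ge0_integral_vmuS//; apply: eq_integral => t _; apply: eq_integral => v _.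
  by rewrite ord1 rVins0.
case: (unliftP ord0 i) => [j|] ->; last first.
  rewrite ge0_integral_vmuS//; apply: eq_integral => t _; apply: eq_integral => v _.
  by rewrite rVins0.
have mF3 : measurable_fun setT
   (fun z : (measurableTypeR R * measurableTypeR R) * @rVE R n =>
     F (rVcons z.1.1 (rVins j z.1.2 z.2))).
  apply: (measurableT_comp mF); apply: measurable_rVcons.
    exact: measurableT_comp measurable_fst measurable_fst.
  apply: measurable_rVins => //.
  exact: measurableT_comp measurable_snd measurable_fst.
rewrite ge0_integral_vmuS//.
transitivity (\int[b]_s \int[b]_t \int[vmu n]_v F (rVcons s (rVins j t v))).
  apply: eq_integral => s _; apply: (IH j (fun w => F (rVcons s w))) => //.
  by apply: (measurableT_comp mF); exact: measurable_rVcons.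
have -> := @fubini_tonelli _ _ _ _ R b b
  (fun z => \int[vmu n]_v F (rVcons z.1 (rVins j z.2 v))).
- apply: eq_integral => t _; rewrite (ge0_integral_vmuS).
  + apply: eq_integral => s _; apply: eq_integral => v _ /=.
    by rewrite rVins_cons.
  + by apply: (measurableT_comp mF); exact: measurable_rVins.
  + by [].
- by apply: (@measurable_fun_fubini_tonelli_F _ _ _ _ _ (vmu n) _ mF3) => z.
- by move=> z; exact: integral_ge0.
Qed.

Definition rVins2 n i (z : measurableTypeR R * @rVE R n) : @rVE R n.+1 := rVins i z.1 z.2.

Lemma measurable_rVins2 n i : measurable_fun setT (@rVins2 n i).
Proof. exact: measurable_rVins. Qed.

(** Testing the previous formula on indicators identifies the two measures, which then lets signed
    integrands pass as well. *)
Lemma vmu_rVins n (i : 'I_n.+1) A : measurable A ->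
  vmu n.+1 A = pushforward (b \x vmu n) (rVins2 i) A.
Proof.
move=> mA.
have mA2 : measurable (rVins2 i @^-1` A).
  by rewrite -[X in measurable X]setTI; exact: measurable_rVins2.
transitivity (\int[vmu n.+1]_x (\1_A x)%:E); first by rewrite integral_indic// setIT.
transitivity (\int[b \x vmu n]_z (\1_(rVins2 i @^-1` A) z)%:E); last first.
  by rewrite integral_indic// setIT.
rewrite (ge0_integral_rVins i).
- by rewrite fubini_tonelli1//; exact/measurable_EFinP/measurable_indic.
- exact/measurable_EFinP/measurable_indic.
- by move=> x; rewrite lee_fin.
Qed.

Lemma integral_rVins n (i : 'I_n.+1) (F : rVE n.+1 -> R) :
  (vmu n.+1).-integrable setT (EFin \o F) ->
  (b \x vmu n).-integrable setT (EFin \o (F \o rVins2 i)) /\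
  \int[vmu n.+1]_x (F x)%:E = \int[b \x vmu n]_z (F (rVins2 i z))%:E.
Proof.
move=> iF; have mF := measurable_int _ iF.
have mF2 : measurable_fun setT (EFin \o (F \o rVins2 i)).
  exact: (measurableT_comp mF (measurable_rVins2 i)).
have iF2 : (b \x vmu n).-integrable setT (EFin \o (F \o rVins2 i)).
  apply/integrableP; split => //.
  have /integrableP[_] := iF; rewrite (ge0_integral_rVins i)//.
    by rewrite fubini_tonelli1//; apply: measurableT_comp.
  exact: measurableT_comp.
split => //.
transitivity (\int[pushforward (b \x vmu n) (rVins2 i)]_x (F x)%:E).
  apply: eq_measure_integral => [|mr A mA _]; first exact: measurable_rVins2.
  exact: vmu_rVins.
have := integral_pushforward (measurable_rVins2 i) mF iF2 measurableT.
by rewrite preimage_setT => E; rewrite [LHS]E.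
Qed.

End vmu.

Section lint_riint.
Context {R : realType}.
Local Open Scope ereal_scope.
Local Notation mu := (@lebesgue_measure R).

Lemma lintE n (F : rVE n -> \bar R) : measurable_fun setT F ->
  (forall x, 0 <= F x) -> lint n F = \int[vmu mu n]_x F x.
Proof.
elim: n F => [|n IH] F mF F0 /=.
  by rewrite integral_dirac// diracT mul1e.
rewrite (ge0_integral_vmuS mu mF)//; apply: eq_integral => t _.
apply: IH => //; apply: (measurableT_comp mF); exact: measurable_rVcons.
Qed.

Lemma measurable_riint n d (T : measurableType d) (F : T * @rVE R n -> R) :
  measurable_fun setT F -> measurable_fun setT (fun t => riint n (fun v => F (t, v))).
Proof.
elim: n d T F => [|n IH] d T F mF.
  by apply: (measurableT_comp mF); exact: measurable_fun_pair.
apply: (@measurable_Rintegral _ _ _ _ (measurableTypeR R) mu (fun z =>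
   riint n (fun v => F (z.1, rVcons z.2 v)))).
apply: (IH _ _ (fun w : (T * measurableTypeR R) * @rVE R n => F (w.1.1, rVcons w.1.2 w.2))).
apply: (measurableT_comp mF); apply: measurable_fun_pair.
  exact: measurableT_comp measurable_fst measurable_fst.
apply: measurable_rVcons => //.
exact: measurableT_comp measurable_snd measurable_fst.
Qed.

(** At each level of [riint], [fine] turns an infinite slice integral into a default real. By Fubini
    almost every slice is integrable, so these values do not affect the outer integral. *)
Lemma riintE n (F : @rVE R n -> R) : (vmu mu n).-integrable setT (EFin \o F) ->
  riint n F = Rintegral (vmu mu n) setT F.
Proof.
elim: n F => [|n IH] F iF /=.
  by rewrite /Rintegral integral_dirac ?diracT ?mul1e//; exact: (measurable_int _ iF).
have [i2 E] := integral_rVins ord0 iF.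
rewrite /Rintegral E -(integral12_prod_meas1 i2); congr fine.
have mF : measurable_fun setT F by apply/measurable_EFinP; exact: (measurable_int _ iF).
apply: ae_eq_integral => //.
- apply/measurable_EFinP.
  apply: (@measurable_riint _ _ _ (fun z : measurableTypeR R * @rVE R n => F (rVcons z.1 z.2))).
  by apply: (measurableT_comp mF); exact: measurable_rVcons.
- exact: (measurable_fubini_F i2).
- have := ae_integrable1 i2; apply: filterS => t it _ /=.
  rewrite (IH (fun v => F (rVcons t v))).
    rewrite /Rintegral fineK.
      by apply: eq_integral => v _; rewrite /rVins2 /= rVins0.
    apply: integrable_fin_num => //.
    by apply: eq_integrable it => // v _; rewrite /rVins2 /= rVins0.
  by apply: eq_integrable it => // v _; rewrite /rVins2 /= rVins0.
Qed.

End lint_riint.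

(** * Bounded measurable functions and bilinear forms *)

Section bounded_measurable.
Context {R : realType}.

(** Over a finite measure this class is an algebra of integrable functions, closed under powers of
    the modulus and under integration in one variable; the side conditions of Fubini and linearity
    become structural. *)
Definition bmf d (T : measurableType d) (f : T -> R) :=
  measurable_fun setT f /\ exists M, forall x, `|f x| <= M.

Section one.
Context d (T : measurableType d).
Implicit Types f g : T -> R.

Lemma bmf_bound f : bmf f -> exists2 M, 0 <= M & forall x, `|f x| <= M.
Proof.
by move=> [_ [M fM]]; exists `|M| => // x; exact: le_trans (fM x) (ler_norm _).
Qed.

Lemma bmf_cst (c : R) : bmf (fun _ : T => c).
Proof. by split => //; exists `|c|. Qed.

Lemma bmfD f g : bmf f -> bmf g -> bmf (fun x => f x + g x).
Proof.
move=> [mf [M fM]] [mg [N gN]]; split; first exact: measurable_funD.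
by exists (M + N) => x; rewrite (le_trans (ler_normD _ _))// lerD.
Qed.

Lemma bmfM f g : bmf f -> bmf g -> bmf (fun x => f x * g x).
Proof.
move=> [mf [M fM]] [mg [N gN]]; split; first exact: measurable_funM.
by exists (M * N) => x; rewrite normrM ler_pM.
Qed.

Lemma bmfN f : bmf f -> bmf (fun x => - f x).
Proof.
move=> [mf [M fM]]; split; first exact: measurableT_comp.
by exists M => x; rewrite normrN.
Qed.

Lemma bmfB f g : bmf f -> bmf g -> bmf (fun x => f x - g x).
Proof. by move=> bf bg; apply: bmfD => //; exact: bmfN. Qed.

Lemma bmfZ c f : bmf f -> bmf (fun x => c * f x).
Proof. by move=> bf; exact: bmfM (bmf_cst c) bf. Qed.

Lemma bmfX f n : bmf f -> bmf (fun x => f x ^+ n).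
Proof.
move=> bf; elim: n => [|n IH]; first exact: bmf_cst.
by under eq_fun do rewrite exprS; exact: bmfM.
Qed.

Lemma bmf_norm f : bmf f -> bmf (fun x => `|f x|).
Proof.
move=> [mf [M fM]]; split; first exact: measurableT_comp.
by exists M => x; rewrite normr_id.
Qed.

Lemma bmf_powR f p : 0 <= p -> bmf f -> bmf (fun x => powR `|f x| p).
Proof.
move=> p0 bf; have [M M0 fM] := bmf_bound bf; case: bf => mf _; split.
  apply: (measurableT_comp (measurable_powR p)).
  exact: measurableT_comp.
exists (powR M p) => x; rewrite ger0_norm ?powR_ge0//.
by rewrite ge0_ler_powR// nnegrE.
Qed.

Lemma bmf_bool (b : T -> bool) : measurable_fun setT b -> bmf (fun x => (b x)%:R).
Proof.
move=> mb; split.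
  rewrite (_ : (fun x => _) = (fun x => if b x then 1 else 0)).
    exact: measurable_fun_ifT.
  by apply/funext => x; case: (b x).
by exists 1 => x; case: (b x); rewrite ?normr1 ?normr0.
Qed.

Lemma bmf_lt f g : measurable_fun setT f -> measurable_fun setT g ->
  bmf (fun x => (f x < g x)%R%:R).
Proof. by move=> mf mg; apply: bmf_bool; exact: measurable_fun_ltr. Qed.

Lemma bmf_sum (I : Type) (s : seq I) (P : pred I) (F : I -> T -> R) :
  (forall i, bmf (F i)) -> bmf (fun x => \sum_(i <- s | P i) F i x).
Proof.
move=> bF; elim: s => [|i s IH].
  by under eq_fun do rewrite big_nil; exact: bmf_cst.
under eq_fun do rewrite big_cons.
by case: (P i) => //; exact: bmfD.
Qed.

Lemma bmf_comp d' (U : measurableType d') (h : U -> T) f :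
  measurable_fun setT h -> bmf f -> bmf (fun u => f (h u)).
Proof.
move=> mh [mf [M fM]]; split; first exact: measurableT_comp.
by exists M => x; exact: fM.
Qed.

Variables (m : {measure set T -> \bar R}).
Hypothesis mfin : (m setT < +oo)%E.

Lemma bmf_integrable f : bmf f -> m.-integrable setT (EFin \o f).
Proof.
move=> [mf [M fM]]; apply: measurable_bounded_integrable => //.
exists M; split; first exact: num_real.
by move=> N MN x _; exact: le_trans (fM x) (ltW MN).
Qed.

Lemma bmf_RintD f g : bmf f -> bmf g ->
  \int[m]_x (f x + g x) = \int[m]_x f x + \int[m]_x g x.
Proof. by move=> bf bg; apply: RintegralD => //; exact: bmf_integrable. Qed.

Lemma bmf_RintZl f r : bmf f -> \int[m]_x (r * f x) = r * \int[m]_x f x.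
Proof. by move=> bf; apply: RintegralZl => //; exact: bmf_integrable. Qed.

Lemma bmf_RintZr f r : bmf f -> \int[m]_x (f x * r) = (\int[m]_x f x) * r.
Proof. by move=> bf; apply: RintegralZr => //; exact: bmf_integrable. Qed.

Lemma bmf_le_Rint f g : bmf f -> bmf g -> (forall x, f x <= g x) ->
  \int[m]_x f x <= \int[m]_x g x.
Proof. by move=> bf bg fg; apply: le_Rintegral => //; exact: bmf_integrable. Qed.

Lemma bmf_Rint_norm f : bmf f -> `|\int[m]_x f x| <= \int[m]_x `|f x|.
Proof. by move=> bf; apply: le_normr_Rintegral => //; exact: bmf_integrable. Qed.

Lemma bmf_Rint_sum (I : Type) (s : seq I) (P : pred I) (F : I -> T -> R) :
  (forall i, bmf (F i)) ->
  \int[m]_x (\sum_(i <- s | P i) F i x) = \sum_(i <- s | P i) \int[m]_x F i x.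
Proof.
move=> bF; elim: s => [|i s IH].
  rewrite big_nil; under eq_Rintegral do rewrite big_nil.
  by rewrite /Rintegral integral0.
rewrite big_cons; under eq_Rintegral do rewrite big_cons.
case: (P i) => //; rewrite bmf_RintD// ?IH//; exact: bmf_sum.
Qed.

Lemma bmf_EFin_Rint f : bmf f -> (\int[m]_x f x)%:E = (\int[m]_x (f x)%:E)%E.
Proof.
by move=> bf; rewrite /Rintegral fineK//; apply: integrable_fin_num => //; exact: bmf_integrable.
Qed.

End one.

Section two.
Context d1 d2 (X : measurableType d1) (Y : measurableType d2).
Variables (m1 : {sigma_finite_measure set X -> \bar R})
  (m2 : {sigma_finite_measure set Y -> \bar R}).
Hypotheses (fin1 : (m1 setT < +oo)%E) (fin2 : (m2 setT < +oo)%E).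
Implicit Type k : X * Y -> R.

Lemma bmf_swap k : bmf k -> bmf (fun z : Y * X => k (z.2, z.1)).
Proof. by move=> bk; apply: (bmf_comp _ bk); exact: measurable_fun_pair. Qed.

Lemma bmf_fst (f : X -> R) : bmf f -> bmf (fun z : X * Y => f z.1).
Proof. by move=> bf; apply: (bmf_comp _ bf). Qed.

Lemma bmf_snd (f : Y -> R) : bmf f -> bmf (fun z : X * Y => f z.2).
Proof. by move=> bf; apply: (bmf_comp _ bf). Qed.

Lemma bmf_pair1 k x : bmf k -> bmf (fun y => k (x, y)).
Proof. by move=> bk; apply: (bmf_comp _ bk); exact: measurable_fun_pair. Qed.

Lemma bmf_pair2 k y : bmf k -> bmf (fun x => k (x, y)).
Proof. by move=> bk; apply: (bmf_comp _ bk); exact: measurable_fun_pair. Qed.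

Lemma prod_fin : ((m1 \x m2) setT < +oo)%E.
Proof. by rewrite -setXTT product_measure1E// lte_mul_pinfty// ge0_fin_numE. Qed.

Lemma bmf_Rint k : bmf k -> bmf (fun x => \int[m2]_y k (x, y)).
Proof.
move=> bk; have [M M0 kM] := bmf_bound bk; split.
  by apply: measurable_Rintegral; case: bk.
exists (M * fine (m2 setT)) => x.
apply: le_trans (bmf_Rint_norm fin2 (bmf_pair1 x bk)) _.
rewrite -Rintegral_cst//; apply: (bmf_le_Rint fin2) => //.
  exact: bmf_norm (bmf_pair1 x bk).
exact: bmf_cst.
Qed.

Lemma bmf_Fubini k : bmf k ->
  \int[m1]_x \int[m2]_y k (x, y) = \int[m2]_y \int[m1]_x k (x, y).
Proof.
move=> bk; rewrite /Rintegral; congr fine.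
transitivity (\int[m1]_x \int[m2]_y (k (x, y))%:E)%E.
  by apply: eq_integral => x _; rewrite -(bmf_EFin_Rint fin2) //; exact: bmf_pair1.
rewrite (@Fubini _ _ _ _ _ m1 m2 (EFin \o k)); last exact: (bmf_integrable prod_fin).
by apply: eq_integral => y _; rewrite -(bmf_EFin_Rint fin1) //; exact: bmf_pair2.
Qed.

End two.

End bounded_measurable.

(** * Dyadic sums *)

Section geometric.
Context {R : realType}.

(** Only the k with 2^k lam > u survive; they form a geometric series of ratio 2^(-a) whose first
    term is at most u^(-a), whence a constant free of [L]. *)
Lemma sum_dyadic_tail (a lam u : R) L : 0 < a -> 0 < lam -> 0 < u ->
  \sum_(k < L) powR (2 ^+ k * lam) (- a) * (u < 2 ^+ k * lam)%R%:R
    <= (1 - powR 2 (- a))^-1 * powR u (- a).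
Proof.
move=> a0 lam0 u0; set rho := powR 2 (- a).
have rho1 : rho < 1.
  rewrite /rho powRN invf_lt1 ?powR_gt0//.
  by have := @gt0_ltr_powR R a a0 1 2; rewrite powR1; apply; rewrite ?nnegrE ?ltr1n.
have r0 : 0 < 1 - rho by rewrite subr_gt0.
have r0i : 0 <= (1 - rho)^-1 by rewrite invr_ge0 ltW.
have pw_anti (x y : R) : 0 < x -> x <= y -> powR y (- a) <= powR x (- a).
  move=> x0 xy; have y0 := lt_le_trans x0 xy.
  rewrite !powRN lef_pV2 ?posrE ?powR_gt0// ge0_ler_powR ?nnegrE//; exact: ltW.
(* The maximum makes the induction close: while u < lam, the new term lam^(-a) added to the bound
   for 2 lam gives exactly the bound for lam. *)
suff H (lam' : R) : 0 < lam' -> \sum_(k < L) powR (2 ^+ k * lam') (- a) * (u < 2 ^+ k * lam')%R%:R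
    <= (1 - rho)^-1 * powR (Num.max lam' u) (- a).
  apply: le_trans (H _ lam0) _; apply: ler_wpM2l => //.
  by apply: pw_anti => //; rewrite le_max lexx orbT.
elim: L lam' {lam lam0} => [|L IH] lam lam0.
  by rewrite big_ord0 mulr_ge0// powR_ge0.
rewrite big_ord_recl expr0 mul1r.
under eq_bigr do rewrite /= /bump /= add1n exprSr -mulrA.
have := IH (2 * lam) (mulr_gt0 (ltr0Sn _ 1) lam0).
have [ul|lu] := ltP u lam.
  have -> : Num.max (2 * lam) u = 2 * lam.
    by apply: max_l; move: lam0 ul; lra.
  rewrite powRM ?(ltW lam0)// -/rho => h.
  rewrite mulr1 (le_trans (lerD (lexx _) h))//.
  have -> : powR lam (- a) + (1 - rho)^-1 * (rho * powR lam (- a)) = (1 - rho)^-1 * powR lam (- a).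
    by field; rewrite gt_eqF.
  by [].
rewrite mulr0 add0r => h; apply: (le_trans h).
apply: ler_wpM2l => //.
by apply: pw_anti => //; rewrite le_max lexx orbT.
Qed.

Lemma sum_dyadic_shells (lam t : R) L : 0 < lam ->
  \sum_(k < L) (2 ^+ k * lam < t <= 2 ^+ k.+1 * lam)%R%:R = (lam < t <= 2 ^+ L * lam)%R%:R :> R.
Proof.
move=> lam0; elim: L => [|L IH].
  by rewrite big_ord0 expr0 mul1r; case: ltP => //= h; rewrite leNgt h.
rewrite big_ord_recr /= IH.
have h1 : lam <= 2 ^+ L * lam by rewrite ler_peMl ?(ltW lam0)// exprn_ege1// ler1n.
have h2 : 2 ^+ L * lam <= 2 ^+ L.+1 * lam.
  by rewrite exprS -mulrA; move: (le_trans (ltW lam0) h1); lra.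
case: (ltP (2 ^+ L * lam) t) => h3 /=.
  by rewrite andbF add0r (le_lt_trans h1 h3).
by rewrite andbT addr0 (le_trans h3 h2) andbT.
Qed.

End geometric.

Section bform.
Context {R : realType} d1 d2 (X : measurableType d1) (Y : measurableType d2).
Variables (m1 : {sigma_finite_measure set X -> \bar R})
  (m2 : {sigma_finite_measure set Y -> \bar R}).
Hypotheses (fin1 : (m1 setT < +oo)%E) (fin2 : (m2 setT < +oo)%E).
Variable k : X * Y -> R.
Hypothesis bk : bmf k.

Definition bform (f : Y -> R) (g : X -> R) : R :=
  \int[m1]_x (g x * \int[m2]_y (k (x, y) * f y)).

Lemma bmf_op f : bmf f -> bmf (fun x => \int[m2]_y (k (x, y) * f y)).
Proof.
move=> bf; apply: (@bmf_Rint _ _ _ _ _ m2 fin2 (fun z => k z * f z.2)).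
by apply: bmfM => //; exact: bmf_snd.
Qed.

Let bk1 x f : bmf f -> bmf (fun y => k (x, y) * f y).
Proof. by move=> bf; by apply: bmfM => //; exact: bmf_pair1. Qed.

Lemma bformDl f1 f2 g : bmf f1 -> bmf f2 -> bmf g ->
  bform (fun y => f1 y + f2 y) g = bform f1 g + bform f2 g.
Proof.
move=> b1 b2 bg; rewrite /bform -(bmf_RintD fin1); last 2 first.
  exact: bmfM bg (bmf_op b1).
  exact: bmfM bg (bmf_op b2).
apply: eq_Rintegral => x _; rewrite -mulrDr -(bmf_RintD fin2); last 2 first.
  exact: bk1.
  exact: bk1.
by congr (_ * _); apply: eq_Rintegral => y _; rewrite mulrDr.
Qed.

Lemma bformDr f g1 g2 : bmf f -> bmf g1 -> bmf g2 ->
  bform f (fun x => g1 x + g2 x) = bform f g1 + bform f g2.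
Proof.
move=> bf b1 b2; rewrite /bform -(bmf_RintD fin1); last 2 first.
  exact: bmfM b1 (bmf_op bf).
  exact: bmfM b2 (bmf_op bf).
by apply: eq_Rintegral => x _; rewrite mulrDl.
Qed.

Lemma bformZ f g (u v : R) : bmf f -> bmf g ->
  bform (fun y => u * f y) (fun x => v * g x) = u * v * bform f g.
Proof.
move=> bf bg; rewrite /bform -(bmf_RintZl fin1); last exact: bmfM bg (bmf_op bf).
apply: eq_Rintegral => x _.
rewrite (_ : \int[m2]_y (k (x, y) * (u * f y)) = u * \int[m2]_y (k (x, y) * f y)).
  by ring.
under eq_Rintegral do rewrite mulrCA.
by rewrite (bmf_RintZl fin2)//; exact: bk1.
Qed.

Lemma bform_suml (I : Type) (s : seq I) (F : I -> Y -> R) g :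
  (forall i, bmf (F i)) -> bmf g ->
  bform (fun y => \sum_(i <- s) F i y) g = \sum_(i <- s) bform (F i) g.
Proof.
move=> bF bg; elim: s => [|i s IH].
  rewrite big_nil /bform; under eq_Rintegral do
    under eq_Rintegral do rewrite big_nil mulr0.
  under eq_Rintegral do rewrite /Rintegral integral0 /= mulr0.
  by rewrite /Rintegral integral0.
rewrite big_cons -IH -bformDl//; last exact: bmf_sum.
by rewrite /bform; apply: eq_Rintegral => x _; congr (_ * _); apply: eq_Rintegral => y _;
  rewrite big_cons.
Qed.

Lemma bform_abs f g : bmf f -> bmf g ->
  `|bform f g| <= \int[m1]_x \int[m2]_y (`|k (x, y)| * `|f y| * `|g x|).
Proof.
move=> bf bg; apply: le_trans (bmf_Rint_norm fin1 _) _.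
  exact: bmfM bg (bmf_op bf).
apply: (bmf_le_Rint fin1).
- by apply: bmf_norm; exact: bmfM bg (bmf_op bf).
- apply: (@bmf_Rint _ _ _ _ _ m2 fin2 (fun z => `|k z| * `|f z.2| * `|g z.1|)).
  apply: bmfM; last exact: bmf_fst (bmf_norm bg).
  by apply: bmfM; [exact: bmf_norm|exact: bmf_snd (bmf_norm bf)].
- move=> x; rewrite normrM mulrC (bmf_RintZr fin2).
    rewrite ler_wpM2r//; apply: le_trans (bmf_Rint_norm fin2 (bk1 x bf)) _.
    by under eq_Rintegral do rewrite normrM.
  by apply: bmfM; [exact: bmf_norm (bmf_pair1 x bk)|exact: bmf_norm].
Qed.

End bform.

Lemma b2R0 (R : pzRingType) : false%:R = 0 :> R. Proof. by []. Qed.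
Lemma b2R1 (R : pzRingType) : true%:R = 1 :> R. Proof. by []. Qed.

(** * Interpolation by level sets *)

Section interpolation.
Context {R : realType} d1 d2 (X : measurableType d1) (Y : measurableType d2).
Variables (m1 : {sigma_finite_measure set X -> \bar R})
  (m2 : {sigma_finite_measure set Y -> \bar R}).
Hypotheses (fin1 : (m1 setT < +oo)%E) (fin2 : (m2 setT < +oo)%E).
Variable k : X * Y -> R.
Hypothesis bk : bmf k.
Local Notation B := (bform m1 m2 k).

(** Transposing the kernel exchanges p and p', which is how exponents below 2 are reached from those
    above 2. *)
Lemma bform_swap f g : bmf f -> bmf g ->
  bform m2 m1 (fun z => k (z.2, z.1)) g f = B f g.
Proof.
move=> bf bg; rewrite /bform.
transitivity (\int[m2]_y \int[m1]_x (k (x, y) * f y * g x)).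
  apply: eq_Rintegral => y _; rewrite -(bmf_RintZl fin1).
    by apply: eq_Rintegral => x _ /=; rewrite mulrA [f y * _]mulrC.
  by apply: bmfM => //; exact: bmf_pair2.
rewrite -(@bmf_Fubini _ _ _ _ _ m1 m2 fin1 fin2 (fun z => k z * f z.2 * g z.1)); last first.
  by apply: bmfM; [apply: bmfM => //; exact: bmf_snd|exact: bmf_fst].
apply: eq_Rintegral => x _; rewrite -(bmf_RintZl fin2).
  by apply: eq_Rintegral => y _ /=; rewrite mulrC.
by apply: bmfM => //; exact: bmf_pair1.
Qed.

(** Replacing f by w^(1/2) f and g by w^(-1/2) g leaves the form unchanged and shifts the balance
    between the two integrals; this restores the strength of a product estimate. *)
Lemma bform_weight (A : R) : (forall f g, bmf f -> bmf g ->
    `|B f g| <= A * (\int[m2]_y (f y ^+ 2) + \int[m1]_x (g x ^+ 2))) ->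
  forall f g w, 0 < w -> bmf f -> bmf g ->
    `|B f g| <= A * (w * \int[m2]_y (f y ^+ 2) + w^-1 * \int[m1]_x (g x ^+ 2)).
Proof.
move=> H f g w w0 bf bg.
have s0 : 0 < Num.sqrt w by rewrite sqrtr_gt0.
have := H (fun y => Num.sqrt w * f y) (fun x => (Num.sqrt w)^-1 * g x)
  (bmfZ _ bf) (bmfZ _ bg).
rewrite bformZ// mulfV ?gt_eqF// mul1r.
under eq_Rintegral do rewrite exprMn sqr_sqrtr ?(ltW w0)//.
rewrite (bmf_RintZl fin2); last exact: bmfX.
under [X in _ + X]eq_Rintegral do rewrite exprMn exprVn sqr_sqrtr ?(ltW w0)//.
by rewrite (bmf_RintZl fin1); last exact: bmfX.
Qed.

(* f is cut into its dyadic levels lam < |f| <= 2 lam and, for each of them, g at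
   height (lam / s)^(p-1): the low part of g is paired by the L^2 bound HA, the
   high part by the trivial bound HM. *)
Section levels.
Variables (p s A M : R).
Hypotheses (p2 : 2 < p) (s0 : 0 < s) (A0 : 0 < A) (M0 : 0 < M).
(** This normalisation means M s = A^(2/p) M^(1 - 2/p), the constant that Riesz-Thorin would give
    between the L^2 bound [A] and the L^oo bound [M]. *)
Hypothesis sAM : A ^+ 2 = M ^+ 2 * powR s p.
Hypothesis HA : forall f g, bmf f -> bmf g ->
  `|B f g| <= A * (\int[m2]_y (f y ^+ 2) + \int[m1]_x (g x ^+ 2)).
Hypothesis HM : forall x, \int[m2]_y `|k (x, y)| <= M.

Let q := p / (p - 1).
Let a := p - 2.
(** On the level lam the weight in [bform_weight] is lam^(p-2) tau. Since A tau = M s and lam < |f|,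
    the f side becomes at most M s |f|^p. *)
Let tau := M * s / A.
Let C := (1 - powR 2 (- a))^-1.

Let p10 : 0 < p - 1. Proof. by move: p2; lra. Qed.
Let a0 : 0 < a. Proof. by rewrite /a; move: p2; lra. Qed.
Let tau0 : 0 < tau. Proof. by rewrite /tau divr_gt0// mulr_gt0. Qed.

Let lev (lam : R) (f : Y -> R) y := f y * (lam < `|f y| <= 2 * lam)%R%:R.
Let thr (lam : R) := powR (lam / s) (p - 1).
Let low (lam : R) (g : X -> R) x := g x * (`|g x| < thr lam)%R%:R.
Let high (lam : R) (g : X -> R) x := g x * (thr lam <= `|g x|)%R%:R.

Let bmf_lev lam f : bmf f -> bmf (lev lam f).
Proof.
move=> bf; apply: bmfM => //; apply: bmf_bool; apply: measurable_and.
  by apply: measurable_fun_ltr => //; case: (bmf_norm bf).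
by apply: measurable_fun_ler => //; case: (bmf_norm bf).
Qed.

Let bmf_low lam g : bmf g -> bmf (low lam g).
Proof. by move=> bg; apply: bmfM => //; apply: bmf_lt => //; case: (bmf_norm bg). Qed.

Let bmf_high lam g : bmf g -> bmf (high lam g).
Proof.
move=> bg; apply: bmfM => //; apply: bmf_bool.
by apply: measurable_fun_ler => //; case: (bmf_norm bg).
Qed.

Let lev_sq lam f y : 0 < lam ->
  powR lam a * tau * (lev lam f y) ^+ 2 <=
  tau * powR `|f y| p * (lam < `|f y| <= 2 * lam)%R%:R.
Proof.
move=> lam0; rewrite /lev exprMn; case: (boolP (_ < _ <= _)) => [/andP[h _]|_]; rewrite ?b2R0 ?b2R1; last first.
  by rewrite expr0n /= !mulr0.
rewrite expr1n !mulr1 mulrAC mulrC ler_wpM2l ?(ltW tau0)//.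
have f0 : 0 < `|f y| := lt_trans lam0 h.
rewrite (_ : p = a + 2); last by rewrite /a; ring.
rewrite powRD; last by rewrite (gt_eqF f0) implybT.
rewrite powR_mulrn// real_normK ?num_real// ler_wpM2r ?sqr_ge0//.
by rewrite ge0_ler_powR ?nnegrE ?normr_ge0 ?(ltW lam0) ?(ltW a0) ?(ltW h).
Qed.

(** On the high part lam <= s |g|^(1/(p-1)), while |f| <= 2 lam; hence |f| |g| <= 2 s |g|^(1/(p-1) +
    1), and that exponent is p'. *)
Let lev_high lam f g x y : 0 < lam ->
  `|lev lam f y| * `|high lam g x| <=
  (lam < `|f y| <= 2 * lam)%R%:R * (2 * s * powR `|g x| q).
Proof.
move=> lam0; rewrite /lev /high !normrM !normr_nat.
have q0 : 0 <= 2 * s * powR `|g x| q by rewrite !mulr_ge0 ?powR_ge0// ltW.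
case: (boolP (_ < _ <= _)) => [/andP[_ h]|_]; rewrite ?b2R0 ?b2R1; last by rewrite mulr0 !mul0r.
case: (boolP (thr lam <= _)) => [h2|_]; rewrite ?b2R0 ?b2R1; last by rewrite !mulr0 mul1r.
rewrite !mulr1 mul1r.
have ls0 : 0 < lam / s by rewrite divr_gt0.
have g0 : 0 < `|g x| by apply: lt_le_trans h2; rewrite powR_gt0.
have h3 : lam <= s * powR `|g x| (p - 1)^-1.
  rewrite mulrC -ler_pdivrMr//.
  have -> : lam / s = powR (thr lam) (p - 1)^-1.
    by rewrite /thr -powRrM mulfV ?gt_eqF// powRr1// ltW.
  by rewrite ge0_ler_powR ?nnegrE ?powR_ge0 ?normr_ge0 ?invr_ge0 ?(ltW p10).
have -> : q = (p - 1)^-1 + 1 by rewrite /q; field; rewrite gt_eqF.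
rewrite powRD ?(gt_eqF g0) ?implybT// powRr1// !mulrA ler_wpM2r//.
by apply: (le_trans h); rewrite -!mulrA ler_wpM2l.
Qed.

(** For a fixed x, g is low exactly on the levels above s |g|^(1/(p-1)); the weights lam^(-(p-2))
    sum there as a geometric tail, which converges because p > 2. *)
Let low_sq lam g x L : 0 < lam ->
  \sum_(i < L) (powR (2 ^+ i * lam) a * tau)^-1 * low (2 ^+ i * lam) g x ^+ 2 <=
  tau^-1 * powR s (- a) * C * powR `|g x| q.
Proof.
move=> lam0.
have C0 : 0 <= C.
  rewrite invr_ge0 subr_ge0 powRN invf_le1 ?powR_gt0//.
  by have := @ge0_ler_powR R a (ltW a0) 1 2; rewrite powR1; apply; rewrite ?nnegrE ?ler1n.
have [g0|gn0] := eqVneq (g x) 0.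
  rewrite big1 => [|i _]; last by rewrite /low g0 mul0r expr0n /= mulr0.
  by rewrite !mulr_ge0 ?powR_ge0// invr_ge0 ltW.
have g0 : 0 < `|g x| by rewrite normr_gt0.
have u0 : 0 < s * powR `|g x| (p - 1)^-1 by rewrite mulr_gt0// powR_gt0.
apply: (@le_trans _ _ (tau^-1 * `|g x| ^+ 2 *
   \sum_(i < L) powR (2 ^+ i * lam) (- a) * (s * powR `|g x| (p - 1)^-1 < 2 ^+ i * lam)%R%:R)).
  rewrite big_distrr /=; apply: ler_sum => i _.
  have l0 : 0 < 2 ^+ i * lam by rewrite mulr_gt0// exprn_gt0.
  rewrite /low exprMn invfM -powRN -(real_normK (num_real (g x))).
  rewrite [leRHS](_ : _ = powR (2 ^+ i * lam) (- a) * tau^-1 * (`|g x| ^+ 2 *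
      (s * powR `|g x| (p - 1)^-1 < 2 ^+ i * lam)%R%:R)); last by ring.
  rewrite ler_wpM2l ?mulr_ge0 ?powR_ge0 ?invr_ge0 ?(ltW tau0)// ler_wpM2l ?sqr_ge0//.
  case: (boolP (`|g x| < _)) => [h|_]; rewrite ?b2R0 ?b2R1; last by rewrite expr0n.
  rewrite expr1n (_ : (_ < _) = true)//.
  have ls0 : 0 < 2 ^+ i * lam / s by rewrite divr_gt0.
  rewrite mulrC -ltr_pdivlMr//.
  have -> : 2 ^+ i * lam / s = powR (thr (2 ^+ i * lam)) (p - 1)^-1.
    by rewrite /thr -powRrM mulfV ?gt_eqF// powRr1// ltW.
  by rewrite gt0_ltr_powR ?nnegrE ?powR_ge0 ?normr_ge0 ?invr_gt0.
apply: le_trans (ler_wpM2l _ (sum_dyadic_tail L a0 lam0 u0)) _.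
  by rewrite mulr_ge0 ?sqr_ge0// invr_ge0 ltW.
rewrite -/C powRM ?powR_ge0 ?(ltW s0)// -powRrM.
have -> : q = 2 + (p - 1)^-1 * (- a) by rewrite /q /a; field; rewrite gt_eqF.
rewrite powRD ?(gt_eqF g0) ?implybT// powR_mulrn//.
by rewrite le_eqVlt; apply/orP; left; apply/eqP; ring.
Qed.

(** The place where [sAM] acts: it gives the g side of the low part the same constant M s as the f
    side. *)
Let tau_id : A * (tau^-1 * powR s (- a)) = M * s.
Proof.
have sa : powR s p = powR s a * s ^+ 2.
  by rewrite -powR_mulrn ?(ltW s0)// -powRD ?(gt_eqF s0) ?implybT// /a subrK.
have sa0 : powR s a != 0 by rewrite gt_eqF// powR_gt0.
rewrite /tau powRN.
transitivity (A ^+ 2 / (M * s * powR s a)); first by field; rewrite sa0 !gt_eqF.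
by rewrite sAM sa; field; rewrite sa0 !gt_eqF.
Qed.

Let decomp lam f L y : 0 < lam -> `|f y| <= 2 ^+ L * lam ->
  f y = f y * (`|f y| <= lam)%R%:R + \sum_(i < L) lev (2 ^+ i * lam) f y.
Proof.
move=> lam0 fL; rewrite /lev -big_distrr /=.
under eq_bigr do rewrite mulrA -exprS.
rewrite (sum_dyadic_shells _ _ lam0) fL andbT -mulrDr.
by case: ltP => _; rewrite ?b2R0 ?b2R1 ?addr0 ?add0r mulr1.
Qed.

Let low_high lam g x : g x = low lam g x + high lam g x.
Proof.
by rewrite /low /high; case: ltP => _; rewrite ?b2R0 ?b2R1 mulr1 mulr0 ?addr0 ?add0r.
Qed.

(** At each y at most one level of f is active, so after the sums are moved inside the integrals the
    number of levels costs nothing and the L^oo bound [M] applies once. *)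
Let part_high lam f g L : 0 < lam -> bmf f -> bmf g ->
  `|\sum_(i < L) B (lev (2 ^+ i * lam) f) (high (2 ^+ i * lam) g)| <=
  2 * (M * s) * \int[m1]_x powR `|g x| q.
Proof.
move=> lam0 bf bg.
have q0 : 0 <= q by rewrite /q divr_ge0 ?(ltW p10)//; move: p2; lra.
have bgq : bmf (fun x => powR `|g x| q) by exact: bmf_powR.
apply: le_trans (ler_norm_sum _ _ _) _.
apply: (@le_trans _ _ (\sum_(i < L) \int[m1]_x \int[m2]_y
   (`|k (x, y)| * `|lev (2 ^+ i * lam) f y| * `|high (2 ^+ i * lam) g x|))).
  by apply: ler_sum => i _; apply: bform_abs => //; [exact: bmf_lev|exact: bmf_high].
have bG i : bmf (fun z : X * Y => `|k z| * `|lev (2 ^+ i * lam) f z.2| * `|high (2 ^+ i * lam) g z.1|).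
  apply: bmfM; last exact: bmf_fst (bmf_norm (bmf_high _ bg)).
  by apply: bmfM; [exact: bmf_norm|exact: bmf_snd (bmf_norm (bmf_lev _ bf))].
rewrite -(bmf_Rint_sum fin1); last first.
  by move=> i; exact: (bmf_Rint fin2 (bG i)).
rewrite -(bmf_RintZl fin1)//; apply: (bmf_le_Rint fin1).
- by apply: bmf_sum => i; exact: (bmf_Rint fin2 (bG i)).
- exact: bmfZ.
move=> x; rewrite -(bmf_Rint_sum fin2); last first.
  by move=> i; exact: (bmf_pair1 x (bG i)).
apply: (@le_trans _ _ (\int[m2]_y (`|k (x, y)| * (2 * s * powR `|g x| q)))).
  apply: (bmf_le_Rint fin2).
  - by apply: bmf_sum => i; exact: (bmf_pair1 x (bG i)).
  - by apply: bmfM; [exact: bmf_norm (bmf_pair1 x bk)|exact: bmf_cst].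
  move=> y; under eq_bigr do rewrite -mulrA.
  rewrite -big_distrr /= ler_wpM2l//.
  apply: (@le_trans _ _ (\sum_(i < L) (2 ^+ i * lam < `|f y| <= 2 ^+ i.+1 * lam)%R%:R *
     (2 * s * powR `|g x| q))).
    apply: ler_sum => i _; rewrite exprS -mulrA; apply: lev_high.
    by rewrite mulr_gt0// exprn_gt0.
  rewrite -big_distrl /= (sum_dyadic_shells _ _ lam0) ler_piMl//.
    by rewrite !mulr_ge0 ?powR_ge0// ltW.
  by case: (_ && _).
rewrite (bmf_RintZr fin2); last exact: bmf_norm (bmf_pair1 x bk).
rewrite [leRHS](_ : _ = M * (2 * s * powR `|g x| q)); last by ring.
by rewrite ler_wpM2r// !mulr_ge0 ?powR_ge0// ltW.
Qed.

Let part_low lam f g L : 0 < lam -> bmf f -> bmf g ->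
  `|\sum_(i < L) B (lev (2 ^+ i * lam) f) (low (2 ^+ i * lam) g)| <=
  M * s * \int[m2]_y powR `|f y| p + C * (M * s) * \int[m1]_x powR `|g x| q.
Proof.
move=> lam0 bf bg.
have q0 : 0 <= q by rewrite /q divr_ge0 ?(ltW p10)//; move: p2; lra.
have p0 : 0 <= p by move: p2; lra.
have li0 i : 0 < 2 ^+ i * lam by rewrite mulr_gt0// exprn_gt0.
have bgq : bmf (fun x => powR `|g x| q) by exact: bmf_powR.
have bfp : bmf (fun x => powR `|f x| p) by exact: bmf_powR.
apply: le_trans (ler_norm_sum _ _ _) _.
apply: (@le_trans _ _ (\sum_(i < L) A *
   (powR (2 ^+ i * lam) a * tau * (\int[m2]_y lev (2 ^+ i * lam) f y ^+ 2) +
    (powR (2 ^+ i * lam) a * tau)^-1 * (\int[m1]_x low (2 ^+ i * lam) g x ^+ 2)))).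
  apply: ler_sum => i _; apply: bform_weight => //.
  - by rewrite mulr_gt0// powR_gt0.
  - exact: bmf_lev.
  - exact: bmf_low.
rewrite -big_distrr /= big_split /= mulrDr; apply: lerD.
  have -> : M * s = A * tau by rewrite /tau; field; rewrite gt_eqF.
  rewrite -[leRHS]mulrA ler_wpM2l ?(ltW A0)// -(bmf_RintZl fin2 tau bfp).
  rewrite (_ : \sum_(i < L) _ = \int[m2]_y \sum_(i < L) (powR (2 ^+ i * lam) a * tau) * lev (2 ^+ i * lam) f y ^+ 2); last first.
    rewrite (bmf_Rint_sum fin2); last by move=> i; exact: (bmfZ _ (bmfX _ (bmf_lev _ bf))).
    by apply: eq_bigr => i _; rewrite (bmf_RintZl fin2)//; exact: (bmfX _ (bmf_lev _ bf)).
  apply: (bmf_le_Rint fin2).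
  - by apply: bmf_sum => i; exact: (bmfZ _ (bmfX _ (bmf_lev _ bf))).
  - exact: bmfZ.
  move=> y; apply: (@le_trans _ _ (\sum_(i < L) tau * powR `|f y| p *
      (2 ^+ i * lam < `|f y| <= 2 ^+ i.+1 * lam)%R%:R)).
    by apply: ler_sum => i _; rewrite [2 ^+ i.+1]exprS -[2 * _ * lam]mulrA; exact: lev_sq.
  rewrite -big_distrr /= (sum_dyadic_shells _ _ lam0) ler_piMr//.
    by rewrite mulr_ge0 ?powR_ge0// ltW.
  by case: (_ && _).
rewrite -tau_id [leRHS](_ : _ = A * (tau^-1 * powR s (- a) * C * \int[m1]_x powR `|g x| q)); last by ring.
rewrite ler_wpM2l ?(ltW A0)// -(bmf_RintZl fin1 _ bgq).
rewrite (_ : \sum_(i < L) _ = \int[m1]_x \sum_(i < L) (powR (2 ^+ i * lam) a * tau)^-1 * low (2 ^+ i * lam) g x ^+ 2); last first.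
  rewrite (bmf_Rint_sum fin1); last by move=> i; exact: (bmfZ _ (bmfX _ (bmf_low _ bg))).
  by apply: eq_bigr => i _; rewrite (bmf_RintZl fin1)//; exact: (bmfX _ (bmf_low _ bg)).
apply: (bmf_le_Rint fin1).
- by apply: bmf_sum => i; exact: (bmfZ _ (bmfX _ (bmf_low _ bg))).
- exact: bmfZ.
by move=> x; exact: low_sq.
Qed.

Lemma interp_levels f g : bmf f -> bmf g ->
  `|B f g| <= (C + 2) * (M * s) * (\int[m2]_y powR `|f y| p + \int[m1]_x powR `|g x| q).
Proof.
move=> bf bg.
have q0 : 0 <= q by rewrite /q divr_ge0 ?(ltW p10)//; move: p2; lra.
have p0 : 0 <= p by move: p2; lra.
have [F F0 fF] := bmf_bound bf.
pose K := \int[m1]_x \int[m2]_y (`|k (x, y)| * `|g x|).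
have bK : bmf (fun z : X * Y => `|k z| * `|g z.1|).
  by apply: bmfM; [exact: bmf_norm|exact: bmf_fst (bmf_norm bg)].
have C0 : 0 <= C.
  rewrite invr_ge0 subr_ge0 powRN invf_le1 ?powR_gt0//.
  by have := @ge0_ler_powR R a (ltW a0) 1 2; rewrite powR1; apply; rewrite ?nnegrE ?ler1n.
set I1 := \int[m2]_y _; set I2 := \int[m1]_x _.
have I10 : 0 <= I1 by apply: Rintegral_ge0 => x _; exact: powR_ge0.
have I20 : 0 <= I2 by apply: Rintegral_ge0 => x _; exact: powR_ge0.
(* The part |f| <= lam lies below all levels and is bounded by lam [K], with [K] independent of lam;
   letting lam tend to 0 removes it. *)
suff H lam : 0 < lam -> `|B f g| <= lam * K + (C + 2) * (M * s) * (I1 + I2).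
  apply/ler_addgt0Pr => e e0; have [K0|K0] := leP K 0.
    apply: le_trans (H 1 ltr01) _; rewrite mul1r; move: K0 e0; lra.
  apply: le_trans (H (e / K) (divr_gt0 e0 K0)) _.
  by rewrite divfK ?gt_eqF// addrC.
move=> lam0.
(* As f is bounded, finitely many dyadic levels above lam cover its range. *)
have [L FL] : exists L : nat, F <= 2 ^+ L * lam.
  have [L hL] : exists L : nat, F / lam <= L%:R.
    by exists (Num.bound (F / lam)); rewrite ltW// archi_boundP// divr_ge0// ltW.
  exists L; rewrite -ler_pdivrMr// (le_trans hL)//.
  by rewrite -natrX ler_nat ltnW// ltn_expl.
pose f0 y := f y * (`|f y| <= lam)%R%:R.
have bf0 : bmf f0.
  apply: bmfM => //; apply: bmf_bool; apply: measurable_fun_ler => //.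
  by case: (bmf_norm bf).
have -> : B f g = B f0 g + (\sum_(i < L) B (lev (2 ^+ i * lam) f) (high (2 ^+ i * lam) g) +
    \sum_(i < L) B (lev (2 ^+ i * lam) f) (low (2 ^+ i * lam) g)).
  rewrite -big_split /=.
  transitivity (B (fun y => f0 y + \sum_(i < L) lev (2 ^+ i * lam) f y) g).
    congr (bform m1 m2 k _ g); apply/funext => y; rewrite -decomp//.
    exact: le_trans (fF y) FL.
  rewrite bformDl//; last by apply: bmf_sum => i; exact: bmf_lev.
  congr (_ + _).
  rewrite bform_suml//; last by move=> i; exact: bmf_lev.
  apply: eq_bigr => i _; rewrite -bformDr//.
  - by congr (bform m1 m2 k _ _); apply/funext => x; rewrite addrC -low_high.
  - exact: bmf_lev.
  - exact: bmf_high.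
  - exact: bmf_low.
apply: le_trans (ler_normD _ _) _; apply: lerD.
  apply: le_trans (bform_abs fin1 fin2 bk bf0 bg) _.
  rewrite -(bmf_RintZl fin1); last exact: (bmf_Rint fin2 bK).
  apply: (bmf_le_Rint fin1).
  - apply: (@bmf_Rint _ _ _ _ _ m2 fin2 (fun z => `|k z| * `|f0 z.2| * `|g z.1|)).
    apply: bmfM; last exact: bmf_fst (bmf_norm bg).
    by apply: bmfM; [exact: bmf_norm|exact: bmf_snd (bmf_norm bf0)].
  - exact: bmfZ _ (bmf_Rint fin2 bK).
  move=> x; rewrite -(bmf_RintZl fin2); last exact: (bmf_pair1 x bK).
  apply: (bmf_le_Rint fin2).
  - apply: bmfM; last exact: bmf_cst.
    by apply: bmfM; [exact: bmf_norm (bmf_pair1 x bk)|exact: bmf_norm bf0].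
  - exact: bmfZ _ (bmf_pair1 x bK).
  move=> y; rewrite mulrAC mulrC ler_wpM2r ?mulr_ge0// /f0.
  by case: (leP `|f y| lam) => h; rewrite ?b2R0 ?b2R1 ?mulr1// mulr0 normr0 ltW.
apply: le_trans (ler_normD _ _) _.
apply: le_trans (lerD (part_high L lam0 bf bg) (part_low L lam0 bf bg)) _.
rewrite -/I1 -/I2 -subr_ge0.
have MS : 0 <= M * s by rewrite mulr_ge0// ltW.
rewrite [leRHS](_ : _ = (C + 1) * (M * s) * I1); last by ring.
by apply: mulr_ge0 => //; apply: mulr_ge0 => //; apply: addr_ge0.
Qed.

End levels.
End interpolation.

(** * Oscillatory integrals in one variable *)

Section one_dimensional.
Context {R : realType}.
Local Notation mu := (@lebesgue_measure R).

Lemma within_itvcc_continuous (f : R -> R) (lo hi : R) :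
  (forall x, lo <= x <= hi -> {for x, continuous f}) -> {within `[lo, hi], continuous f}.
Proof.
move=> cf; apply: continuous_in_subspaceT => x.
by rewrite inE/= in_itv/= => xlohi; exact: cf.
Qed.

Lemma Rintegral_FTC (F f : R -> R) (lo hi : R) : lo <= hi ->
  (forall x, lo <= x <= hi -> is_derive x 1 F (f x)) ->
  (forall x, lo <= x <= hi -> {for x, continuous f}) ->
  \int[mu]_(x in `[lo, hi]) f x = F hi - F lo.
Proof.
rewrite le_eqVlt => /predU1P[<- _ _|lh dF cf].
  by rewrite set_itv1 Rintegral_set1 subrr.
have cF x : lo <= x <= hi -> {for x, continuous F}.
  by move=> /dF dFx; apply: differentiable_continuous; apply/derivable1_diffP; case: dFx.
rewrite /Rintegral (@continuous_FTC2 _ f F) //.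
- exact: within_itvcc_continuous.
- split.
  + move=> x; rewrite in_itv/= => /andP[h1 h2].
    have xlh : lo <= x <= hi by rewrite !ltW.
    by case: (dF x xlh).
  + by apply: cvg_at_right_filter; apply: cF; rewrite lexx ltW.
  + by apply: cvg_at_left_filter; apply: cF; rewrite lexx ltW.
- move=> x; rewrite in_itv/= => /andP[h1 h2].
  have xlh : lo <= x <= hi by rewrite !ltW.
  by rewrite derive1E; have [_ ->] := dF x xlh.
Qed.

Lemma itvcc_integrable (f : R -> R) (lo hi : R) :
  (forall x, lo <= x <= hi -> {for x, continuous f}) ->
  mu.-integrable `[lo, hi] (EFin \o f).
Proof.
move=> cf; apply: continuous_compact_integrable; first exact: segment_compact.
exact: within_itvcc_continuous.
Qed.

Lemma Rintegral_itvcc_bound (f : R -> R) (lo hi M : R) : lo <= hi ->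
  (forall x, lo <= x <= hi -> {for x, continuous f}) ->
  (forall x, lo <= x <= hi -> `|f x| <= M) ->
  `|\int[mu]_(x in `[lo, hi]) f x| <= M * (hi - lo).
Proof.
move=> lh cf fM; apply: le_trans (le_normr_Rintegral _ _) _ => //.
  exact: itvcc_integrable.
have -> : M * (hi - lo) = \int[mu]_(x in `[lo, hi]) M.
  have h : mu `[lo, hi]%classic = (hi - lo)%:E.
    rewrite lebesgue_measure_itv /= lte_fin; case: ltP => //= h.
    by congr (_%:E); apply/esym/eqP; rewrite subr_eq0 eq_le h lh.
  by rewrite Rintegral_cst//; congr (_ * _); rewrite [X in fine X]h.
apply: le_Rintegral => //.
- apply: itvcc_integrable => x /cf cx.
  by apply: continuous_comp => //; exact: norm_continuous.
- by apply: itvcc_integrable => x _; exact: cvg_cst.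
Qed.

(** Nonstationary phase: b sin Q / Q' has derivative b cos Q plus a remainder without cosine. The
    endpoints give 2 B / q and the remainder gives the rest; the bound on Q'' stands in for the
    monotonicity of Q' in the van der Corput lemma. *)
Lemma oscillatory_ibp (lo hi : R) (b b1 Q Q1 Q2 : R -> R) (q q2 B B1 : R) :
  lo <= hi -> 0 < q -> 0 <= B -> 
  (forall t, lo <= t <= hi -> is_derive t 1 b (b1 t)) ->
  (forall t, lo <= t <= hi -> is_derive t 1 Q (Q1 t)) ->
  (forall t, lo <= t <= hi -> is_derive t 1 Q1 (Q2 t)) ->
  (forall t, lo <= t <= hi -> {for t, continuous b1}) ->
  (forall t, lo <= t <= hi -> {for t, continuous Q2}) ->
  (forall t, lo <= t <= hi -> q <= `|Q1 t|) ->
  (forall t, lo <= t <= hi -> `|Q2 t| <= q2) ->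
  (forall t, lo <= t <= hi -> `|b t| <= B) ->
  (forall t, lo <= t <= hi -> `|b1 t| <= B1) ->
  `|\int[mu]_(t in `[lo, hi]) (b t * cos (Q t))|
     <= 2 * B / q + (hi - lo) * (B1 / q + B * q2 / q ^+ 2).
Proof.
move=> lh q0 B0 db dQ dQ1 cb1 cQ2 Q1q Q2q bB b1B.
have Q1n0 t : lo <= t <= hi -> Q1 t != 0.
  by move=> /Q1q; apply: contraTneq => ->; rewrite normr0 -ltNge.
have cder (f f1 : R -> R) : (forall t, lo <= t <= hi -> is_derive t 1 f (f1 t)) ->
    forall t, lo <= t <= hi -> {for t, continuous f}.
  move=> df t /df dft.
  by apply: differentiable_continuous; apply/derivable1_diffP; case: dft.
have cb := cder _ _ db; have cQ := cder _ _ dQ; have cQ1 := cder _ _ dQ1.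
pose G t := b t * sin (Q t) / Q1 t.
pose rest t := (b1 t / Q1 t - b t * Q2 t / Q1 t ^+ 2) * sin (Q t).
have dG t : lo <= t <= hi -> is_derive t 1 G (b t * cos (Q t) + rest t).
  move=> tlh; have n0 := Q1n0 _ tlh.
  have h1 := db _ tlh; have h2 := dQ _ tlh; have h3 := dQ1 _ tlh.
  have h4 : is_derive t 1 (fun t => sin (Q t)) (Q1 t * cos (Q t)).
    have := @is_derive1_comp _ sin Q t (cos (Q t)) (Q1 t) _ h2.
    by rewrite mulrC; apply; exact: is_derive_sin.
  have h5 : is_derive t 1 (fun t => (Q1 t)^-1) (- Q2 t / Q1 t ^+ 2).
    have := @is_deriveV _ Q1 t (Q2 t) 1 n0 h3.
    by move=> h; apply: is_derive_eq h _; rewrite /GRing.scale /=; ring.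
  have h6 := is_deriveM (is_deriveM h1 h4) h5.
  rewrite /G; apply: is_derive_eq h6 _.
  have -> : (b * (fun u : R => sin (Q u))) t = b t * sin (Q t) by [].
  rewrite /rest /GRing.scale /=; field.
  exact: n0.
have cG t : lo <= t <= hi -> {for t, continuous (fun t => b t * cos (Q t))}.
  move=> tlh; apply: continuousM; first exact: cb.
  by apply: continuous_comp; [exact: cQ|exact: continuous_cos].
have crest t : lo <= t <= hi -> {for t, continuous rest}.
  move=> tlh; apply: continuousM; last first.
    by apply: continuous_comp; [exact: cQ|exact: continuous_sin].
  have cV : {for t, continuous (fun t => (Q1 t)^-1)}.
    by apply: continuousV; [exact: Q1n0|exact: cQ1].
  apply: continuousB.
    by apply: continuousM; [exact: cb1|exact: cV].
  apply: continuousM; first by apply: continuousM; [exact: cb|exact: cQ2].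
  have -> : (fun t => (Q1 t ^+ 2)^-1) = (fun t => (Q1 t)^-1 * (Q1 t)^-1).
    by apply/funext => u; rewrite expr2 invfM.
  by apply: continuousM; exact: cV.
have E : \int[mu]_(t in `[lo, hi]) (b t * cos (Q t)) =
   G hi - G lo - \int[mu]_(t in `[lo, hi]) rest t.
  rewrite -(Rintegral_FTC lh dG); last first.
    by move=> t tlh; apply: continuousD; [exact: cG|exact: crest].
  rewrite RintegralD ?addrK//; exact: itvcc_integrable.
have GB t : lo <= t <= hi -> `|G t| <= B / q.
  move=> tlh; rewrite /G !normrM normfV ler_pM//.
    rewrite -[leRHS]mulr1 ler_pM ?bB//.
    exact: sin_max.
  by rewrite lef_pV2 ?posrE ?normr_gt0 ?Q1n0// Q1q.
rewrite E; apply: le_trans (ler_normB _ _) _; apply: lerD.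
  apply: le_trans (ler_normB _ _) _.
  rewrite [leRHS](_ : _ = B / q + B / q); last by field; rewrite gt_eqF.
  by rewrite lerD// GB// lexx lh.
rewrite mulrC; apply: Rintegral_itvcc_bound => // t tlh.
rewrite /rest normrM -[leRHS]mulr1 ler_pM//; last first.
  exact: sin_max.
apply: le_trans (ler_normB _ _) _.
have qi : `|(Q1 t)^-1| <= q^-1.
  by rewrite normfV lef_pV2 ?posrE ?normr_gt0 ?Q1n0// Q1q.
apply: lerD; rewrite !normrM; first by rewrite ler_pM ?b1B.
by rewrite ler_pM ?mulr_ge0// ?ler_pM ?bB ?Q2q// -exprVn normrX -exprVn lerXn2r ?nnegrE ?invr_ge0 ?(ltW q0).
Qed.

End one_dimensional.

(** * Lebesgue measure restricted to an interval *)

Section restricted_lebesgue.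
Context {R : realType}.
Local Notation mu := (@lebesgue_measure R).

Lemma lebesgue_itvco_fin (rho : R) :
  ((mu : set (measurableTypeR R) -> \bar R) `[(- rho)%R, rho[%classic < +oo)%E.
Proof.
by rewrite lebesgue_measure_itv /=; case: ifP => _; rewrite ltry.
Qed.

(* The restriction makes every bounded measurable function integrable. *)
Definition bmu (rho : R) : {sigma_finite_measure set (measurableTypeR R) -> \bar R} :=
  @mfrestr _ (measurableTypeR R) R _ mu (measurable_itv `[(- rho)%R, rho[) (lebesgue_itvco_fin rho).

Lemma bmuE rho A : bmu rho A = mu (A `&` `[(- rho)%R, rho[%classic).
Proof. by []. Qed.

Lemma bmu_fin rho : (bmu rho setT < +oo)%E.
Proof. by rewrite bmuE setTI lebesgue_itvco_fin. Qed.

Lemma bmu_le rho A : measurable A -> (bmu rho A <= mu A)%E.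
Proof.
by move=> mA; rewrite bmuE le_measure ?inE//; apply: measurableI.
Qed.

Lemma ge0_integral_bmu rho (f : R -> \bar R) : measurable_fun setT f -> (forall x, 0 <= f x)%E ->
  (\int[bmu rho]_x f x = \int[mu]_(x in `[(- rho)%R, rho[) f x)%E.
Proof.
move=> mf f0; set D := `[(- rho)%R, rho[%classic.
have mD : measurable (D : set (measurableTypeR R)) by exact: measurable_itv.
have mfD A : measurable_fun A (f : measurableTypeR R -> \bar R) by exact: measurable_funTS.
rewrite -(setUv D) ge0_integral_setU//=; last 2 first.
- exact: measurableC.
- by apply/disj_setPS => x [].
rewrite [X in (_ + X)%E](_ : _ = 0%E).
  rewrite adde0; apply: eq_measure_integral => A mA AD.
  by transitivity (mu (A `&` D)) => //; rewrite setIidl.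
apply: null_set_integral => //; first exact: measurableC.
by transitivity (mu (~` D `&` D)) => //; rewrite setICl measure0.
Qed.

Lemma integral_bmu rho (f : R -> \bar R) : measurable_fun setT f ->
  (\int[bmu rho]_x f x = \int[mu]_(x in `[(- rho)%R, rho[) f x)%E.
Proof.
move=> mf; rewrite integralE [in RHS]integralE !ge0_integral_bmu//.
  exact: measurable_funeneg.
exact: measurable_funepos.
Qed.

Lemma Rintegral_bmu_indic rho c l (f : R -> R) : 0 < l -> - rho <= c -> c + l <= rho ->
  measurable_fun setT f ->
  \int[bmu rho]_x ((c <= x < c + l)%R%:R * f x) = \int[mu]_(x in `[c, c + l]) f x.
Proof.
move=> l0 h1 h2 mf.
transitivity (\int[mu]_(x in `[c, (c + l)[) f x); last first.
  rewrite /Rintegral integral_itv_bndo_bndc//.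
  exact/measurable_EFinP/measurable_funTS.
rewrite [RHS]Rintegral_mkcond [LHS]/Rintegral integral_bmu; last first.
  apply/measurable_EFinP; apply: measurable_funM => //.
  case: (@bmf_bool R _ (measurableTypeR R) (fun x : R => (c <= x < c + l)%R)) => //.
  apply: measurable_and; first exact: measurable_fun_ler.
  exact: measurable_fun_ltr.
rewrite integral_mkcond /Rintegral; congr fine; apply: eq_integral => x _.
rewrite !patchE; case: ifPn => h.
  case: ifPn => h'; move: h'; rewrite ?notin_setE ?inE/= in_itv/=.
    by move=> ->; rewrite mul1r.
  by move=> /negP/negbTE ->; rewrite mul0r.
case: ifPn => // h'; exfalso; move: h h'; rewrite notin_setE inE/= !in_itv/=.
by move=> h /andP[h3 h4]; apply: h; rewrite (le_trans h1 h3) (lt_le_trans h4 h2).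
Qed.

(** The integrand stands for min(1, 1 / (nu |s - x|)), which it matches up to a factor 2, and it has
    an explicit primitive on each side of s. The logarithm found here is what forces k < 1 later. *)
Lemma Rintegral_log (nu c l s : R) : 0 < nu -> c <= s <= c + l ->
  \int[mu]_(x in `[c, c + l]) (1 + nu * `|s - x|)^-1 <= 2 * ln (1 + nu * l) / nu.
Proof.
move=> nu0 /andP[cs sl].
have l0 : 0 <= l by move: cs sl; lra.
have pos x : 0 < 1 + nu * `|s - x| by rewrite ltr_pwDl// mulr_ge0// ltW.
have cf (g : R -> R) x : {for x, continuous g} -> 0 < g x -> {for x, continuous (fun x => (g x)^-1)}.
  by move=> cg g0; apply: continuousV => //; rewrite gt_eqF.
have lin (u v x : R) : is_derive x 1 (fun x => u + nu * (v * x)) (nu * v).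
  have -> : (fun x => u + nu * (v * x)) = cst u + (nu * v) \*: id.
    by apply/funext => y; rewrite mulrA.
  have h := is_deriveD (is_derive_cst u x 1) (is_deriveZ (nu * v) (is_derive_id x 1)).
  by apply: is_derive_eq h _; rewrite add0r /GRing.scale /= mulr1.
have dl (u v x : R) : 0 < u + nu * (v * x) ->
    is_derive x 1 (fun x => nu^-1 * (v * ln (u + nu * (v * x)))) (v * v * (u + nu * (v * x))^-1).
  move=> p.
  have h := @is_derive1_comp _ (@ln R) (fun x => u + nu * (v * x)) x _ _ (is_derive1_ln p) (lin u v x).
  have h2 : is_derive x 1 (fun x => ln (u + nu * (v * x))) ((u + nu * (v * x))^-1 * (nu * v)) by exact: h.
  have -> : (fun x => nu^-1 * (v * ln (u + nu * (v * x)))) =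
     (nu^-1 * v) \*: (fun x => ln (u + nu * (v * x))).
    by apply/funext => y; rewrite [LHS]mulrA.
  apply: is_derive_eq (is_deriveZ _ h2) _.
  by rewrite /GRing.scale /=; field; rewrite !gt_eqF.
have cl (u v x : R) : {for x, continuous (fun x => u + nu * (v * x))}.
  apply: differentiable_continuous; apply/derivable1_diffP.
  by case: (lin u v x).
have contf x : {for x, continuous (fun x => (1 + nu * `|s - x|)^-1)}.
  apply: cf => //; apply: continuousD; first exact: cvg_cst.
  apply: continuousM; first exact: cvg_cst.
  apply: continuous_comp; last exact: norm_continuous.
  by apply: continuousB; [exact: cvg_cst|exact: cvg_id].
have iA lo hi : mu.-integrable `[lo, hi] (EFin \o (fun x => (1 + nu * `|s - x|)^-1)).
  by apply: itvcc_integrable => x _; exact: contf.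
(* The sign v = -1 or 1 treats the left and the right of s with one primitive. *)
have ic (v lo hi : R) (u : R) : lo <= hi -> v ^+ 2 = 1 -> (forall x, lo <= x <= hi -> 0 < u + nu * (v * x)) ->
    \int[mu]_(x in `[lo, hi]) (u + nu * (v * x))^-1 =
    nu^-1 * (v * ln (u + nu * (v * hi))) - nu^-1 * (v * ln (u + nu * (v * lo))).
  move=> lohi v1 p.
  apply: (@Rintegral_FTC _ (fun x => nu^-1 * (v * ln (u + nu * (v * x))))) => //.
    by move=> x /p px; have := dl u v x px; rewrite -expr2 v1 mul1r.
  by move=> x /p px; exact: cf.
have -> : \int[mu]_(x in `[c, c + l]) (1 + nu * `|s - x|)^-1 =
   \int[mu]_(x in `[c, s]) (1 + nu * `|s - x|)^-1 + \int[mu]_(x in `[s, c + l]) (1 + nu * `|s - x|)^-1.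
  rewrite -(@Rintegral_itv_obnd_cbnd _ s (BRight (c + l))); last first.
    apply: integrableS (iA s (c + l)) => //; exact: subset_itv_oc_cc.
  rewrite -Rintegral_setU//.
  - congr (Rintegral _ _ _); apply/seteqP; split => x /=; rewrite !in_itv/=.
      by move=> /andP[h1 h2]; case: (leP x s) => h3; [left|right]; apply/andP.
    by case => /andP[h1 h2]; apply/andP; split => //; [exact: le_trans h2 sl|exact: le_trans cs (ltW h1)].
  - apply: integrableS (iA c (c + l)) => //.
      by apply: measurableU; exact: measurable_itv.
    move=> x /=; rewrite !in_itv/= => -[] /andP[h1 h2]; apply/andP; split => //.
      exact: le_trans h2 sl.
    exact: le_trans cs (ltW h1).
  - apply/disj_setPS => x /= [/=]; rewrite !in_itv/= => /andP[_ h1] /andP[h2 _].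
    by move: (lt_le_trans h2 h1); rewrite ltxx.
have -> : \int[mu]_(x in `[c, s]) (1 + nu * `|s - x|)^-1 = \int[mu]_(x in `[c, s]) (1 + nu * s + nu * (- 1 * x))^-1.
  apply: eq_Rintegral => x; rewrite inE/= in_itv/= => /andP[_ h].
  by rewrite ger0_norm ?subr_ge0//; congr (_^-1); ring.
have -> : \int[mu]_(x in `[s, c + l]) (1 + nu * `|s - x|)^-1 = \int[mu]_(x in `[s, c + l]) (1 - nu * s + nu * (1 * x))^-1.
  apply: eq_Rintegral => x; rewrite inE/= in_itv/= => /andP[h _].
  by rewrite distrC ger0_norm ?subr_ge0//; congr (_^-1); ring.
rewrite ic//; last 2 first.
- by rewrite sqrrN expr1n.
- by move=> x /andP[h1 h2]; have := pos x; rewrite ger0_norm ?subr_ge0//; congr (0 < _); ring.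
rewrite ic//; last 2 first.
- by rewrite expr1n.
- by move=> x /andP[h1 h2]; have := pos x; rewrite distrC ger0_norm ?subr_ge0//; congr (0 < _); ring.
have lnm (x y : R) : 0 < x -> x <= y -> ln x <= ln y.
  by move=> x0 xy; rewrite ler_ln ?posrE// (lt_le_trans x0 xy).
rewrite (_ : 1 + nu * s + nu * (- 1 * s) = 1); last by ring.
rewrite (_ : 1 - nu * s + nu * (1 * s) = 1); last by ring.
rewrite (_ : 1 + nu * s + nu * (- 1 * c) = 1 + nu * (s - c)); last by ring.
rewrite (_ : 1 - nu * s + nu * (1 * (c + l)) = 1 + nu * (c + l - s)); last by ring.
rewrite ln1 !mulr0 sub0r subr0 mulN1r mulrN opprK mul1r -mulrDr mulrC ler_pM2r ?invr_gt0//.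
rewrite [leRHS](_ : _ = ln (1 + nu * l) + ln (1 + nu * l)); last by ring.
by apply: lerD; apply: lnm; rewrite ?ltr_pwDl ?mulr_ge0 ?lerD2l ?ler_wpM2l ?(ltW nu0)//; move: cs sl; lra.
Qed.

End restricted_lebesgue.

(** * The L^2 bound in one pair of variables *)

Section TTstar.
Context {R : realType} d1 d2 (X : measurableType d1) (Y : measurableType d2).
Variables (m1 : {sigma_finite_measure set X -> \bar R})
  (m2 : {sigma_finite_measure set Y -> \bar R}).
Hypotheses (fin1 : (m1 setT < +oo)%E) (fin2 : (m2 setT < +oo)%E).

Lemma sqr_Rintegral (f : Y -> R) : bmf f ->
  (\int[m2]_y f y) ^+ 2 = \int[m2]_y \int[m2]_z (f y * f z).
Proof.
move=> bf; rewrite expr2 -(bmf_RintZr fin2)//.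
by apply: eq_Rintegral => y _; rewrite (bmf_RintZl fin2).
Qed.

Variables (kc ks : X * Y -> R).
Hypotheses (bkc : bmf kc) (bks : bmf ks).

(* The real part of the kernel of T^*T, for T with kernel kc + i ks. *)
Definition ttker (y z : Y) := \int[m1]_x (kc (x, y) * kc (x, z) + ks (x, y) * ks (x, z)).

Variable N : R.
Hypothesis HN : forall y, \int[m2]_z `|ttker y z| <= N.

Lemma ttkerC y z : ttker y z = ttker z y.
Proof. by apply: eq_Rintegral => x _; rewrite mulrC [ks _ * _]mulrC. Qed.

Let bcomp (k : X * Y -> R) d (T : measurableType d) (u : T -> X) (v : T -> Y) :
  bmf k -> measurable_fun setT u -> measurable_fun setT v -> bmf (fun t => k (u t, v t)).
Proof.
by move=> bk mu mv; apply: (@bmf_comp _ _ _ _ _ (fun t => (u t, v t)) k) => //; exact: measurable_fun_pair.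
Qed.

Lemma bmf_ttker : bmf (fun z : Y * Y => ttker z.1 z.2).
Proof.
apply: (@bmf_Rint _ _ _ _ _ m1 fin1 (fun w : (Y * Y) * X =>
   kc (w.2, w.1.1) * kc (w.2, w.1.2) + ks (w.2, w.1.1) * ks (w.2, w.1.2))).
have m1' : measurable_fun setT (fun w : (Y * Y) * X => w.1.1).
  exact: measurableT_comp measurable_fst measurable_fst.
have m2' : measurable_fun setT (fun w : (Y * Y) * X => w.1.2).
  exact: measurableT_comp measurable_snd measurable_fst.
by apply: bmfD; apply: bmfM; apply: bcomp.
Qed.

(** Schur's test: the squares are expanded, Fubini brings out [ttker], then h(y) h(z) is bounded by
    (h(y)^2 + h(z)^2) / 2 and the two halves agree by symmetry of the kernel. For a real h the
    antisymmetric imaginary part of the kernel contributes nothing. *)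
Lemma TTstar h : bmf h ->
  \int[m1]_x ((\int[m2]_y (kc (x, y) * h y)) ^+ 2 + (\int[m2]_y (ks (x, y) * h y)) ^+ 2)
    <= N * \int[m2]_y (h y ^+ 2).
Proof.
move=> bh.
pose F (x : X) (y z : Y) := (kc (x, y) * kc (x, z) + ks (x, y) * ks (x, z)) * (h y * h z).
have bF d (T : measurableType d) (u : T -> X) (v w : T -> Y) : measurable_fun setT u ->
    measurable_fun setT v -> measurable_fun setT w -> bmf (fun t => F (u t) (v t) (w t)).
  move=> mu mv mw; apply: bmfM; last by apply: bmfM; exact: bmf_comp bh.
  by apply: bmfD; apply: bmfM; exact: bcomp.
have bkh (k : X * Y -> R) x : bmf k -> bmf (fun y => k (x, y) * h y).
  by move=> bk; apply: bmfM => //; exact: bmf_pair1.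
have btt : bmf (fun z : Y * Y => `|ttker z.1 z.2|) by exact: bmf_norm bmf_ttker.
have mt1 y : measurable_fun [set: Y] (fun z => ttker y z).
  by case: (bmf_pair1 y bmf_ttker).
have E1 : \int[m1]_x ((\int[m2]_y (kc (x, y) * h y)) ^+ 2 + (\int[m2]_y (ks (x, y) * h y)) ^+ 2)
    = \int[m2]_y \int[m2]_z (ttker y z * (h y * h z)).
  transitivity (\int[m1]_x \int[m2]_y \int[m2]_z F x y z).
    apply: eq_Rintegral => x _.
    have b2 (k : X * Y -> R) : bmf k ->
        bmf (fun w : Y * Y => k (x, w.1) * h w.1 * (k (x, w.2) * h w.2)).
      by move=> bk; apply: bmfM; apply: bmfM; (exact: bmf_comp bh) || exact: bcomp.
    rewrite !sqr_Rintegral; [|exact: bkh..].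
    rewrite -(bmf_RintD fin2); last 2 first.
      exact: (bmf_Rint fin2 (b2 _ bkc)).
      exact: (bmf_Rint fin2 (b2 _ bks)).
    apply: eq_Rintegral => y _; rewrite -(bmf_RintD fin2); last 2 first.
      exact: (bmf_pair1 y (b2 _ bkc)).
      exact: (bmf_pair1 y (b2 _ bks)).
    by apply: eq_Rintegral => z _; rewrite /F; ring.
  rewrite (@bmf_Fubini _ _ _ _ _ m1 m2 fin1 fin2 (fun w => \int[m2]_z F w.1 w.2 z)); last first.
    by apply: (@bmf_Rint _ _ _ _ _ m2 fin2 (fun w : (X * Y) * Y => F w.1.1 w.1.2 w.2));
      apply: bF => //; exact: measurableT_comp.
  apply: eq_Rintegral => y _ /=.
  rewrite (@bmf_Fubini _ _ _ _ _ m1 m2 fin1 fin2 (fun w => F w.1 y w.2)); last exact: bF.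
  apply: eq_Rintegral => z _ /=; rewrite /F (bmf_RintZr fin1)//.
  by apply: bmfD; apply: bmfM; exact: bmf_pair2.
have bh2 : bmf (fun y => h y ^+ 2) by exact: bmfX.
have bt1 : bmf (fun w : Y * Y => ttker w.1 w.2 * (h w.1 * h w.2)).
  apply: bmfM; first exact: bmf_ttker.
  by apply: bmfM; exact: bmf_comp bh.
have bt2 : bmf (fun w : Y * Y => `|ttker w.1 w.2| * (2^-1 * h w.1 ^+ 2)).
  by apply: bmfM => //; apply: bmfZ; exact: bmf_comp bh2.
have bt3 : bmf (fun w : Y * Y => `|ttker w.1 w.2| * (2^-1 * h w.2 ^+ 2)).
  by apply: bmfM => //; apply: bmfZ; exact: bmf_comp bh2.
rewrite E1; apply: (@le_trans _ _ (\int[m2]_y \int[m2]_z (`|ttker y z| * (2^-1 * h y ^+ 2) +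
   `|ttker y z| * (2^-1 * h z ^+ 2)))).
  apply: (bmf_le_Rint fin2).
  - exact: (bmf_Rint fin2 bt1).
  - exact: (bmf_Rint fin2 (bmfD bt2 bt3)).
  move=> y; apply: (bmf_le_Rint fin2).
  - exact: (bmf_pair1 y bt1).
  - exact: (bmf_pair1 y (bmfD bt2 bt3)).
  move=> z; rewrite -mulrDr; apply: le_trans (ler_norm _) _; rewrite normrM ler_wpM2l//.
  rewrite ler_norml; apply/andP; split.
    by have := sqr_ge0 (h y + h z); rewrite sqrrD; lra.
  by have := sqr_ge0 (h y - h z); rewrite sqrrB; lra.
have half : \int[m2]_y \int[m2]_z (`|ttker y z| * (2^-1 * h y ^+ 2)) <=
    2^-1 * N * \int[m2]_y (h y ^+ 2).
  rewrite -(bmf_RintZl fin2)//; apply: (bmf_le_Rint fin2).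
  - exact: (bmf_Rint fin2 bt2).
  - exact: bmfZ.
  move=> y; rewrite (bmf_RintZr fin2); last exact: (bmf_pair1 y btt).
  by rewrite mulrCA mulrA ler_wpM2r ?sqr_ge0// ler_wpM2l.
have -> : \int[m2]_y \int[m2]_z (`|ttker y z| * (2^-1 * h y ^+ 2) + `|ttker y z| * (2^-1 * h z ^+ 2)) =
   \int[m2]_y \int[m2]_z (`|ttker y z| * (2^-1 * h y ^+ 2)) +
   \int[m2]_y \int[m2]_z (`|ttker y z| * (2^-1 * h z ^+ 2)).
  rewrite -(bmf_RintD fin2); last 2 first.
    exact: (bmf_Rint fin2 bt2).
    exact: (bmf_Rint fin2 bt3).
  apply: eq_Rintegral => y _; rewrite -(bmf_RintD fin2)//.
    exact: (bmf_pair1 y bt2).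
  exact: (bmf_pair1 y bt3).
have -> : \int[m2]_y \int[m2]_z (`|ttker y z| * (2^-1 * h z ^+ 2)) =
   \int[m2]_y \int[m2]_z (`|ttker y z| * (2^-1 * h y ^+ 2)).
  rewrite (bmf_Fubini fin2 fin2 bt3); apply: eq_Rintegral => y _; apply: eq_Rintegral => z _ /=.
  by rewrite ttkerC.
apply: le_trans (lerD half half) _.
by rewrite le_eqVlt; apply/orP; left; apply/eqP; field.
Qed.
End TTstar.

Section osc1D.
Context {R : realType}.
Local Notation mu := (@lebesgue_measure R).
Variables (rho l c1 c2 lam : R).
Hypotheses (l0 : 0 < l) (lam0 : lam != 0).
Hypotheses (c1l : - rho <= c1) (c1r : c1 + l <= rho) (c2l : - rho <= c2) (c2r : c2 + l <= rho).
Variables (a P a1 P1 P2 Q1 Q2 : R -> R -> R) (q q2 B B1 : R).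
Hypotheses (q0 : 0 < q) (B0 : 0 < B) (B10 : 0 <= B1) (q20 : 0 <= q2).
Let I t := (c1 <= t < c1 + l).
Let J s := (c2 <= s < c2 + l).
Hypothesis ma : bmf (fun z : measurableTypeR R * measurableTypeR R => a z.1 z.2).
Hypothesis mP : measurable_fun setT (fun z : measurableTypeR R * measurableTypeR R => P z.1 z.2).
Hypothesis da : forall t s : R, is_derive t 1 (a ^~ s) (a1 t s).
Hypothesis ca1 : forall s, continuous (a1 ^~ s).
Hypothesis dP : forall t s : R, is_derive t 1 (P ^~ s) (P1 t s).
Hypothesis dP1 : forall t s : R, is_derive t 1 (P1 ^~ s) (P2 t s).
Hypothesis cP2 : forall s, continuous (P2 ^~ s).
Hypothesis dQ1 : forall t s : R, is_derive s 1 (P1 t) (Q1 t s).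
Hypothesis dQ2 : forall t s : R, is_derive s 1 (P2 t) (Q2 t s).
Let cell t s := (c1 <= t <= c1 + l) && (c2 <= s <= c2 + l).
Hypothesis aB : forall t s, cell t s -> `|a t s| <= B.
Hypothesis a1B : forall t s, cell t s -> `|a1 t s| <= B1.
Hypothesis Q1q : forall t s, cell t s -> q <= `|Q1 t s|.
Hypothesis Q2q : forall t s, cell t s -> `|Q2 t s| <= q2.

(* Integration by parts bounds the kernel of T^*T by E / (|lam| |s - s'|); this
   meets the trivial bound B^2 l at |s - s'| = 1 / nu. *)
Let E := 2 * B ^+ 2 / q + l * (2 * B * B1 / q + B ^+ 2 * q2 / q ^+ 2).
Let nu := B ^+ 2 * l * `|lam| / E.

Lemma osc_E_gt0 : 0 < E.
Proof.
rewrite /E ltr_pwDl//; first by rewrite divr_gt0// mulr_gt0// exprn_gt0.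
rewrite mulr_ge0 ?(ltW l0)//; apply: addr_ge0; apply: divr_ge0.
- by rewrite !mulr_ge0// ltW.
- exact: ltW.
- by rewrite mulr_ge0// sqr_ge0.
- exact: sqr_ge0.
Qed.

Lemma osc_nu_gt0 : 0 < nu.
Proof.
by rewrite /nu divr_gt0 ?osc_E_gt0// mulr_gt0 ?normr_gt0// mulr_gt0// exprn_gt0.
Qed.

Lemma MVT_unordered (f f1 : R -> R) (x y : R) : (forall t : R, is_derive t 1 f (f1 t)) ->
  exists2 z, Num.min x y <= z <= Num.max x y & f x - f y = f1 z * (x - y).
Proof.
move=> df.
have cf : continuous f.
  by move=> t; apply: differentiable_continuous; apply/derivable1_diffP; case: (df t).
have [xy|yx] := leP x y.
  have [z] := MVT_segment xy (fun t _ => df t) (continuous_subspaceT cf).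
  rewrite in_itv/= => xzy e; exists z => //.
  by rewrite -[LHS]opprB e; ring.
have [z] := MVT_segment (ltW yx) (fun t _ => df t) (continuous_subspaceT cf).
by rewrite in_itv/= => xzy e; exists z.
Qed.

(** By the mean value theorem in s, the first and second t-derivatives of the phase difference are
    lam (s - s') times values of [Q1] and [Q2]. The factor |lam| |s - s'| thus comes out of every
    term of [oscillatory_ibp], leaving [E]. *)
Lemma osc_ker_decay s s' : c2 <= s <= c2 + l -> c2 <= s' <= c2 + l -> s != s' ->
  `|\int[mu]_(t in `[c1, c1 + l]) (a t s * a t s' * cos (lam * (P t s - P t s')))|
     <= E / (`|lam| * `|s - s'|).
Proof.
move=> cs cs' ss'.
have btw z : Num.min s s' <= z <= Num.max s s' -> c2 <= z <= c2 + l.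
  move: cs cs' => /andP[x1 x2] /andP[x3 x4]; rewrite ge_min le_max.
  by move=> /andP[/orP[]h1 /orP[]h2]; apply/andP; split; lra.
have L0 : 0 < `|lam| by rewrite normr_gt0.
have u0 : 0 < `|s - s'| by rewrite normr_gt0 subr_eq0.
have Lu : 0 < `|lam| * `|s - s'| by rewrite mulr_gt0.
have := @oscillatory_ibp R c1 (c1 + l) (fun t => a t s * a t s')
  (fun t => a1 t s * a t s' + a t s * a1 t s')
  (fun t => lam * (P t s - P t s')) (fun t => lam * (P1 t s - P1 t s'))
  (fun t => lam * (P2 t s - P2 t s')) (`|lam| * `|s - s'| * q) (`|lam| * `|s - s'| * q2)
  (B ^+ 2) (2 * B * B1).
have -> : 2 * B ^+ 2 / (`|lam| * `|s - s'| * q) +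
  (c1 + l - c1) * (2 * B * B1 / (`|lam| * `|s - s'| * q) +
     B ^+ 2 * (`|lam| * `|s - s'| * q2) / (`|lam| * `|s - s'| * q) ^+ 2) =
  E / (`|lam| * `|s - s'|).
  rewrite /E; field; rewrite (gt_eqF q0)/= !normr_eq0 subr_eq0 ss' andbT/=.
  by rewrite lam0.
have dcont (f f1 : R -> R) (t : R) : is_derive t 1 f (f1 t) -> {for t, continuous f}.
  by move=> df; apply: differentiable_continuous; apply/derivable1_diffP; case: df.
have dscale (f1 f2 : R -> R) (t d1 d2 : R) : is_derive t 1 f1 d1 -> is_derive t 1 f2 d2 ->
    is_derive t 1 (fun t => lam * (f1 t - f2 t)) (lam * (d1 - d2)).
  move=> h1 h2; have h := is_deriveZ lam (is_deriveB h1 h2).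
  exact: h.
apply.
- by rewrite lerDl ltW.
- by rewrite mulr_gt0.
- exact: sqr_ge0.
- move=> t _; apply: is_derive_eq (is_deriveM (da t s) (da t s')) _.
  by rewrite /GRing.scale /=; ring.
- move=> t _; have h1 := dcont _ (a1 ^~ s) t (da t s).
  have h2 := dcont _ (a1 ^~ s') t (da t s').
  by apply: continuousD; apply: continuousM => //; exact: ca1.
- move=> t _; apply: continuousM; first exact: cvg_cst.
  by apply: continuousB; exact: cP2.
(* The intermediate point z depends on t; this is harmless because the bounds on [Q1] hold on the
   whole closed cell. *)
- move=> t tc; have [z /btw zc ->] := MVT_unordered s s' (dQ1 t).
  rewrite !normrM -[leLHS]mulrA ler_wpM2l// [leLHS]mulrC ler_wpM2r//.
  by apply: Q1q; rewrite /cell tc.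
- move=> t tc; have [z /btw zc ->] := MVT_unordered s s' (dQ2 t).
  rewrite !normrM -[leRHS]mulrA ler_wpM2l// [leLHS]mulrC ler_wpM2l//.
  by apply: Q2q; rewrite /cell tc.
- move=> t tc; rewrite normrM expr2 ler_pM// aB// /cell tc ?cs ?cs'//.
- move=> t tc; apply: le_trans (ler_normD _ _) _; rewrite !normrM.
  rewrite [leRHS](_ : _ = B1 * B + B * B1); last by ring.
  by apply: lerD; apply: ler_pM => //; rewrite ?aB ?a1B// /cell tc ?cs ?cs'.
Qed.

Lemma osc_ker_trivial s s' : c2 <= s <= c2 + l -> c2 <= s' <= c2 + l ->
  `|\int[mu]_(t in `[c1, c1 + l]) (a t s * a t s' * cos (lam * (P t s - P t s')))|
     <= B ^+ 2 * l.
Proof.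
move=> cs cs'.
have dcont (f f1 : R -> R) (t : R) : is_derive t 1 f (f1 t) -> {for t, continuous f}.
  by move=> df; apply: differentiable_continuous; apply/derivable1_diffP; case: df.
rewrite [leRHS](_ : _ = B ^+ 2 * (c1 + l - c1)); last by ring.
apply: Rintegral_itvcc_bound; first by rewrite lerDl ltW.
- move=> t _; apply: continuousM.
    by apply: continuousM; [exact: (dcont _ (a1 ^~ s))|exact: (dcont _ (a1 ^~ s'))].
  apply: continuous_comp; last exact: continuous_cos.
  apply: continuousM; first exact: cvg_cst.
  by apply: continuousB; [exact: (dcont _ (P1 ^~ s))|exact: (dcont _ (P1 ^~ s'))].
- move=> t tc; rewrite normrM -[leRHS]mulr1 ler_pM ?cos_max// normrM expr2.
  by rewrite ler_pM// aB// /cell tc ?cs ?cs'.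
Qed.

Let kc (z : measurableTypeR R * measurableTypeR R) : R :=
  (I z.1)%:R * (J z.2)%:R * (a z.1 z.2 * cos (lam * P z.1 z.2)).
Let ks (z : measurableTypeR R * measurableTypeR R) : R :=
  (I z.1)%:R * (J z.2)%:R * (a z.1 z.2 * sin (lam * P z.1 z.2)).

(** The two kernel bounds combine into 2 B^2 l / (1 + nu |s - s'|), whose integral by
    [Rintegral_log] is the Schur constant; the 4 is this 2 times the 2 of that lemma. *)
Lemma osc_L2 (h : measurableTypeR R -> R) : bmf h ->
  \int[bmu rho]_t ((\int[bmu rho]_s (kc (t, s) * h s)) ^+ 2 +
                   (\int[bmu rho]_s (ks (t, s) * h s)) ^+ 2)
    <= (4 * B ^+ 2 * l * ln (1 + nu * l) / nu) * \int[bmu rho]_s (h s ^+ 2).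
Proof.
have bI c : bmf (fun t : measurableTypeR R => ((c <= t < c + l)%R%:R : R)).
  apply: bmf_bool; apply: measurable_and; first exact: measurable_fun_ler.
  exact: measurable_fun_ltr.
have mPs u : measurable_fun (setT : set (measurableTypeR R)) (P ^~ u).
  exact: (measurableT_comp mP (measurable_fun_pair (@measurable_id _ _ setT) (measurable_cst u))).
have bIJ : bmf (fun z : measurableTypeR R * measurableTypeR R => (I z.1)%:R * (J z.2)%:R : R).
  apply: bmfM; first exact: (@bmf_comp _ _ _ _ _ fst _ _ (bI c1)).
  exact: (@bmf_comp _ _ _ _ _ snd _ _ (bI c2)).
have btrig (g : R -> R) : continuous g -> (forall x, `|g x| <= 1) ->
    bmf (fun z : measurableTypeR R * measurableTypeR R => g (lam * P z.1 z.2)).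
  move=> cg gle1; split; last by exists 1.
  apply: (measurableT_comp (continuous_measurable_fun cg)).
  exact: measurable_funM.
have bkc : bmf kc.
  apply: bmfM => //; apply: bmfM => //; apply: btrig; [exact: continuous_cos|exact: cos_max].
have bks : bmf ks.
  apply: bmfM => //; apply: bmfM => //; apply: btrig; [exact: continuous_sin|exact: sin_max].
have nu0 := osc_nu_gt0.
have B2l : 0 < B ^+ 2 * l by rewrite mulr_gt0// exprn_gt0.
apply: (TTstar (bmu_fin rho) (bmu_fin rho) bkc bks) => s.
(* The cosine subtraction formula leaves only the phase difference P(t, s) - P(t, s'). *)
have ttE s' : ttker (bmu rho) kc ks s s' = (J s)%:R * (J s')%:R *
    \int[mu]_(t in `[c1, c1 + l]) (a t s * a t s' * cos (lam * (P t s - P t s'))).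
  rewrite -(Rintegral_bmu_indic l0 c1l c1r); last first.
    apply: measurable_funM.
      have [m1 _] := bmf_pair2 s ma; have [m2 _] := bmf_pair2 s' ma.
      exact: measurable_funM.
    apply: (measurableT_comp (continuous_measurable_fun (@continuous_cos R))).
    by apply: measurable_funM; [exact: measurable_cst|apply: measurable_funB; exact: mPs].
  have bb : bmf (fun t : measurableTypeR R => (c1 <= t < c1 + l)%R%:R *
      (a t s * a t s' * cos (lam * (P t s - P t s')))).
    apply: bmfM => //; apply: bmfM.
      by apply: bmfM; [exact: (bmf_pair2 s ma)|exact: (bmf_pair2 s' ma)].
    split; last by exists 1 => t; exact: cos_max.
    apply: (measurableT_comp (continuous_measurable_fun (@continuous_cos R))).
    by apply: measurable_funM; [exact: measurable_cst|apply: measurable_funB; exact: mPs].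
  rewrite -(bmf_RintZl (bmu_fin rho) _ bb); apply: eq_Rintegral => t _.
  rewrite /kc /ks /= mulrBr cosB /I.
  by case: (_ <= t < _); rewrite ?b2R0 ?b2R1; ring.
have cg : continuous (fun s' : R => (1 + nu * `|s - s'|)^-1).
  move=> x; suff : {for x, continuous (fun s' : R => (1 + nu * `|s - s'|)^-1)} by [].
  apply: continuousV.
    by rewrite gt_eqF// ltr_pwDl// mulr_ge0// ltW.
  apply: continuousD; first exact: cvg_cst.
  apply: continuousM; first exact: cvg_cst.
  apply: continuous_comp; last exact: norm_continuous.
  by apply: continuousB; [exact: cvg_cst|exact: cvg_id].
have bg : bmf (fun s' : measurableTypeR R => (1 + nu * `|s - s'|)^-1).
  split; first exact: (continuous_measurable_fun cg).
  exists 1 => s'; have ge1 : 1 <= 1 + nu * `|s - s'|.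
    by rewrite lerDl mulr_ge0// ltW.
  by rewrite ger0_norm ?invr_ge0 ?invf_le1 ?(lt_le_trans ltr01 ge1)// (le_trans ler01 ge1).
have bj : bmf (fun s' : measurableTypeR R => 2 * (B ^+ 2 * l) *
   ((c2 <= s' < c2 + l)%R%:R * (1 + nu * `|s - s'|)^-1)).
  by apply: bmfZ; apply: bmfM.
have N0 : 0 <= 4 * B ^+ 2 * l * ln (1 + nu * l) / nu.
  rewrite divr_ge0 ?(ltW nu0)// mulr_ge0//; last first.
    by rewrite ln_ge0// lerDl mulr_ge0// ltW.
  by rewrite -mulrA mulr_ge0// ltW.
have btt : bmf (fun s' : measurableTypeR R => `|ttker (bmu rho) kc ks s s'|).
  exact: bmf_norm (bmf_pair1 s (bmf_ttker (bmu_fin rho) bkc bks)).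
have J_cc x : J x -> c2 <= x <= c2 + l by move=> /andP[h1 h2]; rewrite h1 ltW.
case: (boolP (J s)) => [Js|nJs]; last first.
  rewrite (_ : \int[_]_z _ = 0)//.
  under eq_Rintegral do rewrite ttE (negbTE nJs) b2R0 !mul0r normr0.
  by rewrite /Rintegral integral0.
apply: (@le_trans _ _ (\int[bmu rho]_s' (2 * (B ^+ 2 * l) *
   ((c2 <= s' < c2 + l)%R%:R * (1 + nu * `|s - s'|)^-1)))).
  apply: (bmf_le_Rint (bmu_fin rho)) => // s'.
  rewrite ttE Js b2R1 mul1r normrM normr_nat /J.
  case: (boolP (_ <= s' < _)) => [Js'|_]; last by rewrite b2R0 !mul0r mulr0.
  have p : 0 < 1 + nu * `|s - s'| by rewrite ltr_pwDl// mulr_ge0// ltW.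
  (* With v = nu |s - s'|: if v <= 1, the trivial bound suffices since 1 + v <= 2; if v > 1, the
     decay suffices since 1 + v <= 2 v. *)
  rewrite b2R1 !mul1r; have [le1|gt1] := leP (nu * `|s - s'|) 1.
    apply: le_trans (osc_ker_trivial (J_cc _ Js) (J_cc _ Js')) _.
    by rewrite ler_pdivlMr// mulrC ler_wpM2r ?(ltW B2l)//; move: le1; lra.
  have ss' : s != s'.
    by apply: contraTneq gt1 => ->; rewrite subrr normr0 mulr0 ltr10.
  apply: le_trans (osc_ker_decay (J_cc _ Js) (J_cc _ Js') ss') _.
  have u0 : 0 < `|s - s'| by rewrite normr_gt0 subr_eq0.
  have L0 : 0 < `|lam| by rewrite normr_gt0.
  have -> : E / (`|lam| * `|s - s'|) = B ^+ 2 * l / (nu * `|s - s'|).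
    by rewrite /nu; field; rewrite !(gt_eqF B0, gt_eqF l0, gt_eqF L0, gt_eqF u0, gt_eqF osc_E_gt0).
  rewrite [leRHS](_ : _ = B ^+ 2 * l * (2 / (1 + nu * `|s - s'|))); last by ring.
  rewrite ler_wpM2l ?(ltW B2l)//.
  have nu1 : 0 < nu * `|s - s'| by rewrite mulr_gt0.
  rewrite ler_pdivlMr// mulrC ler_pdivrMr//; move: gt1; lra.
rewrite (bmf_RintZl (bmu_fin rho)); last exact: bmfM.
rewrite Rintegral_bmu_indic//; last exact: (continuous_measurable_fun cg).
rewrite [leRHS](_ : _ = 2 * (B ^+ 2 * l) * (2 * ln (1 + nu * l) / nu)); last first.
  by field; rewrite gt_eqF.
rewrite ler_wpM2l//; first by rewrite mulr_ge0// ltW.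
by apply: Rintegral_log => //; exact: J_cc.
Qed.

End osc1D.

(** * Cells *)

Section vmu_finite.
Context {R : realType} (b : {sigma_finite_measure set (measurableTypeR R) -> \bar R}).
Hypothesis bfin : (b setT < +oo)%E.

Lemma vmu_fin n : (vmu b n setT < +oo)%E.
Proof.
elim: n => [|n IH]; first by rewrite /= diracT ltry.
rewrite (vmu_rVins b ord0)// /pushforward preimage_setT.
exact: prod_fin.
Qed.

Lemma bmf_Rint_rVins n (i : 'I_n.+1) (F : rVE n.+1 -> R) : bmf F ->
  \int[vmu b n.+1]_x F x = \int[vmu b n]_v \int[b]_t F (rVins i t v).
Proof.
move=> bF.
have iF := bmf_integrable (vmu_fin n.+1) bF.
have [i2 E] := integral_rVins i iF.
rewrite /Rintegral E -(integral21_prod_meas1 i2); congr fine.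
apply: eq_integral => v _; rewrite /fubini_G /= -(bmf_EFin_Rint bfin)//.
have h : bmf (fun t : measurableTypeR R => F (rVins i t v)) by apply: (bmf_comp _ bF); exact: measurable_rVins.
exact: h.
Qed.

End vmu_finite.

Section cells.
Context {R : realType}.

(** Half-open, so that the subcells of a cube are disjoint and their indicators add up exactly. *)
Definition cell n (c : 'rV[R]_n) (l : R) (x : 'rV[R]_n) : bool :=
  [forall k, c 0 k <= x 0 k < c 0 k + l].

Definition rVdel n (i : 'I_n.+1) (c : 'rV[R]_n.+1) : 'rV[R]_n := \row_k c 0 (lift i k).

Lemma cell_rVins n (i : 'I_n.+1) (c : 'rV[R]_n.+1) l t (v : 'rV[R]_n) :
  cell c l (rVins i t v) = (c 0 i <= t < c 0 i + l) && cell (rVdel i c) l v.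
Proof.
apply/forallP/andP => [h|[h1 /forallP h2] k].
  split; first by have := h i; rewrite rVins_id.
  by apply/forallP => k; have := h (lift i k); rewrite rVins_lift mxE.
case: (unliftP i k) => [j|] ->; last by rewrite rVins_id.
by have := h2 j; rewrite rVins_lift mxE.
Qed.

Lemma bmf_cell n (c : 'rV[R]_n) l : bmf (fun x : @rVE R n => (cell c l x)%:R : R).
Proof.
apply: bmf_bool.
rewrite (_ : cell c l = fun x => \big[andb/true]_(k < n) (c 0 k <= x 0 k < c 0 k + l)).
  elim: (index_enum _) => [|k s IH].
    rewrite (_ : (fun x => _) = (fun=> true)); first exact: measurable_cst.
    by apply/funext => x; rewrite big_nil.
  rewrite (_ : (fun x => _) = (fun x : @rVE R n => (c 0 k <= x 0 k < c 0 k + l) &&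
    \big[andb/true]_(j <- s) (c 0 j <= x 0 j < c 0 j + l))); last first.
    by apply/funext => x; rewrite big_cons.
  apply: measurable_and => //; apply: measurable_and.
    by apply: measurable_fun_ler => //; exact: measurable_coord.
  by apply: measurable_fun_ltr => //; exact: measurable_coord.
by apply/funext => x; rewrite big_andE.
Qed.

Lemma bmf_itv (c l : R) : bmf (fun t : measurableTypeR R => (c <= t < c + l)%R%:R : R).
Proof.
apply: bmf_bool; apply: measurable_and; first exact: measurable_fun_ler.
exact: measurable_fun_ltr.
Qed.

Lemma Rintegral_bmu_itv_le rho c l : 0 <= l ->
  \int[bmu rho]_t ((c <= t < c + l)%R%:R) <= l :> R.
Proof.
move=> l0; rewrite -lee_fin (bmf_EFin_Rint (bmu_fin rho)); last exact: bmf_itv.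
rewrite (_ : (\int[_]_x _)%E = (\int[bmu rho]_x (\1_(`[c, (c + l)[%classic : set (measurableTypeR R)) x)%:E)%E).
  rewrite integral_indic// setIT; apply: le_trans (bmu_le _ _) _ => //.
  rewrite lebesgue_measure_itv /= lte_fin; case: ltP => _; last by rewrite lee_fin.
  by rewrite -EFinB lee_fin addrAC subrr add0r.
apply: eq_integral => x _; rewrite indicE.
suff -> : (x \in (`[c, (c + l)[%classic : set (measurableTypeR R))) = (c <= x < c + l) by [].
by apply/idP/idP; rewrite inE/= in_itv.
Qed.

Lemma Rintegral_cell_le rho n (c : 'rV[R]_n) l : 0 <= l ->
  \int[vmu (bmu rho) n]_x ((cell c l x)%:R) <= l ^+ n :> R.
Proof.
move=> l0; elim: n c => [|n IH] c.
  rewrite /Rintegral integral_dirac ?diracT ?mul1e/= ?expr0//.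
    by rewrite -[leRHS]/(1%:R) ler_nat leq_b1.
  by apply/measurable_EFinP; case: (bmf_cell c l).
rewrite (bmf_Rint_rVins (bmu_fin rho) ord0); last exact: bmf_cell.
under eq_Rintegral do under eq_Rintegral do rewrite cell_rVins -mulnb natrM.
under eq_Rintegral do rewrite (bmf_RintZr (bmu_fin rho) _ (bmf_itv _ _)).
rewrite (bmf_RintZl (vmu_fin (bmu_fin rho) n)); last exact: bmf_cell.
rewrite exprS ler_pM//; first exact: Rintegral_ge0.
  exact: Rintegral_ge0.
exact: Rintegral_bmu_itv_le.
Qed.

End cells.

Section Cauchy_Schwarz.
Context {R : realType} d (Y : measurableType d).
Variables (m : {sigma_finite_measure set Y -> \bar R}).
Hypothesis fin : (m setT < +oo)%E.

(** The square is written as a double integral and 2 a b <= a^2 + b^2 is used under it; integrating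
    the free indicator produces [V]. *)
Lemma Cauchy_Schwarz_bool (J : Y -> bool) (f : Y -> R) (V : R) :
  bmf (fun y => (J y)%:R : R) -> bmf f -> \int[m]_y (J y)%:R <= V ->
  (\int[m]_y ((J y)%:R * f y)) ^+ 2 <= V * \int[m]_y ((J y)%:R * f y ^+ 2).
Proof.
move=> bJ bf JV; have bJf := bmfM bJ bf; have bJf2 := bmfM bJ (bmfX 2 bf).
rewrite (sqr_Rintegral fin bJf).
have b1 : bmf (fun w : Y * Y => (J w.1)%:R * f w.1 * ((J w.2)%:R * f w.2)).
  by apply: bmfM; [exact: (@bmf_comp _ _ _ _ _ fst _ _ bJf)|exact: (@bmf_comp _ _ _ _ _ snd _ _ bJf)].
have b2 : bmf (fun w : Y * Y => (J w.2)%:R * (2^-1 * ((J w.1)%:R * f w.1 ^+ 2))).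
  apply: bmfM; first exact: (@bmf_comp _ _ _ _ _ snd _ _ bJ).
  by apply: bmfZ; exact: (@bmf_comp _ _ _ _ _ fst _ _ bJf2).
have b3 : bmf (fun w : Y * Y => (J w.1)%:R * (2^-1 * ((J w.2)%:R * f w.2 ^+ 2))).
  apply: bmfM; first exact: (@bmf_comp _ _ _ _ _ fst _ _ bJ).
  by apply: bmfZ; exact: (@bmf_comp _ _ _ _ _ snd _ _ bJf2).
apply: (@le_trans _ _ (\int[m]_y \int[m]_z ((J z)%:R * (2^-1 * ((J y)%:R * f y ^+ 2)) +
    (J y)%:R * (2^-1 * ((J z)%:R * f z ^+ 2))))).
  apply: (bmf_le_Rint fin).
  - exact: (bmf_Rint fin b1).
  - exact: (bmf_Rint fin (bmfD b2 b3)).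
  move=> y; apply: (bmf_le_Rint fin).
  - exact: (bmf_pair1 y b1).
  - exact: (bmf_pair1 y (bmfD b2 b3)).
  move=> z; case: (J y); case: (J z); rewrite ?b2R0 ?b2R1 ?(mul0r, mulr0, mul1r, addr0)//.
  by have := sqr_ge0 (f y - f z); rewrite sqrrB; lra.
have half : \int[m]_y \int[m]_z ((J z)%:R * (2^-1 * ((J y)%:R * f y ^+ 2))) <=
    2^-1 * V * \int[m]_y ((J y)%:R * f y ^+ 2).
  rewrite -(bmf_RintZl fin)//; apply: (bmf_le_Rint fin).
  - exact: (bmf_Rint fin b2).
  - exact: bmfZ.
  move=> y; rewrite (bmf_RintZr fin)//.
  rewrite mulrCA mulrA; apply: ler_wpM2r; last exact: ler_wpM2l.
  by apply: mulr_ge0 => //; exact: sqr_ge0.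
have -> : \int[m]_y \int[m]_z ((J z)%:R * (2^-1 * ((J y)%:R * f y ^+ 2)) +
    (J y)%:R * (2^-1 * ((J z)%:R * f z ^+ 2))) =
   \int[m]_y \int[m]_z ((J z)%:R * (2^-1 * ((J y)%:R * f y ^+ 2))) +
   \int[m]_y \int[m]_z ((J y)%:R * (2^-1 * ((J z)%:R * f z ^+ 2))).
  rewrite -(bmf_RintD fin); last 2 first.
    exact: (bmf_Rint fin b2).
    exact: (bmf_Rint fin b3).
  apply: eq_Rintegral => y _; rewrite -(bmf_RintD fin)//.
    exact: (bmf_pair1 y b2).
  exact: (bmf_pair1 y b3).
rewrite [X in _ + X](bmf_Fubini fin fin b3).
apply: le_trans (lerD half half) _.
by rewrite le_eqVlt; apply/orP; left; apply/eqP; field.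
Qed.

End Cauchy_Schwarz.

(** * Freezing all variables but two *)

Section freezing.
Context {R : realType} (b : {sigma_finite_measure set (measurableTypeR R) -> \bar R}).
Hypothesis bfin : (b setT < +oo)%E.
Variables (n1 n2 : nat) (i : 'I_n1.+1) (j : 'I_n2.+1).
Local Notation mX := (vmu b n1.+1).
Local Notation mY := (vmu b n2.+1).
Variables (kc ks : @rVE R n1.+1 * @rVE R n2.+1 -> R).
Hypotheses (bkc : bmf kc) (bks : bmf ks).
Variables (I : 'rV[R]_n1 -> bool) (J : 'rV[R]_n2 -> bool) (VX VY N : R).
Hypotheses (bI : bmf (fun x : @rVE R n1 => (I x)%:R : R))
  (bJ : bmf (fun y : @rVE R n2 => (J y)%:R : R)).
Hypotheses (IV : \int[vmu b n1]_x (I x)%:R <= VX) (JV : \int[vmu b n2]_y (J y)%:R <= VY).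
Hypothesis N0 : 0 <= N.
Hypothesis kcI : forall t x y, kc (rVins i t x, y) = (I x)%:R * kc (rVins i t x, y).
Hypothesis ksI : forall t x y, ks (rVins i t x, y) = (I x)%:R * ks (rVins i t x, y).
Hypothesis kcJ : forall x s y, kc (x, rVins j s y) = (J y)%:R * kc (x, rVins j s y).
Hypothesis ksJ : forall x s y, ks (x, rVins j s y) = (J y)%:R * ks (x, rVins j s y).
Hypothesis H1 : forall x y (h : measurableTypeR R -> R), I x -> J y -> bmf h ->
  \int[b]_t ((\int[b]_s (kc (rVins i t x, rVins j s y) * h s)) ^+ 2 +
             (\int[b]_s (ks (rVins i t x, rVins j s y) * h s)) ^+ 2)
    <= N * \int[b]_s (h s ^+ 2).

Let vfin n : (vmu b n setT < +oo)%E := vmu_fin bfin n.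

Let W (k : @rVE R n1.+1 * @rVE R n2.+1 -> R) (f : @rVE R n2.+1 -> R) (x : @rVE R n1.+1) (y : @rVE R n2) :=
  \int[b]_s (k (x, rVins j s y) * f (rVins j s y)).

Let bW k (f : @rVE R n2.+1 -> R) : bmf k -> bmf f ->
  bmf (fun z : @rVE R n1.+1 * @rVE R n2 => W k f z.1 z.2).
Proof.
move=> bk bf; apply: (@bmf_Rint _ _ _ _ _ b bfin (fun w : (@rVE R n1.+1 * @rVE R n2) * measurableTypeR R =>
   k (w.1.1, rVins j w.2 w.1.2) * f (rVins j w.2 w.1.2))).
have mr : measurable_fun setT (fun w : (@rVE R n1.+1 * @rVE R n2) * measurableTypeR R =>
    rVins j w.2 w.1.2 : @rVE R n2.+1).
  by apply: measurable_rVins => //; exact: measurableT_comp measurable_snd measurable_fst.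
apply: bmfM; last exact: (bmf_comp mr bf).
have mp : measurable_fun setT (fun w : (@rVE R n1.+1 * @rVE R n2) * measurableTypeR R =>
    (w.1.1, rVins j w.2 w.1.2 : @rVE R n2.+1)).
  by apply: measurable_fun_pair => //; exact: measurableT_comp measurable_fst measurable_fst.
exact: (bmf_comp mp bk).
Qed.

Let sq_op (k : @rVE R n1.+1 * @rVE R n2.+1 -> R) (f : @rVE R n2.+1 -> R) x : bmf k -> bmf f ->
  (forall x s y, k (x, rVins j s y) = (J y)%:R * k (x, rVins j s y)) ->
  (\int[mY]_y (k (x, y) * f y)) ^+ 2 <= VY * \int[vmu b n2]_y ((J y)%:R * W k f x y ^+ 2).
Proof.
move=> bk bf kJ.
rewrite (bmf_Rint_rVins bfin j); last by apply: bmfM => //; exact: bmf_pair1.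
have -> : \int[vmu b n2]_y \int[b]_s (k (x, rVins j s y) * f (rVins j s y)) =
   \int[vmu b n2]_y ((J y)%:R * W k f x y).
  apply: eq_Rintegral => y _; rewrite /W -(bmf_RintZl bfin).
    by apply: eq_Rintegral => s _; rewrite mulrA -kJ.
  have mr : measurable_fun setT (fun s : measurableTypeR R => rVins j s y : @rVE R n2.+1).
    exact: measurable_rVins.
  have bkf : bmf (fun y => k (x, y) * f y) by apply: bmfM => //; exact: bmf_pair1.
  exact: (bmf_comp mr bkf).
apply: (Cauchy_Schwarz_bool (vfin n2)) => //.
exact: (bmf_pair1 x (bW bk bf)).
Qed.

Lemma freezing_L2 (f : @rVE R n2.+1 -> R) : bmf f ->
  \int[mX]_x ((\int[mY]_y (kc (x, y) * f y)) ^+ 2 + (\int[mY]_y (ks (x, y) * f y)) ^+ 2)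
    <= VX * VY * N * \int[mY]_y (f y ^+ 2).
Proof.
move=> bf.
pose G x y := (J y)%:R * (W kc f x y ^+ 2 + W ks f x y ^+ 2).
have bWc := bW bkc bf; have bWs := bW bks bf.
have VY0 : 0 <= VY by apply: le_trans JV; exact: Rintegral_ge0.
have bG : bmf (fun z : @rVE R n1.+1 * @rVE R n2 => G z.1 z.2).
  apply: bmfM; first exact: (@bmf_comp _ _ _ _ _ snd _ _ bJ).
  by apply: bmfD; exact: bmfX.
have bsq (k : @rVE R n1.+1 * @rVE R n2.+1 -> R) : bmf k -> bmf (fun x => (\int[mY]_y (k (x, y) * f y)) ^+ 2).
  move=> bk; apply: bmfX.
  have bkf : bmf (fun z : @rVE R n1.+1 * @rVE R n2.+1 => k z * f z.2).
    by apply: bmfM => //; exact: (@bmf_comp _ _ _ _ _ snd _ _ bf).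
  exact: (bmf_Rint (vfin n2.+1) bkf).
apply: (@le_trans _ _ (VY * \int[mX]_x \int[vmu b n2]_y G x y)).
  rewrite -(bmf_RintZl (vfin n1.+1)); last exact: (bmf_Rint (vfin n2) bG).
  apply: (bmf_le_Rint (vfin n1.+1)).
  - by apply: bmfD; exact: bsq.
  - by apply: bmfZ; exact: (bmf_Rint (vfin n2) bG).
  move=> x; apply: le_trans (lerD (sq_op x bkc bf kcJ) (sq_op x bks bf ksJ)) _.
  rewrite -mulrDr -(bmf_RintD (vfin n2)); last 2 first.
    by apply: bmfM => //; apply: bmfX; exact: (bmf_pair1 x bWc).
    by apply: bmfM => //; apply: bmfX; exact: (bmf_pair1 x bWs).
  by under eq_Rintegral do rewrite -mulrDr.
rewrite [VX * VY]mulrC -2!mulrA; apply: ler_wpM2l => //.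
have bf2 : bmf (fun y => f y ^+ 2) by exact: bmfX.
rewrite (bmf_Fubini (vfin n1.+1) (vfin n2) bG) (bmf_Rint_rVins bfin j bf2).
have bfs : bmf (fun y : @rVE R n2 => \int[b]_s (f (rVins j s y) ^+ 2)).
  apply: (@bmf_Rint _ _ _ _ _ b bfin (fun w : @rVE R n2 * measurableTypeR R => f (rVins j w.2 w.1) ^+ 2)).
  have mr : measurable_fun setT (fun w : @rVE R n2 * measurableTypeR R => rVins j w.2 w.1 : @rVE R n2.+1).
    exact: measurable_rVins.
  exact: (bmf_comp mr bf2).
rewrite mulrA -(bmf_RintZl (vfin n2))//; apply: (bmf_le_Rint (vfin n2)).
- exact: (bmf_Rint (vfin n1.+1) (bmf_swap bG)).
- exact: bmfZ.
move=> y; rewrite /= (bmf_Rint_rVins bfin i); last exact: (bmf_pair2 y bG).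
set D := \int[b]_s _.
have D0 : 0 <= D by apply: Rintegral_ge0 => s _; exact: sqr_ge0.
apply: (@le_trans _ _ (\int[vmu b n1]_x ((I x)%:R * (N * D)))); last first.
  rewrite (bmf_RintZr (vfin n1))// -[leRHS]mulrA; apply: ler_wpM2r => //.
  exact: mulr_ge0.
apply: (bmf_le_Rint (vfin n1)).
- apply: (@bmf_Rint _ _ _ _ _ b bfin (fun w : @rVE R n1 * measurableTypeR R => G (rVins i w.2 w.1) y)).
  have mr : measurable_fun setT (fun w : @rVE R n1 * measurableTypeR R => rVins i w.2 w.1 : @rVE R n1.+1).
    exact: measurable_rVins.
  exact: (bmf_comp mr (bmf_pair2 y bG)).
- by apply: bmfM => //; exact: bmf_cst.
move=> x; rewrite /G; case: (boolP (J y)) => [Jy|_]; last first.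
  under eq_Rintegral do rewrite b2R0 mul0r.
  by rewrite /Rintegral integral0 /= !mulr_ge0.
case: (boolP (I x)) => [Ix|nIx]; last first.
  have W0 (k : @rVE R n1.+1 * @rVE R n2.+1 -> R) t : (forall t x y, k (rVins i t x, y) = (I x)%:R * k (rVins i t x, y)) ->
      W k f (rVins i t x) y = 0.
    move=> kI; rewrite /W.
    under eq_Rintegral do rewrite kI (negbTE nIx) b2R0 !mul0r.
    by rewrite /Rintegral integral0.
  under eq_Rintegral do rewrite !W0// expr0n addr0 mulr0.
  by rewrite /Rintegral integral0 /= b2R0 mul0r.
rewrite b2R1 mul1r.
under eq_Rintegral do rewrite mul1r.
apply: H1 => //; apply: (bmf_comp _ bf); exact: measurable_rVins.
Qed.

End freezing.

(** * Homogeneous polynomials and the rank one condition *)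

Section polynomials.
Context {R : realType}.

(** Continuity, derivatives and Lipschitz bounds of the evaluation all pass through sums and
    products, so constants and variables suffice as base cases. *)
Lemma mpoly_ring_ind n (Q : mpoly.mpoly n R -> Prop) :
  (forall c, Q (mpoly.mpolyC n c)) ->
  (forall i, Q (mpoly.mpolyX R (mpoly.mnm1 i))) ->
  (forall p q, Q p -> Q q -> Q (p + q)) -> (forall p q, Q p -> Q q -> Q (p * q)) ->
  forall p, Q p.
Proof.
move=> QC QX QD QM p.
have Q0 : Q 0 by have := QC 0; rewrite mpoly.mpolyC0.
have Q1 : Q 1 by have := QC 1.
rewrite (mpoly.mpolyE p); apply: (big_rec Q) => // m q _ Qq; apply/QD => //.
rewrite -mpoly.mul_mpolyC; apply/QM => //; rewrite mpoly.mpolyXE_id.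
apply: (big_rec Q) => // i q' _ Qq'; apply/QM => //; elim: (m i) => [|k IH]; first by rewrite expr0.
by rewrite exprS; exact: QM.
Qed.

Lemma pevalD n (p q : mpoly.mpoly n R) z : peval (p + q) z = peval p z + peval q z.
Proof. exact: mpoly.mevalD. Qed.

Lemma pevalM n (p q : mpoly.mpoly n R) z : peval (p * q) z = peval p z * peval q z.
Proof. exact: mpoly.mevalM. Qed.

Lemma pevalC n c (z : 'rV[R]_n) : peval (mpoly.mpolyC n c) z = c.
Proof. exact: mpoly.mevalC. Qed.

Lemma pevalX n i (z : 'rV[R]_n) : peval (mpoly.mpolyX R (mpoly.mnm1 i)) z = z ord0 i.
Proof. exact: mpoly.mevalXU. Qed.

Lemma peval0 n (z : 'rV[R]_n) : peval 0 z = 0.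
Proof. exact: mpoly.meval0. Qed.

Lemma continuous_peval n (p : mpoly.mpoly n R) : continuous (peval p : 'rV[R]_n -> R).
Proof.
move: p; apply: mpoly_ring_ind => [c|i|p q cp cq|p q cp cq] x.
- rewrite (_ : peval _ = cst c); first exact: cst_continuous.
  by apply/funext => y; rewrite pevalC.
- rewrite (_ : peval _ = fun y : 'rV[R]_n => y ord0 i); first exact: coord_continuous.
  by apply/funext => y; rewrite pevalX.
- rewrite (_ : peval _ = peval p \+ peval q); first exact: (cvgD (cp x) (cq x)).
  by apply/funext => y; rewrite pevalD.
- rewrite (_ : peval _ = peval p \* peval q); first exact: (cvgM (cp x) (cq x)).
  by apply/funext => y; rewrite pevalM.
Qed.

(** Stated along a curve that moves coordinate k alone at unit speed, as [rVins] does, so that the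
    derivative is the formal one. *)
Lemma is_derive_peval n (p : mpoly.mpoly n R) (k : 'I_n) (w : R -> 'rV[R]_n) (t : R) :
  (forall t, w t ord0 k = t) -> (forall i, i != k -> forall t s, w t ord0 i = w s ord0 i) ->
  is_derive t 1 (fun t => peval p (w t)) (peval (mpoly.mderiv k p) (w t)).
Proof.
move=> wk wi; move: p; apply: mpoly_ring_ind => [c|i|p q dp dq|p q dp dq].
- rewrite (_ : (fun t => _) = cst c); last by apply/funext => y; rewrite pevalC.
  by rewrite mpoly.mderivC peval0; exact: is_derive_cst.
- rewrite mpoly.mderivX mpoly.mnm1E; have [->|ik] := eqVneq i k.
    rewrite (_ : (fun t => _) = id); last by apply/funext => y; rewrite pevalX wk.
    rewrite (_ : peval _ _ = 1); first exact: is_derive_id.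
    have -> : mpoly.mnm_sub (mpoly.mnm1 k) (mpoly.mnm1 k) = mpoly.mnm0 by apply/mpoly.mnmP => l; rewrite mpoly.mnmBE mpoly.mnm0E subnn.
    by rewrite mpoly.mpolyX0 /peval mpoly.mevalZ mpoly.meval1 mulr1.
  rewrite (_ : (fun t => _) = cst (w 0 ord0 i)); last first.
    by apply/funext => y; rewrite pevalX /=; exact: wi.
  by rewrite mulr0n scale0r peval0; exact: is_derive_cst.
- rewrite mpoly.mderivD pevalD.
  rewrite (_ : (fun t => _) = (fun t => peval p (w t)) + (fun t => peval q (w t))).
    exact: is_deriveD.
  by apply/funext => y; rewrite pevalD.
- rewrite mpoly.mderivM pevalD !pevalM.
  rewrite (_ : (fun t => _) = (fun t => peval p (w t)) * (fun t => peval q (w t))).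
    apply: is_derive_eq (is_deriveM dp dq) _.
    by rewrite /GRing.scale /=; ring.
  by apply/funext => y; rewrite pevalM.
Qed.

Definition in_ball n (r : R) (z : 'rV[R]_n) := forall i, `|z ord0 i| <= r.

(** The sup bound [B] is carried in the induction because the Lipschitz constant of a product
    involves it. *)
Lemma peval_lipschitz n (p : mpoly.mpoly n R) : exists L B : R, [/\ 0 <= L, 0 <= B,
  (forall z, in_ball 1 z -> `|peval p z| <= B) &
  forall z z' e, in_ball 1 z -> in_ball 1 z' -> (forall i, `|z ord0 i - z' ord0 i| <= e) -> 0 <= e ->
    `|peval p z - peval p z'| <= L * e].
Proof.
move: p; apply: mpoly_ring_ind => [c|i|p q [L [B [L0 B0 h1 h2]]] [L' [B' [L'0 B'0 h1' h2']]]|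
    p q [L [B [L0 B0 h1 h2]]] [L' [B' [L'0 B'0 h1' h2']]]].
- exists 0, `|c|; split => //; first by move=> z _; rewrite pevalC.
  by move=> z z' e _ _ _ e0; rewrite !pevalC subrr normr0 mul0r.
- exists 1, 1; split => //; first by move=> z; rewrite pevalX.
  by move=> z z' e _ _ ze e0; rewrite !pevalX mul1r.
- exists (L + L'), (B + B'); split; [exact: addr_ge0|exact: addr_ge0|move=> z zb|move=> z z' e zb zb' ze e0].
    by rewrite pevalD (le_trans (ler_normD _ _))// lerD ?h1 ?h1'.
  rewrite !pevalD opprD addrACA (le_trans (ler_normD _ _))// mulrDl.
  by rewrite lerD ?h2 ?h2'.
- exists (L * B' + B * L'), (B * B'); split; [by rewrite addr_ge0// mulr_ge0|exact: mulr_ge0|move=> z zb|move=> z z' e zb zb' ze e0].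
    by rewrite pevalM normrM ler_pM ?h1 ?h1'.
  rewrite !pevalM (_ : _ - _ = (peval p z - peval p z') * peval q z +
    peval p z' * (peval q z - peval q z')); last by ring.
  rewrite (le_trans (ler_normD _ _))// !normrM mulrDl.
  rewrite [L * B' * e]mulrAC -[B * L' * e]mulrA.
  by rewrite lerD// ler_pM ?h1 ?h1' ?h2 ?h2'.
Qed.

Lemma peval_homogeneous n d (p : mpoly.mpoly n R) r z : homogeneous_of_degree d p ->
  peval p (r *: z) = r ^+ d * peval p z.
Proof.
move=> /mpoly.dhomogP hp; rewrite /peval !mpoly.mevalE big_distrr /=.
rewrite big_seq_cond [RHS]big_seq_cond; apply: eq_bigr => m; rewrite andbT => /hp md.
rewrite mulrCA; congr (_ * _).
rewrite (eq_bigr (fun i => r ^+ (m i) * z ord0 i ^+ (m i))); last first.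
  by move=> i _; rewrite mxE exprMn.
rewrite big_split /=; congr (_ * _).
by rewrite -md /= mpoly.mdegE prodrXr.
Qed.

Lemma mderiv_homogeneous n d (p : mpoly.mpoly n R) k : homogeneous_of_degree d.+1 p ->
  homogeneous_of_degree d (mpoly.mderiv k p).
Proof.
move=> /mpoly.dhomogP hp; apply/mpoly.dhomogP => m.
rewrite mpoly.mcoeff_msupp mpoly.mcoeff_mderiv => h.
have : (mpoly.mnm_add m (mpoly.mnm1 k)) \in mpoly.msupp p.
  rewrite mpoly.mcoeff_msupp; apply: contraNneq h => ->.
  by rewrite mul0rn.
by move=> /hp /=; rewrite mpoly.mdegD mpoly.mdeg1 addn1 => -[].
Qed.

Lemma peval_homogeneous_bound n d (p : mpoly.mpoly n R) : homogeneous_of_degree d p ->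
  exists2 C, 0 <= C & forall r z, 0 < r -> in_ball r z -> `|peval p z| <= C * r ^+ d.
Proof.
move=> hp; have [L [B [_ B0 pB _]]] := peval_lipschitz p.
exists B => // r z r0 zr.
have -> : z = r *: (r^-1 *: z) by rewrite scalerA mulfV ?gt_eqF// scale1r.
rewrite (peval_homogeneous _ _ hp) normrM ger0_norm ?exprn_ge0 ?(ltW r0)//.
rewrite mulrC ler_wpM2r ?exprn_ge0 ?(ltW r0)//; apply: pB => i.
by rewrite mxE normrM ger0_norm ?invr_ge0 ?(ltW r0)// mulrC ler_pdivrMr// mul1r.
Qed.

End polynomials.

Section rank_one.
Context {R : realType} (nX nY : nat).

Lemma sum_continuous_rV n (I : finType) (F : I -> 'rV[R]_n -> R) :
  (forall i, continuous (F i)) -> continuous (fun z => \sum_i F i z).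
Proof.
move=> cF; elim: (index_enum I) => [|i s IH].
  rewrite (_ : (fun z => _) = cst 0); first exact: cst_continuous.
  by apply/funext => z; rewrite big_nil.
rewrite (_ : (fun z => _) = F i \+ (fun z => \sum_(j <- s) F j z)).
  by move=> x; exact: (cvgD (cF i x) (IH x)).
by apply/funext => z; rewrite big_cons.
Qed.

Lemma sqr_continuous_rV n (F : 'rV[R]_n -> R) :
  continuous F -> continuous (fun z => F z ^+ 2).
Proof. by move=> cF x; exact: (cvgM (cF x) (cF x)). Qed.

(** The sum of squares of the mixed derivatives is continuous and, by the rank one condition,
    vanishes nowhere on a compact set avoiding 0; its minimum there is [g]. *)
Lemma rank_one_lower_bound (S : mpoly.mpoly (nX + nY) R) : rank_one_condition S ->
  exists2 g : R, 0 < g & forall w : 'rV[R]_(nX + nY), in_ball 1 w ->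
    (exists k, 1 / 2 <= `|w ord0 k|) ->
    g <= \sum_(ij : 'I_nX * 'I_nY) peval (dxdy S ij.1 ij.2) w ^+ 2.
Proof.
move=> hS.
pose N2 (w : 'rV[R]_(nX + nY)) := \sum_k w ord0 k ^+ 2.
pose G (w : 'rV[R]_(nX + nY)) := \sum_(ij : 'I_nX * 'I_nY) peval (dxdy S ij.1 ij.2) w ^+ 2.
have cN2 : continuous N2.
  by apply: sum_continuous_rV => k; apply: sqr_continuous_rV; exact: coord_continuous.
have cG : continuous G.
  by apply: sum_continuous_rV => k; apply: sqr_continuous_rV; exact: continuous_peval.
(* The Euclidean condition N2 >= 1/4 is closed, excludes 0, and follows from one coordinate being at
   least 1/2 in modulus. *)
pose A := [set w : 'rV[R]_(nX + nY) | forall i, `[(-1 : R), 1]%classic (w ord0 i)] `&`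
  (N2 @^-1` [set x | 4^-1 <= x]).
have AP w : in_ball 1 w -> (exists k, 1 / 2 <= `|w ord0 k|) -> A w.
  move=> w1 [k wk]; split.
    by move=> i /=; rewrite in_itv/= -ler_norml; exact: w1.
  rewrite /= /N2 (bigD1 k)//=; apply: (@le_trans _ _ (w ord0 k ^+ 2)); last first.
    by rewrite lerDl; apply: sumr_ge0 => i _; exact: sqr_ge0.
  rewrite -(real_normK (num_real (w ord0 k))) (_ : 4^-1 = (1 / 2) ^+ 2); last by field.
  by rewrite lerXn2r ?nnegrE ?divr_ge0.
have [A0|/set0P/negP/negPn/eqP A0] := pselect (A !=set0); last first.
  by exists 1 => // w w1 wk; have := AP w w1 wk; rewrite A0.
have cA : compact A.
  apply: compact_closedI.
    by apply: (@rV_compact _ _ (fun=> `[(-1 : R), 1]%classic)) => i; exact: segment_compact.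
  by move/continuous_closedP : cN2; apply; exact: closed_ge.
have [w0 Aw0 w0min] := compact_EVT_min A0 cA (continuous_subspaceT cG).
exists (G w0); last first.
  by move=> w w1 wk; apply: w0min; rewrite inE; exact: AP.
rewrite lt_def sumr_ge0 ?andbT; last by move=> ij _; exact: sqr_ge0.
apply/eqP => G0; apply: hS.
have z0 : forall ij : 'I_nX * 'I_nY, peval (dxdy S ij.1 ij.2) w0 = 0.
  move=> ij; apply/eqP; rewrite -sqrf_eq0; apply/eqP.
  by apply: (psumr_eq0P _ G0) => // k _; exact: sqr_ge0.
exists (lsubmx w0), (rsubmx w0); rewrite hsubmxK; split; last by move=> i j; exact: (z0 (i, j)).
have [x0|] := eqVneq (lsubmx w0) 0; last by left.
have [y0|] := eqVneq (rsubmx w0) 0; last by right.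
exfalso; move: Aw0; rewrite inE => -[_ /=]; rewrite /N2 big1 ?invr_le0 ?lern0// => k _.
by rewrite -[w0]hsubmxK x0 y0 row_mx0 mxE expr0n.
Qed.

(** After rescaling by 1/r, pigeonhole at one point of the cell yields a pair (i, j) with mixed
    derivative at least 2 c; the rescaled cell is so small that the Lipschitz bound loses at most c
    across it. Homogeneity of degree d - 2 (here [d]) restores r. *)
Lemma rank_one_cells d (S : mpoly.mpoly (nX + nY) R) :
  homogeneous_of_degree d.+2 S -> rank_one_condition S ->
  exists2 K : nat, (0 < K)%N & exists2 c : R, 0 < c &
  forall r (Z : 'rV[R]_(nX + nY) -> Prop), 0 < r ->
    (forall z, Z z -> in_ball r z) ->
    (forall z, Z z -> exists k, r / 2 <= `|z ord0 k|) ->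
    (forall z z' k, Z z -> Z z' -> `|z ord0 k - z' ord0 k| <= r / (2 * K%:R)) ->
    (exists z, Z z) ->
    exists i j, forall z, Z z -> c * r ^+ d <= `|peval (dxdy S i j) z|.
Proof.
move=> hom hS; have [g g0 gG] := rank_one_lower_bound hS.
have homd i j : homogeneous_of_degree d (dxdy S i j).
  by apply: mderiv_homogeneous; exact: mderiv_homogeneous.
(* If all nX nY derivatives were below 2 c, their squares would sum to at most nX nY g / (nX nY + 1)
   < g; the successor provides the strict inequality. *)
pose c := Num.sqrt (g / (nX * nY).+1%:R) / 2.
have gN0 : 0 < g / (nX * nY).+1%:R by rewrite divr_gt0.
have c0 : 0 < c by rewrite divr_gt0// sqrtr_gt0.
have c2 : (2 * c) ^+ 2 = g / (nX * nY).+1%:R.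
  by rewrite /c mulrC divfK// sqr_sqrtr// ltW.
have [L L0 hL] : exists2 L : R, 0 <= L & forall i j z z' e, in_ball 1 z -> in_ball 1 z' ->
    (forall k, `|z ord0 k - z' ord0 k| <= e) -> 0 <= e ->
    `|peval (dxdy S i j) z - peval (dxdy S i j) z'| <= L * e.
  have hh (ij : 'I_nX * 'I_nY) := cid (peval_lipschitz (dxdy S ij.1 ij.2)).
  exists (\sum_ij projT1 (hh ij)).
    by apply: sumr_ge0 => ij _; case: (hh ij) => /= L [B []].
  move=> i j z z' e z1 z1' ze e0.
  apply: (@le_trans _ _ (projT1 (hh (i, j)) * e)).
    by case: (hh (i, j)) => /= L [B [? ? ? h]]; exact: h.
  rewrite ler_wpM2r// (bigD1 (i, j))//= lerDl.
  by apply: sumr_ge0 => ij _; case: (hh ij) => /= L' [B' []].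
(* This K exceeds L / c, hence the oscillation L / (2 K) over a rescaled cell is at most c. *)
exists (Num.bound (L / c)).+1 => //; exists c => // r Z r0 Zr Zk Zd [z0 Zz0].
set K := (Num.bound _).+1 in Zd *.
have K0 : 0 < K%:R :> R by rewrite ltr0n.
have LK : L / (2 * K%:R) <= c.
  rewrite ler_pdivrMr ?mulr_gt0// mulrC -ler_pdivrMr//.
  have : L / c < K%:R.
    apply: lt_le_trans (archi_boundP _) _; first by rewrite divr_ge0// ltW.
    by rewrite ler_nat.
  by move=> h; rewrite (le_trans (ltW h))// ler_peMl ?(ltW K0)// ler1n.
have scal z : Z z -> in_ball 1 (r^-1 *: z).
  move=> /Zr zr i; rewrite mxE normrM ger0_norm ?invr_ge0 ?(ltW r0)//.
  by rewrite mulrC ler_pdivrMr// mul1r.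
have /existsP[[i j] hij] : [exists ij : 'I_nX * 'I_nY,
    2 * c <= `|peval (dxdy S ij.1 ij.2) (r^-1 *: z0)|].
  apply: contraT => /existsPn h.
  have h1 : exists k, 1 / 2 <= `|(r^-1 *: z0) ord0 k|.
    have [k hk] := Zk _ Zz0; exists k.
    rewrite mxE normrM ger0_norm ?invr_ge0 ?(ltW r0)// [leRHS]mulrC ler_pdivlMr//.
    by rewrite mulrAC mul1r.
  have := gG _ (scal _ Zz0) h1; apply: contraTT => _; rewrite -ltNge.
  apply: (@le_lt_trans _ _ (\sum_(ij : 'I_nX * 'I_nY) g / (nX * nY).+1%:R)).
    apply: ler_sum => ij _; have := h ij; rewrite -ltNge => /ltW hle.
    rewrite -c2 -(real_normK (num_real (peval _ _))) lerXn2r ?nnegrE//.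
    by rewrite mulr_ge0// ltW.
  rewrite sumr_const card_prod !card_ord -[X in X < _]mulr_natr.
  by rewrite mulrAC ltr_pdivrMr// ltr_pM2l// ltr_nat.
exists i, j => z Zz.
have -> : z = r *: (r^-1 *: z) by rewrite scalerA mulfV ?gt_eqF// scale1r.
rewrite (peval_homogeneous _ _ (homd i j)) normrM ger0_norm ?exprn_ge0 ?(ltW r0)//.
rewrite mulrC ler_wpM2l ?exprn_ge0 ?(ltW r0)//.
have hd k : `|(r^-1 *: z0) ord0 k - (r^-1 *: z) ord0 k| <= 1 / (2 * K%:R).
   rewrite !mxE -mulrBr normrM ger0_norm ?invr_ge0 ?(ltW r0)//.
  rewrite [leLHS]mulrC ler_pdivrMr// mulrAC mul1r.
  exact: Zd.
have e0 : 0 <= 1 / (2 * K%:R) :> R by rewrite divr_ge0// mulr_ge0// ltW.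
have := hL i j _ _ _ (scal _ Zz0) (scal _ Zz) hd e0; rewrite mulrA mulr1 => h.
have h2 := lerB_dist (peval (dxdy S i j) (r^-1 *: z0)) (peval (dxdy S i j) (r^-1 *: z)).
move: (le_trans h2 (le_trans h LK)) hij => /=; lra.
Qed.

End rank_one.

(** * Constants of the one-cell estimate *)

Section estimates.
Context {R : realType}.

(** The logarithm is traded for an arbitrarily small power: for z <= 1 use ln (1 + z) <= z, for z >
    1 use ln (1 + z) <= (1 + z)^(1-k) / (1-k) and 1 + z <= 2 z. The factor 1 / (1 - k) shows why k =
    1 is out of reach. *)
Lemma ln1D_le_powR (z k : R) : 0 < z -> 0 <= k < 1 ->
  ln (1 + z) / z <= 2 / (1 - k) * powR z (- k).
Proof.
move=> z0 /andP[k0 k1]; set e := 1 - k.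
have e0 : 0 < e by rewrite /e; lra.
have e1 : e <= 1 by rewrite /e; lra.
have z1 : 0 < 1 + z by lra.
rewrite ler_pdivrMr// -[leRHS]mulrA.
have -> : powR z (- k) * z = powR z e.
  rewrite -[X in _ * X](powRr1 (ltW z0)) -powRD ?(gt_eqF z0) ?implybT//.
  by congr powR; rewrite /e; ring.
have [zle1|zgt1] := leP z 1.
  apply: (@le_trans _ _ z); first by apply: le_ln1Dx; lra.
  apply: (@le_trans _ _ (powR z e)).
    have := @ger1_powR _ z e; rewrite z0 zle1 => /(_ isT e1).
    by [].
  by rewrite ler_peMl ?powR_ge0// ler_pdivlMr// mul1r; lra.
have h : ln (1 + z) <= powR (1 + z) e / e.
  rewrite ler_pdivlMr// mulrC -ln_powR; apply: ltW; apply: ln_sublinear.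
  exact: powR_gt0.
apply: (le_trans h); rewrite ler_pdivrMr//.
rewrite [leRHS](_ : _ = 2 * powR z e); last by field; rewrite gt_eqF.
apply: (@le_trans _ _ (powR (2 * z) e)).
  by rewrite ge0_ler_powR ?nnegrE ?(ltW e0)//; lra.
rewrite powRM// ?(ltW z0)// ler_wpM2r ?powR_ge0//.
have := @ler_powR _ 2 (ler1n _ 2) e 1 e1.
by rewrite powRr1.
Qed.

(** The constant of [osc_L2] is 4 B^2 l^2 ln (1 + z) / z with z = nu l. As l is comparable to r and
    E is at most of order r^(-(n+1)), z is at least a constant times |lam| r^(n+3), and n + 3 is the
    degree of S. *)
Lemma osc_constant_bound (B l lam E E0 r k : R) (K : nat) (n : nat) :
  0 < B -> 0 < r -> lam != 0 -> (0 < K)%N -> l = r / (2 * K%:R) -> 0 < E -> 0 < E0 ->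
  E <= E0 / r ^+ n.+1 -> 0 <= k < 1 ->
  4 * B ^+ 2 * l * ln (1 + B ^+ 2 * l * `|lam| / E * l) / (B ^+ 2 * l * `|lam| / E) <=
  4 * B ^+ 2 * (2 / (1 - k)) * powR (B ^+ 2 / (4 * K%:R ^+ 2 * E0)) (- k) *
    (r ^+ 2 * powR (`|lam| * r ^+ n.+3) (- k)).
Proof.
move=> B0 r0 lam0 K0 lE EE0 E00 EE k01.
have KR : 0 < K%:R :> R by rewrite ltr0n.
have L0 : 0 < `|lam| by rewrite normr_gt0.
have l0 : 0 < l by rewrite lE divr_gt0// mulr_gt0.
have lr : l <= r.
  rewrite lE ler_pdivrMr ?mulr_gt0// ler_peMr ?(ltW r0)//.
  have : 1 <= K%:R :> R by rewrite ler1n.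
  by lra.
have B20 : 0 < B ^+ 2 by rewrite exprn_gt0.
set z := B ^+ 2 * l * `|lam| / E * l.
have z0 : 0 < z by rewrite /z !mulr_gt0// invr_gt0.
have -> : 4 * B ^+ 2 * l * ln (1 + z) / (B ^+ 2 * l * `|lam| / E) =
   4 * B ^+ 2 * l ^+ 2 * (ln (1 + z) / z).
  by rewrite /z; field; rewrite !gt_eqF.
set kap := B ^+ 2 / (4 * K%:R ^+ 2 * E0).
have kap0 : 0 < kap by rewrite /kap divr_gt0// !mulr_gt0// exprn_gt0.
have Lr0 : 0 < `|lam| * r ^+ n.+3 by rewrite mulr_gt0// exprn_gt0.
have zk : kap * (`|lam| * r ^+ n.+3) <= z.
  have -> : z = B ^+ 2 / (4 * K%:R ^+ 2) * `|lam| * r ^+ 2 / E.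
    by rewrite /z lE; field; rewrite !gt_eqF.
  rewrite ler_pdivlMr//.
  apply: (@le_trans _ _ (kap * (`|lam| * r ^+ n.+3) * (E0 / r ^+ n.+1))).
    by rewrite ler_wpM2l// mulr_ge0// ltW.
  rewrite /kap le_eqVlt; apply/orP; left; apply/eqP.
  rewrite (_ : r ^+ n.+3 = r ^+ n.+1 * r ^+ 2); last by rewrite -exprD addn2.
  by field; rewrite !gt_eqF// exprn_gt0.
have [k0 k1] := andP k01.
have h1 : ln (1 + z) / z <= 2 / (1 - k) * (powR kap (- k) * powR (`|lam| * r ^+ n.+3) (- k)).
  apply: le_trans (ln1D_le_powR z0 k01) _.
  rewrite ler_wpM2l ?divr_ge0 ?subr_ge0 ?(ltW k1)//.
  have kL : 0 < kap * (`|lam| * r ^+ n.+3) by rewrite mulr_gt0.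
  rewrite -powRM ?(ltW kap0) ?(ltW Lr0)// !powRN lef_pV2 ?posrE; [|exact: powR_gt0..].
  by rewrite ge0_ler_powR ?nnegrE ?(ltW z0) ?(ltW kL).
rewrite [leRHS](_ : _ = 4 * B ^+ 2 * r ^+ 2 *
   (2 / (1 - k) * (powR kap (- k) * powR (`|lam| * r ^+ n.+3) (- k)))); last by ring.
apply: ler_pM => //.
- by rewrite !mulr_ge0// ?sqr_ge0// ltW.
- by rewrite divr_ge0 ?(ltW z0)// ln_ge0// lerDl ltW.
- apply: ler_wpM2l; first by rewrite mulr_ge0// ltW.
  by rewrite lerXn2r ?nnegrE ?(ltW l0) ?(ltW r0).
Qed.

(** All three terms scale at worst like r^(-(n+1)): the derivative of the amplitude comes with a
    factor l <= R0, and the third derivative of S, of size r^n, comes with l <= r. *)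
Lemma osc_E_bound (B B1 c C3 r R0 l : R) (n : nat) : 0 < B -> 0 <= B1 -> 0 < c -> 0 <= C3 ->
  0 < r <= R0 -> 0 <= l <= r ->
  2 * B ^+ 2 / (c * r ^+ n.+1) + l * (2 * B * B1 / (c * r ^+ n.+1) +
     B ^+ 2 * (C3 * r ^+ n) / (c * r ^+ n.+1) ^+ 2)
  <= (2 * B ^+ 2 / c + R0 * (2 * B * B1 / c) + B ^+ 2 * C3 / c ^+ 2) / r ^+ n.+1.
Proof.
move=> B0 B10 c0 C30 /andP[r0 rR] /andP[l0 lr].
have rn : 0 < r ^+ n by rewrite exprn_gt0.
have rn1 : 0 < r ^+ n.+1 by rewrite exprn_gt0.
rewrite [leLHS](_ : _ = 2 * B ^+ 2 / (c * r ^+ n.+1) + l * (2 * B * B1 / (c * r ^+ n.+1)) +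
   l * (B ^+ 2 * (C3 * r ^+ n) / (c * r ^+ n.+1) ^+ 2)); last by ring.
rewrite [leRHS](_ : _ = 2 * B ^+ 2 / c / r ^+ n.+1 + R0 * (2 * B * B1 / c) / r ^+ n.+1 +
   B ^+ 2 * C3 / c ^+ 2 / r ^+ n.+1); last by ring.
apply: lerD; first apply: lerD.
- by rewrite le_eqVlt; apply/orP; left; apply/eqP; field; rewrite !gt_eqF.
- rewrite [leLHS](_ : _ = l * (2 * B * B1 / c) / r ^+ n.+1); last by field; rewrite !gt_eqF.
  rewrite ler_wpM2r ?invr_ge0 ?(ltW rn1)// ler_wpM2r ?(le_trans lr rR)//.
  by rewrite divr_ge0 ?(ltW c0)// !mulr_ge0// ltW.
- rewrite [leLHS](_ : _ = l / r * (B ^+ 2 * C3 / c ^+ 2 / r ^+ n.+1)); last first.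
    by rewrite [r ^+ n.+1]exprS; field; rewrite !gt_eqF.
  rewrite ler_piMl//; last by rewrite ler_pdivrMr// mul1r.
  by rewrite !mulr_ge0 ?invr_ge0 ?sqr_ge0// ltW.
Qed.

Lemma continuous_ball_bound n (F : 'rV[R]_n -> R) (R0 : R) : continuous F ->
  exists2 B, 0 < B & forall z, in_ball R0 z -> `|F z| <= B.
Proof.
move=> cF.
pose A := [set w : 'rV[R]_n | forall i, `[- R0, R0]%classic (w ord0 i)].
have cA : compact A.
  by apply: (@rV_compact _ _ (fun=> `[- R0, R0]%classic)) => i; exact: segment_compact.
have AP z : in_ball R0 z -> A z.
  by move=> zR i; rewrite /= in_itv/= -ler_norml; exact: zR.
have [A0|/set0P/negP/negPn/eqP A0] := pselect (A !=set0); last first.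
  by exists 1 => // z /AP; rewrite A0.
have cN : continuous (fun z => `|F z|).
  by move=> z; apply: continuous_comp; [exact: cF|exact: norm_continuous].
have [w0 Aw0 w0max] := compact_EVT_max A0 cA (continuous_subspaceT cN).
exists (`|F w0| + 1); first by rewrite ltr_wpDl.
move=> z /AP Az; apply: (@le_trans _ _ `|F w0|); last by rewrite lerDl.
by apply: w0max; rewrite inE.
Qed.

Lemma is_derive_curve n (F : 'rV[R]_n -> R) (v : 'rV[R]_n) (w : R -> 'rV[R]_n) (t : R) :
  (forall t h, w (h + t) = h *: v + w t) -> derivable F (w t) v ->
  is_derive t 1 (fun t => F (w t)) (derive F (w t) v).
Proof.
move=> wv dF.
have E : (fun h : R => h^-1 *: (F (w (h *: (1 : R) + t)) - F (w t))) =
   (fun h : R => h^-1 *: (F (h *: v + w t) - F (w t))).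
  apply/funext => h; have -> : h *: (1 : R) = h by rewrite /GRing.scale /= mulr1.
  by rewrite wv.
apply: DeriveDef.
  by rewrite /derivable; move: dF; rewrite /derivable -E.
by rewrite /derive -E.
Qed.

End estimates.

(** * The L^2 bound on one cell *)

Section cell_estimate.
Context {R : realType}.

Lemma measurable_row_mx n1 n2 :
  measurable_fun setT (fun z : @rVE R n1 * @rVE R n2 => row_mx z.1 z.2 : @rVE R (n1 + n2)).
Proof.
apply: measurable_rV => k; case: (split_ordP k) => i ->.
  rewrite (_ : (fun z => _) = (fun x : @rVE R n1 => x 0 i) \o fst).
    exact: measurableT_comp (measurable_coord i) measurable_fst.
  by apply/funext => z; rewrite row_mxEl.
rewrite (_ : (fun z => _) = (fun x : @rVE R n2 => x 0 i) \o snd).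
  exact: measurableT_comp (measurable_coord i) measurable_snd.
by apply/funext => z; rewrite row_mxEr.
Qed.

Section curves.
Variables (n1 n2 : nat).

Lemma row_rVins_l (i : 'I_n1.+1) (x : 'rV[R]_n1) (y : 'rV[R]_n2) (t h : R) :
  row_mx (rVins i (h + t) x) y = h *: delta_mx ord0 (lshift n2 i) + row_mx (rVins i t x) y.
Proof.
apply/rowP => k; rewrite !mxE eqxx /=; case: (split_ordP k) => j ->.
  rewrite eq_lshift !mxE; case: unliftP => [j' ->|->].
    by rewrite eq_sym (negbTE (neq_lift _ _)) mulr0 add0r.
  by rewrite eqxx mulr1.
by rewrite eq_rlshift mulr0 add0r.
Qed.

Lemma is_derive_peval_l (p : mpoly.mpoly (n1.+1 + n2) R) i (x : 'rV[R]_n1) (y : 'rV[R]_n2) (t : R) :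
  is_derive t 1 (fun t => peval p (row_mx (rVins i t x) y))
    (peval (mpoly.mderiv (lshift n2 i) p) (row_mx (rVins i t x) y)).
Proof.
apply: (@is_derive_peval _ _ p _ (fun t => row_mx (rVins i t x) y)) => [u|k ki u v].
  by rewrite row_mxEl rVins_id.
move: ki; case: (split_ordP k) => j ->; last by rewrite !row_mxEr.
by rewrite eq_lshift !row_mxEl; case: (unliftP i j) => [j' ->|->]; rewrite ?eqxx// !rVins_lift.
Qed.

Lemma is_derive_peval_r (p : mpoly.mpoly (n1 + n2.+1) R) j (x : 'rV[R]_n1) (y : 'rV[R]_n2) (t : R) :
  is_derive t 1 (fun t => peval p (row_mx x (rVins j t y)))
    (peval (mpoly.mderiv (rshift n1 j) p) (row_mx x (rVins j t y))).
Proof.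
apply: (@is_derive_peval _ _ p _ (fun t => row_mx x (rVins j t y))) => [u|k ki u v].
  by rewrite row_mxEr rVins_id.
move: ki; case: (split_ordP k) => i ->; first by rewrite !row_mxEl.
by rewrite eq_rshift !row_mxEr; case: (unliftP j i) => [j' ->|->]; rewrite ?eqxx// !rVins_lift.
Qed.

Lemma continuous_row_rVins_l (F : 'rV[R]_(n1.+1 + n2) -> R) i (x : 'rV[R]_n1) (y : 'rV[R]_n2) :
  continuous F -> continuous (fun t : R => F (row_mx (rVins i t x) y)).
Proof.
move=> cF t.
have E : (fun t : R => row_mx (rVins i t x) y) =
   (fun t : R => t *: delta_mx ord0 (lshift n2 i) + row_mx (rVins i 0 x) y).
  by apply/funext => u; rewrite -[u in LHS]addr0 row_rVins_l.
have cw : {for t, continuous (fun t : R => row_mx (rVins i t x) y)}.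
  rewrite E; apply: continuousD; last exact: cvg_cst.
  exact: scalel_continuous.
exact: (continuous_comp cw (@cF _)).
Qed.

End curves.

Variables (n1 n2 e : nat).
Local Notation nX := n1.+1.
Local Notation nY := n2.+1.
Variables (S : mpoly.mpoly (nX + nY) R) (phi : 'rV[R]_(nX + nY) -> R) (R0 : R).
Hypothesis homS : homogeneous_of_degree e.+3 S.
Hypothesis rk1 : rank_one_condition S.
Hypothesis cphi : continuous phi.
Hypothesis dphi : forall v a, derivable phi a v.
Hypothesis cdphi : forall v, continuous (fun a => derive phi a v).
Hypothesis R00 : 0 < R0.
Hypothesis bphi : bmf (fun z : @rVE R nX * @rVE R nY => phi (row_mx z.1 z.2)).

Definition kern (g : R -> R) (lam : R) (z : @rVE R nX * @rVE R nY) : R :=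
  phi (row_mx z.1 z.2) * g (lam * peval S (row_mx z.1 z.2)).

Definition cell_kern (g : R -> R) (lam : R) cX cY l (z : @rVE R nX * @rVE R nY) : R :=
  (cell cX l z.1)%:R * (cell cY l z.2)%:R * kern g lam z.

(** Integration by parts and the mean value theorem work on closed intervals, so derivative bounds
    are required up to the faces that [cell] leaves out. *)
Definition closed_cell n (c : 'rV[R]_n) (l : R) (z : 'rV[R]_n) :=
  forall k, c ord0 k <= z ord0 k <= c ord0 k + l.

Lemma bmf_kern g lam : continuous g -> (forall x, `|g x| <= 1) -> bmf (kern g lam).
Proof.
move=> cg g1; apply: bmfM => //; split; last by exists 1 => z.
apply: (measurableT_comp (continuous_measurable_fun cg)).
apply: measurable_funM; first exact: measurable_cst.
have mp : measurable_fun setT (peval S : @rVE R (nX + nY) -> R).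
  by apply: continuous_measurable_rV; exact: continuous_peval.
exact: (measurableT_comp mp (@measurable_row_mx nX nY)).
Qed.

Lemma bmf_cell_kern g lam cX cY l : continuous g -> (forall x, `|g x| <= 1) ->
  bmf (cell_kern g lam cX cY l).
Proof.
move=> cg g1; apply: bmfM; last exact: bmf_kern.
by apply: bmfM; [exact: (@bmf_comp _ _ _ _ _ fst _ _ (bmf_cell cX l))|
  exact: (@bmf_comp _ _ _ _ _ snd _ _ (bmf_cell cY l))].
Qed.

Local Notation mX := (vmu (bmu R0) nX).
Local Notation mY := (vmu (bmu R0) nY).

(** K comes from the geometry of S and is fixed before k, because the final summation uses two
    values of k on the same cells. *)
Lemma cell_L2 : exists2 K : nat, (0 < K)%N & forall k, 0 <= k < 1 -> exists2 G : R, 0 < G &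
  forall lam r cX cY, lam != 0 -> 0 < r <= R0 ->
    (forall z, closed_cell (row_mx cX cY) (r / (2 * K%:R)) z -> in_ball r z) ->
    (forall z, closed_cell (row_mx cX cY) (r / (2 * K%:R)) z -> exists k, r / 2 <= `|z ord0 k|) ->
    forall f : @rVE R nY -> R, bmf f ->
    \int[mX]_x ((\int[mY]_y (cell_kern cos lam cX cY (r / (2 * K%:R)) (x, y) * f y)) ^+ 2 +
                (\int[mY]_y (cell_kern sin lam cX cY (r / (2 * K%:R)) (x, y) * f y)) ^+ 2)
      <= G * (r ^+ (nX + nY) * powR (`|lam| * r ^+ e.+3) (- k)) * \int[mY]_y (f y ^+ 2).
Proof.
have [K K0 [c c0 hcell]] := rank_one_cells homS rk1.
exists K => // k k01.
have [B B0 hB] := continuous_ball_bound R0 cphi.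
have [B1 B10 hB1] : exists2 B1 : R, 0 <= B1 & forall i : 'I_(nX + nY), forall z, in_ball R0 z ->
    `|derive phi z (delta_mx ord0 i)| <= B1.
  have hh (i : 'I_(nX + nY)) := cid2 (continuous_ball_bound R0 (@cdphi (delta_mx ord0 i))).
  exists (\sum_i s2val (hh i)); first by apply: sumr_ge0 => i _; case: (hh i) => /= x /ltW.
  move=> i z zR; apply: (@le_trans _ _ (s2val (hh i))); first by case: (hh i) => /= x _; exact.
  by rewrite (bigD1 i)//= lerDl; apply: sumr_ge0 => j _; case: (hh j) => /= x /ltW.
(* Twice in x_i and once in y_j: this derivative, of degree d - 3, controls the second t-derivative
   of the phase difference. *)
pose D3 (ij : 'I_nX * 'I_nY) := mpoly.mderiv (rshift nX ij.2)
   (mpoly.mderiv (lshift nY ij.1) (mpoly.mderiv (lshift nY ij.1) S)).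
have homD3 ij : homogeneous_of_degree e (D3 ij).
  by do 3 apply: mderiv_homogeneous.
have [C3 C30 hC3] : exists2 C3 : R, 0 <= C3 & forall ij r z, 0 < r -> in_ball r z ->
    `|peval (D3 ij) z| <= C3 * r ^+ e.
  have hh ij := cid2 (peval_homogeneous_bound (homD3 ij)).
  exists (\sum_ij s2val (hh ij)); first by apply: sumr_ge0 => ij _; case: (hh ij).
  move=> ij r z r0 zr; apply: (@le_trans _ _ (s2val (hh ij) * r ^+ e)).
    by case: (hh ij) => /= x _; exact.
  rewrite ler_wpM2r ?exprn_ge0 ?(ltW r0)// (bigD1 ij)//= lerDl.
  by apply: sumr_ge0 => j _; case: (hh j).
pose E0 := 2 * B ^+ 2 / c + R0 * (2 * B * B1 / c) + B ^+ 2 * C3 / c ^+ 2.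
have E00 : 0 < E0.
  rewrite /E0 -addrA ltr_pwDl//; first by rewrite divr_gt0// mulr_gt0// exprn_gt0.
  apply: addr_ge0; last by rewrite divr_ge0 ?sqr_ge0// mulr_ge0// sqr_ge0.
  by rewrite mulr_ge0 ?(ltW R00)// divr_ge0 ?(ltW c0)// !mulr_ge0// ltW.
pose G := 4 * B ^+ 2 * (2 / (1 - k)) * powR (B ^+ 2 / (4 * K%:R ^+ 2 * E0)) (- k).
have KR : 0 < K%:R :> R by rewrite ltr0n.
have G0 : 0 < G.
  have [_ k1] := andP k01.
  rewrite /G; apply: mulr_gt0; last first.
    by rewrite powR_gt0// divr_gt0 ?exprn_gt0// !mulr_gt0// exprn_gt0.
  by rewrite !mulr_gt0 ?exprn_gt0// invr_gt0 subr_gt0.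
exists G => // lam r cX cY lam0 rR hin hk f bf.
have [r0 rR0] := andP rR.
set l := r / (2 * K%:R) in hin hk *.
have l0 : 0 < l by rewrite divr_gt0// mulr_gt0.
have lr : l <= r.
  rewrite /l ler_pdivrMr ?mulr_gt0// ler_peMr ?(ltW r0)//.
  have : 1 <= K%:R :> R by rewrite ler1n.
  by lra.
have corner : closed_cell (row_mx cX cY) l (row_mx cX cY).
  by move=> k'; rewrite lexx lerDl ltW.
have dist z z' k' : closed_cell (row_mx cX cY) l z -> closed_cell (row_mx cX cY) l z' ->
    `|z ord0 k' - z' ord0 k'| <= r / (2 * K%:R).
  move=> /(_ k')/andP[h1 h2] /(_ k')/andP[h3 h4]; rewrite -/l ler_norml; apply/andP; split; lra.
have [i [j hij]] := hcell r (closed_cell (row_mx cX cY) l) r0 hin hk dist (ex_intro _ _ corner).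
(* Keeps the cell where the restricted measure is Lebesgue measure; the two extreme corners of the
   closed cell suffice. *)
have incube k' : - R0 <= row_mx cX cY ord0 k' /\ row_mx cX cY ord0 k' + l <= R0.
  split.
    have /(_ k') := hin _ corner; rewrite ler_norml => /andP[h _].
    by apply: le_trans h; rewrite lerN2.
  have top : closed_cell (row_mx cX cY) l (row_mx cX cY + const_mx l).
    by move=> k''; rewrite !mxE lexx lerDl (ltW l0).
  have := hin _ top k'; rewrite !mxE ler_norml => /andP[_ h].
  by apply: le_trans h rR0.
have cXi : row_mx cX cY ord0 (lshift nY i) = cX ord0 i by rewrite row_mxEl.
have cYj : row_mx cX cY ord0 (rshift nX j) = cY ord0 j by rewrite row_mxEr.
pose q := c * r ^+ e.+1; pose q2 := C3 * r ^+ e.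
pose E := 2 * B ^+ 2 / q + l * (2 * B * B1 / q + B ^+ 2 * q2 / q ^+ 2).
have q0 : 0 < q by rewrite mulr_gt0// exprn_gt0.
have q20 : 0 <= q2 by rewrite mulr_ge0// exprn_ge0// ltW.
have EE0 : 0 < E by exact: (osc_E_gt0 l0 q0 B0 B10 q20).
have EE : E <= E0 / r ^+ e.+1.
  by apply: osc_E_bound => //; rewrite lr (ltW l0).
pose nu := B ^+ 2 * l * `|lam| / E.
pose N := 4 * B ^+ 2 * l * ln (1 + nu * l) / nu.
have nu0 : 0 < nu by rewrite /nu divr_gt0// mulr_gt0 ?normr_gt0// mulr_gt0// exprn_gt0.
have N0 : 0 <= N.
  rewrite divr_ge0 ?(ltW nu0)// mulr_ge0//; last by rewrite ln_ge0// lerDl mulr_ge0// ltW.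
  by rewrite !mulr_ge0// ?sqr_ge0// ltW.
have NG : N <= G * (r ^+ 2 * powR (`|lam| * r ^+ e.+3) (- k)).
  exact: (@osc_constant_bound _ B l lam E E0 r k K e).
have bc : bmf (cell_kern cos lam cX cY l).
  by apply: bmf_cell_kern; [exact: continuous_cos|exact: cos_max].
have bs : bmf (cell_kern sin lam cX cY l).
  by apply: bmf_cell_kern; [exact: continuous_sin|exact: sin_max].
have kI g t x y : cell_kern g lam cX cY l (rVins i t x, y) =
    (cell (rVdel i cX) l x)%:R * cell_kern g lam cX cY l (rVins i t x, y).
  rewrite /cell_kern /= cell_rVins.
  by case: (cell (rVdel i cX) l x); rewrite ?andbT ?andbF ?b2R0 ?b2R1 ?mul1r ?mul0r.
have kJ g x s y : cell_kern g lam cX cY l (x, rVins j s y) =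
    (cell (rVdel j cY) l y)%:R * cell_kern g lam cX cY l (x, rVins j s y).
  rewrite /cell_kern /= cell_rVins.
  by case: (cell (rVdel j cY) l y); rewrite ?andbT ?andbF ?b2R0 ?b2R1 ?mul1r ?(mulr0, mul0r).
have H1 x y (h : measurableTypeR R -> R) : cell (rVdel i cX) l x -> cell (rVdel j cY) l y -> bmf h ->
  \int[bmu R0]_t ((\int[bmu R0]_s (cell_kern cos lam cX cY l (rVins i t x, rVins j s y) * h s)) ^+ 2 +
             (\int[bmu R0]_s (cell_kern sin lam cX cY l (rVins i t x, rVins j s y) * h s)) ^+ 2)
    <= N * \int[bmu R0]_s (h s ^+ 2).
  move=> Ix Jy bh.
  pose w t s : 'rV[R]_(nX + nY) := row_mx (rVins i t x) (rVins j s y).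
  have win t s : (cX ord0 i <= t <= cX ord0 i + l) && (cY ord0 j <= s <= cY ord0 j + l) ->
      closed_cell (row_mx cX cY) l (w t s).
    move=> /andP[ht hs] k'; rewrite /w; case: (split_ordP k') => k'' ->.
      rewrite !row_mxEl; case: (unliftP i k'') => [m|] ->; last by rewrite rVins_id.
      have /forallP/(_ m) := Ix; rewrite mxE rVins_lift => /andP[h1 h2].
      by rewrite h1 ltW.
    rewrite !row_mxEr; case: (unliftP j k'') => [m|] ->; last by rewrite rVins_id.
    have /forallP/(_ m) := Jy; rewrite mxE rVins_lift => /andP[h1 h2].
    by rewrite h1 ltW.
  have kE (g : R -> R) t s : cell_kern g lam cX cY l (rVins i t x, rVins j s y) =
     (cX ord0 i <= t < cX ord0 i + l)%R%:R * (cY ord0 j <= s < cY ord0 j + l)%R%:R *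
     (phi (w t s) * g (lam * peval S (w t s))).
    by rewrite /cell_kern /= !cell_rVins Ix Jy !andbT.
  have mw : measurable_fun setT (fun z : measurableTypeR R * measurableTypeR R =>
      (rVins i z.1 x : @rVE R nX, rVins j z.2 y : @rVE R nY)).
    by apply: measurable_fun_pair; apply: measurable_rVins.
  have [c1l c1r] := incube (lshift nY i); have [c2l c2r] := incube (rshift nX j).
  rewrite cXi in c1l c1r; rewrite cYj in c2l c2r.
  have := @osc_L2 R R0 l (cX ord0 i) (cY ord0 j) lam l0 lam0 c1l c1r c2l c2r
    (fun t s => phi (w t s)) (fun t s => peval S (w t s))
    (fun t s => derive phi (w t s) (delta_mx ord0 (lshift nY i)))
    (fun t s => peval (mpoly.mderiv (lshift nY i) S) (w t s))
    (fun t s => peval (mpoly.mderiv (lshift nY i) (mpoly.mderiv (lshift nY i) S)) (w t s))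
    (fun t s => peval (dxdy S i j) (w t s)) (fun t s => peval (D3 (i, j)) (w t s))
    q q2 B B1 q0 B0 B10 q20.
  have e1 : bmf (fun z : measurableTypeR R * measurableTypeR R => phi (w z.1 z.2)).
    exact: (bmf_comp mw bphi).
  have e2 : measurable_fun setT (fun z : measurableTypeR R * measurableTypeR R => peval S (w z.1 z.2)).
    have mp : measurable_fun setT (peval S : @rVE R (nX + nY) -> R).
      by apply: continuous_measurable_rV; exact: continuous_peval.
    exact: (measurableT_comp mp (measurableT_comp (@measurable_row_mx nX nY) mw)).
  have e3 (t s : R) : is_derive t 1 ((fun t s => phi (w t s)) ^~ s)
      (derive phi (w t s) (delta_mx ord0 (lshift nY i))).
    apply: (@is_derive_curve _ _ phi _ (fun t => w t s)) => [t' h'|]; last exact: dphi.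
    exact: row_rVins_l.
  have e4 (s : R) : continuous ((fun t s => derive phi (w t s) (delta_mx ord0 (lshift nY i))) ^~ s).
    exact: (@continuous_row_rVins_l _ _ (fun a => derive phi a _) i x (rVins j s y) (@cdphi _)).
  have e5 (t s : R) := @is_derive_peval_l n1 nY S i x (rVins j s y) t.
  have e6 (t s : R) := @is_derive_peval_l n1 nY (mpoly.mderiv (lshift nY i) S) i x (rVins j s y) t.
  have e7 (s : R) := @continuous_row_rVins_l n1 nY _ i x (rVins j s y)
    (@continuous_peval _ _ (mpoly.mderiv (lshift nY i) (mpoly.mderiv (lshift nY i) S))).
  have e8 (t s : R) := @is_derive_peval_r nX n2 (mpoly.mderiv (lshift nY i) S) j (rVins i t x) y s.
  have e9 (t s : R) := @is_derive_peval_r nX n2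
    (mpoly.mderiv (lshift nY i) (mpoly.mderiv (lshift nY i) S)) j (rVins i t x) y s.
  have f1 t s : (cX ord0 i <= t <= cX ord0 i + l) && (cY ord0 j <= s <= cY ord0 j + l) ->
      `|phi (w t s)| <= B.
    move=> /win/hin h'; apply: hB => k'; exact: le_trans (h' k') rR0.
  have f2 t s : (cX ord0 i <= t <= cX ord0 i + l) && (cY ord0 j <= s <= cY ord0 j + l) ->
      `|derive phi (w t s) (delta_mx ord0 (lshift nY i))| <= B1.
    move=> /win/hin h'; apply: hB1 => k'; exact: le_trans (h' k') rR0.
  have f3 t s : (cX ord0 i <= t <= cX ord0 i + l) && (cY ord0 j <= s <= cY ord0 j + l) ->
      q <= `|peval (dxdy S i j) (w t s)|.
    by move=> /win; exact: hij.
  have f4 t s : (cX ord0 i <= t <= cX ord0 i + l) && (cY ord0 j <= s <= cY ord0 j + l) ->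
      `|peval (D3 (i, j)) (w t s)| <= q2.
    by move=> /win/hin h'; exact: hC3.
  move=> /(_ e1 e2 e3 e4 e5 e6 e7 e8 e9 f1 f2 f3 f4 h bh) le_main.
  apply: le_trans le_main; rewrite le_eqVlt; apply/orP; left; apply/eqP.
  apply: eq_Rintegral => t _; congr (_ ^+ 2 + _ ^+ 2).
    by apply: eq_Rintegral => s _; rewrite kE.
  by apply: eq_Rintegral => s _; rewrite kE.
have main := freezing_L2 (bmu_fin R0) bc bs (bmf_cell _ _) (bmf_cell _ _)
  (Rintegral_cell_le _ _ (ltW l0)) (Rintegral_cell_le _ _ (ltW l0)) N0
  (kI cos) (kI sin) (kJ cos) (kJ sin) H1 bf.
apply: (le_trans main); rewrite ler_wpM2r//.
  by apply: Rintegral_ge0 => y _; exact: sqr_ge0.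
(* The nX - 1 and nY - 1 frozen variables give r^n1 r^n2; the remaining r^2 comes from the pair
   (x_i, y_j). *)
rewrite [leRHS](_ : _ = r ^+ n1 * r ^+ n2 * (G * (r ^+ 2 * powR (`|lam| * r ^+ e.+3) (- k)))); last first.
  by rewrite (_ : (nX + nY)%N = (n1 + n2 + 2)%N) ?exprD; [ring|by rewrite addSn addnS addn2].
apply: ler_pM => //; first by rewrite mulr_ge0// exprn_ge0// ltW.
by rewrite ler_pM ?exprn_ge0 ?(ltW l0)// lerXn2r ?nnegrE ?(ltW l0) ?(ltW r0).
Qed.

End cell_estimate.

(** * The bound on one cell and summation over dyadic shells *)

Section bilinear_bounds.
Context {R : realType} d1 d2 (X : measurableType d1) (Y : measurableType d2).
Variables (m1 : {sigma_finite_measure set X -> \bar R})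
  (m2 : {sigma_finite_measure set Y -> \bar R}).
Hypotheses (fin1 : (m1 setT < +oo)%E) (fin2 : (m2 setT < +oo)%E).
Variable k : X * Y -> R.
Hypothesis bk : bmf k.

(** Young's inequality |g U| <= U^2 / A + A g^2, where U is the image of f. *)
Lemma bform_of_L2 (A : R) : 0 < A ->
  (forall f, bmf f -> \int[m1]_x ((\int[m2]_y (k (x, y) * f y)) ^+ 2) <=
     A ^+ 2 * \int[m2]_y (f y ^+ 2)) ->
  forall f g, bmf f -> bmf g ->
    `|bform m1 m2 k f g| <= A * (\int[m2]_y (f y ^+ 2) + \int[m1]_x (g x ^+ 2)).
Proof.
move=> A0 H f g bf bg; pose U x := \int[m2]_y (k (x, y) * f y).
have bU : bmf U by exact: bmf_op.
apply: le_trans (bmf_Rint_norm fin1 (bmfM bg bU)) _.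
apply: (@le_trans _ _ (\int[m1]_x (A^-1 * U x ^+ 2 + A * g x ^+ 2))).
  apply: (bmf_le_Rint fin1).
  - exact: bmf_norm (bmfM bg bU).
  - by apply: bmfD; apply: bmfZ; exact: bmfX.
  move=> x; rewrite -(@ler_pM2l _ A)// mulrDr mulrA mulfV ?gt_eqF// mul1r mulrA -expr2.
  rewrite normrM -(real_normK (num_real (U x))) -(real_normK (num_real (g x))) -exprMn.
  have := sqr_ge0 (A * `|g x| - `|U x|); rewrite sqrrB.
  have := mulr_ge0 (mulr_ge0 (ltW A0) (normr_ge0 (g x))) (normr_ge0 (U x)).
  by rewrite [A * (_ * _)]mulrA; lra.
rewrite (bmf_RintD fin1); [|by apply: bmfZ; exact: bmfX..].
rewrite !(bmf_RintZl fin1); [|exact: bmfX..].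
rewrite mulrDr lerD2r mulrC ler_pdivrMr//.
by apply: le_trans (H _ bf) _; rewrite expr2 mulrAC.
Qed.

End bilinear_bounds.

Section interpolation_all.
Context {R : realType}.

(** C is chosen before the spaces and the kernel, hence is common to all cells. [M2] is the L^oo
    bound and serves for p > 2; [M1] is the L^1 bound and serves for p < 2 through the transposed
    kernel. At p = 2, where the level set constant degenerates, the L^2 bound is used directly. *)
Lemma interpolation (p : R) : 1 < p -> exists2 C : R, 0 < C &
  forall d1 d2 (X : measurableType d1) (Y : measurableType d2)
  (m1 : {sigma_finite_measure set X -> \bar R})
  (m2 : {sigma_finite_measure set Y -> \bar R}) (k : X * Y -> R) (A M1 M2 s1 s2 : R),
  (m1 setT < +oo)%E -> (m2 setT < +oo)%E -> bmf k ->
  0 < A -> 0 < M1 -> 0 < M2 -> 0 < s1 -> 0 < s2 ->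
  A ^+ 2 = M2 ^+ 2 * powR s2 p -> A ^+ 2 = M1 ^+ 2 * powR s1 (p / (p - 1)) ->
  (forall x, \int[m2]_y `|k (x, y)| <= M2) -> (forall y, \int[m1]_x `|k (x, y)| <= M1) ->
  (forall f g, bmf f -> bmf g ->
    `|bform m1 m2 k f g| <= A * (\int[m2]_y (f y ^+ 2) + \int[m1]_x (g x ^+ 2))) ->
  forall f g, bmf f -> bmf g ->
    `|bform m1 m2 k f g| <= C * (if p < 2 then M1 * s1 else M2 * s2) *
      (\int[m2]_y powR `|f y| p + \int[m1]_x powR `|g x| (p / (p - 1))).
Proof.
move=> p1; set q := p / (p - 1).
have p10 : 0 < p - 1 by rewrite subr_gt0.
have qp : p = q / (q - 1).
  have q1 : q - 1 = (p - 1)^-1 by rewrite /q; field; rewrite gt_eqF.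
  by rewrite q1 invrK /q divfK// gt_eqF.
have cst (t : R) : 2 < t -> 0 < (1 - powR 2 (- (t - 2)))^-1 + 2.
  move=> t2; apply: ltr_wpDl => //; rewrite invr_ge0 subr_ge0 powRN invf_le1 ?powR_gt0//.
  have t0 : 0 <= t - 2 by lra.
  by have := @ge0_ler_powR R (t - 2) t0 1 2; rewrite powR1; apply; rewrite ?nnegrE ?ler1n.
have [p2|p2|p2] := ltgtP p 2.
- have q2 : 2 < q by rewrite /q ltr_pdivlMr//; lra.
  exists ((1 - powR 2 (- (q - 2)))^-1 + 2); first exact: cst.
  move=> d1 d2 X Y m1 m2 k A M1 M2 s1 s2 fin1 fin2 bk A0 M10 M20 s10 s20 E2 E1 H2 H1 HA f g bf bg.
  have HA' f' g' : bmf f' -> bmf g' -> `|bform m2 m1 (fun z => k (z.2, z.1)) f' g'| <=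
      A * (\int[m1]_x (f' x ^+ 2) + \int[m2]_y (g' y ^+ 2)).
    by move=> bf' bg'; rewrite (bform_swap fin1 fin2 bk)// addrC; exact: HA.
  have := interp_levels fin2 fin1 (bmf_swap bk) q2 s10 A0 M10 E1 HA' H1 bg bf.
  by rewrite -qp (bform_swap fin1 fin2 bk)// [\int[m1]__ _ + _]addrC.
- exists ((1 - powR 2 (- (p - 2)))^-1 + 2); first exact: cst.
  move=> d1 d2 X Y m1 m2 k A M1 M2 s1 s2 fin1 fin2 bk A0 M10 M20 s10 s20 E2 E1 H2 H1 HA f g bf bg.
  exact: (interp_levels fin1 fin2 bk p2 s20 A0 M20 E2).
- exists 1 => // d1 d2 X Y m1 m2 k A M1 M2 s1 s2 fin1 fin2 bk A0 M10 M20 s10 s20 E2 E1 H2 H1 HA f g bf bg.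
  have q2 : q = 2 by rewrite /q p2; field.
  have E : M2 * s2 = A.
    apply/eqP; rewrite -(@eqrXn2 _ 2) ?(ltW A0)//; last by rewrite mulr_ge0// ltW.
    by rewrite exprMn E2 p2 powR_mulrn// ltW.
  rewrite mul1r E q2 p2.
  apply: le_trans (HA _ _ bf bg) _; rewrite le_eqVlt; apply/orP; left; apply/eqP.
  by congr (_ * (_ + _)); apply: eq_Rintegral => x _; rewrite powR_mulrn// real_normK ?num_real.
Qed.

End interpolation_all.

Section cell_Lp.
Context {R : realType} (n1 n2 e : nat).
Local Notation nX := n1.+1.
Local Notation nY := n2.+1.
Variables (S : mpoly.mpoly (nX + nY) R) (phi : 'rV[R]_(nX + nY) -> R) (R0 : R).
Hypothesis homS : homogeneous_of_degree e.+3 S.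
Hypothesis rk1 : rank_one_condition S.
Hypothesis cphi : continuous phi.
Hypothesis dphi : forall v a, derivable phi a v.
Hypothesis cdphi : forall v, continuous (fun a => derive phi a v).
Hypothesis R00 : 0 < R0.
Hypothesis bphi : bmf (fun z : @rVE R nX * @rVE R nY => phi (row_mx z.1 z.2)).
Local Notation mX := (vmu (bmu R0) nX).
Local Notation mY := (vmu (bmu R0) nY).

(** The power of r in the trivial L^p bound on a cell, that is r^nX and r^nY weighted by 1/p and
    1/p'; it equals d times the exponent of the theorem. *)
Definition scale_exp (p : R) : R := nX%:R / p + nY%:R * (1 - p^-1).

(** The real and imaginary parts of e^(i t), indexed so that one bilinear bound covers both. *)
Definition trig (b : bool) : R -> R := if b then cos else sin.

Lemma continuous_trig b : continuous (trig b).
Proof. by case: b; [exact: continuous_cos|exact: continuous_sin]. Qed.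

Lemma trig_max b x : `|trig b x| <= 1.
Proof. by case: b; [exact: cos_max|exact: sin_max]. Qed.

(** Interpolating with r^nY on L^oo or with r^nX on L^1 gives the same power of r in both ranges of
    p, while the decay k / 2 turns into k / max(p, p'). *)
Lemma cell_Lp : exists2 K : nat, (0 < K)%N & forall p k, 1 < p -> 0 <= k < 1 -> exists2 G : R, 0 < G &
  forall b lam r cX cY, lam != 0 -> 0 < r <= R0 ->
    (forall z, closed_cell (row_mx cX cY) (r / (2 * K%:R)) z -> in_ball r z) ->
    (forall z, closed_cell (row_mx cX cY) (r / (2 * K%:R)) z -> exists k, r / 2 <= `|z ord0 k|) ->
    forall f g, bmf f -> bmf g ->
    `|bform mX mY (cell_kern S phi (trig b) lam cX cY (r / (2 * K%:R))) f g| <=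
      G * (powR r (scale_exp p) * powR (`|lam| * r ^+ e.+3) (- (k / Num.max p (p / (p - 1))))) *
      (\int[mY]_y powR `|f y| p + \int[mX]_x powR `|g x| (p / (p - 1))).
Proof.
have [K K0 hK] := cell_L2 homS rk1 cphi dphi cdphi R00 bphi.
exists K => // p k p1 k01; have [G G0 hG] := hK k k01.
have [C C0 hC] := interpolation p1.
have [P P0 hP] := bmf_bound bphi.
(* One constant in front of the L^2, L^1 and L^oo bounds, so that it cancels from the relations that
   [interpolation] asks for. *)
pose Ga := Num.max (Num.sqrt G) (P + 1).
have Ga0 : 0 < Ga by rewrite lt_max sqrtr_gt0 G0.
exists (C * Ga); first exact: mulr_gt0.
move=> b lam r cX cY lam0 rR hin hk f g bf bg.
have [r0 rR0] := andP rR.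
set l := r / (2 * K%:R) in hin hk *.
have KR : 0 < K%:R :> R by rewrite ltr0n.
have l0 : 0 < l by rewrite divr_gt0// mulr_gt0.
have lr : l <= r.
  rewrite /l ler_pdivrMr ?mulr_gt0// ler_peMr ?(ltW r0)//.
  have : 1 <= K%:R :> R by rewrite ler1n.
  by lra.
pose mu := `|lam| * r ^+ e.+3.
have mu0 : 0 < mu by rewrite mulr_gt0 ?normr_gt0// exprn_gt0.
set q := p / (p - 1).
have p0 : 0 < p by apply: lt_trans p1.
have p10 : 0 < p - 1 by rewrite subr_gt0.
have q0 : 0 < q by rewrite divr_gt0.
pose kb := cell_kern S phi (trig b) lam cX cY l.
have bkb : bmf kb by apply: bmf_cell_kern => //; [exact: continuous_trig|exact: trig_max].
have finX : (mX setT < +oo)%E := vmu_fin (bmu_fin R0) nX.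
have finY : (mY setT < +oo)%E := vmu_fin (bmu_fin R0) nY.
pose A := Ga * (powR r ((nX + nY)%:R / 2) * powR mu (- (k / 2))).
have A0 : 0 < A by rewrite !mulr_gt0 ?powR_gt0.
have A2 : A ^+ 2 = Ga ^+ 2 * (powR r (nX + nY)%:R * powR mu (- k)).
  rewrite !exprMn -[powR r _ ^+ 2]powR_mulrn ?powR_ge0//.
  rewrite -[powR mu _ ^+ 2]powR_mulrn ?powR_ge0// -!powRrM.
  by rewrite divfK// mulNr divfK.
have HA f' g' : bmf f' -> bmf g' ->
   `|bform mX mY kb f' g'| <= A * (\int[mY]_y (f' y ^+ 2) + \int[mX]_x (g' x ^+ 2)).
  apply: bform_of_L2 => // h bh.
  have bkc : bmf (cell_kern S phi cos lam cX cY l).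
    by apply: (@bmf_cell_kern _ _ _ _ _ bphi cos) => //; [exact: continuous_cos|exact: cos_max].
  have bks : bmf (cell_kern S phi sin lam cX cY l).
    by apply: (@bmf_cell_kern _ _ _ _ _ bphi sin) => //; [exact: continuous_sin|exact: sin_max].
  have bUc : bmf (fun x => (\int[mY]_y (cell_kern S phi cos lam cX cY l (x, y) * h y)) ^+ 2).
    by apply: bmfX; apply: bmf_op.
  have bUs : bmf (fun x => (\int[mY]_y (cell_kern S phi sin lam cX cY l (x, y) * h y)) ^+ 2).
    by apply: bmfX; apply: bmf_op.
  have bU : bmf (fun x => (\int[mY]_y (kb (x, y) * h y)) ^+ 2).
    by apply: bmfX; apply: bmf_op.
  apply: (@le_trans _ _ (G * (r ^+ (nX + nY) * powR mu (- k)) * \int[mY]_y (h y ^+ 2))).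
    apply: le_trans (hG lam r cX cY lam0 rR hin hk h bh).
    apply: (bmf_le_Rint finX) => //; first exact: bmfD.
    by move=> x; rewrite /kb /trig; case: (b); rewrite ?lerDl ?lerDr sqr_ge0.
  apply: ler_wpM2r; first by apply: Rintegral_ge0 => y _; exact: sqr_ge0.
  rewrite A2 -powR_mulrn ?(ltW r0)//; apply: ler_wpM2r; first by rewrite mulr_ge0 ?powR_ge0.
  rewrite -[leLHS]sqr_sqrtr ?(ltW G0)// lerXn2r ?nnegrE ?sqrtr_ge0 ?(ltW Ga0)//.
  by rewrite le_max lexx.
have kbP x y : `|kb (x, y)| <= (cell cX l x)%:R * ((cell cY l y)%:R * P).
  rewrite /kb /cell_kern /kern !normrM !normr_nat /= -!mulrA.
  do 2 apply: ler_wpM2l => //.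
  by rewrite -[leRHS]mulr1 ler_pM// ?trig_max//; exact: (hP (x, y)).
pose M1 := Ga * powR r nX%:R; pose M2 := Ga * powR r nY%:R.
have M10 : 0 < M1 by rewrite mulr_gt0 ?powR_gt0.
have M20 : 0 < M2 by rewrite mulr_gt0 ?powR_gt0.
have PG : P <= Ga by rewrite le_max lerDl ler01 orbT.
have HM2 x : \int[mY]_y `|kb (x, y)| <= M2.
  apply: (@le_trans _ _ (\int[mY]_y ((cell cY l y)%:R * P))).
    apply: (bmf_le_Rint finY).
    - exact: bmf_norm (bmf_pair1 x bkb).
    - by apply: bmfM; [exact: bmf_cell|exact: bmf_cst].
    move=> y; apply: le_trans (kbP x y) _; rewrite ler_piMl ?mulr_ge0//.
    by rewrite -[leRHS]/(1%:R) ler_nat leq_b1.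
  rewrite (bmf_RintZr finY _ (bmf_cell _ _)) mulrC /M2 powR_mulrn ?(ltW r0)//.
  apply: ler_pM => //; first exact: Rintegral_ge0.
  apply: le_trans (Rintegral_cell_le _ _ (ltW l0)) _.
  by rewrite lerXn2r ?nnegrE ?(ltW l0) ?(ltW r0).
have HM1 y : \int[mX]_x `|kb (x, y)| <= M1.
  apply: (@le_trans _ _ (\int[mX]_x ((cell cX l x)%:R * P))).
    apply: (bmf_le_Rint finX).
    - exact: bmf_norm (bmf_pair2 y bkb).
    - by apply: bmfM; [exact: bmf_cell|exact: bmf_cst].
    move=> x; apply: le_trans (kbP x y) _; apply: ler_wpM2l => //; rewrite ler_piMl//.
    by rewrite -[leRHS]/(1%:R) ler_nat leq_b1.
  rewrite (bmf_RintZr finX _ (bmf_cell _ _)) mulrC /M1 powR_mulrn ?(ltW r0)//.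
  apply: ler_pM => //; first exact: Rintegral_ge0.
  apply: le_trans (Rintegral_cell_le _ _ (ltW l0)) _.
  by rewrite lerXn2r ?nnegrE ?(ltW l0) ?(ltW r0).
(* These solve s2^p = (A / M2)^2 and s1^q = (A / M1)^2. *)
pose s2 := powR r ((nX%:R - nY%:R) / p) * powR mu (- (k / p)).
pose s1 := powR r ((nY%:R - nX%:R) / q) * powR mu (- (k / q)).
have rD u v : powR r u * powR r v = powR r (u + v).
  by rewrite powRD// (gt_eqF r0) implybT.
have E2 : A ^+ 2 = M2 ^+ 2 * powR s2 p.
  rewrite A2 /M2 /s2 exprMn powRM ?powR_ge0// -!powRrM -[powR r nY%:R ^+ 2]powR_mulrn ?powR_ge0//.
  rewrite -powRrM divfK ?gt_eqF// mulNr divfK ?gt_eqF//.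
  rewrite -[RHS]mulrA [X in _ = _ * X]mulrA rD; congr (_ * (powR r _ * _)).
  by rewrite natrD; ring.
have E1 : A ^+ 2 = M1 ^+ 2 * powR s1 q.
  rewrite A2 /M1 /s1 exprMn powRM ?powR_ge0// -!powRrM -[powR r nX%:R ^+ 2]powR_mulrn ?powR_ge0//.
  rewrite -powRrM divfK ?gt_eqF// mulNr divfK ?gt_eqF//.
  rewrite -[RHS]mulrA [X in _ = _ * X]mulrA rD; congr (_ * (powR r _ * _)).
  by rewrite natrD; ring.
have s10 : 0 < s1 by rewrite mulr_gt0 ?powR_gt0.
have s20 : 0 < s2 by rewrite mulr_gt0 ?powR_gt0.
apply: le_trans (hC _ _ _ _ mX mY kb A M1 M2 s1 s2 finX finY bkb A0 M10 M20 s10 s20 E2 E1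
  HM2 HM1 HA f g bf bg) _.
rewrite le_eqVlt; apply/orP; left; apply/eqP; congr (_ * _).
rewrite -mulrA; congr (_ * _).
have qi : q^-1 = 1 - p^-1 by rewrite /q; field; rewrite !gt_eqF.
case: ifPn => [p2|]; last rewrite -leNgt => p2.
  have -> : Num.max p q = q.
    by apply: max_r; rewrite /q ler_pdivlMr// -[leRHS]mulr1 ler_wpM2l ?(ltW p0)// lerBlDr ltW.
  rewrite /M1 /s1 -!mulrA [X in _ * X]mulrA rD; congr (_ * (powR r _ * _)).
  by rewrite /scale_exp qi; ring.
have -> : Num.max p q = p.
  by apply: max_l; rewrite /q ler_pdivrMr// -[leLHS]mulr1 ler_wpM2l ?(ltW p0)// lerBrDr.
rewrite /M2 /s2 -!mulrA [X in _ * X]mulrA rD; congr (_ * (powR r _ * _)).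
by rewrite /scale_exp; ring.
Qed.

End cell_Lp.

(** * Partition of a cube into cells *)

Section cube_partition.
Context {R : realType}.

Lemma sum_itv_steps (c l t : R) m1 m2 : 0 <= l -> (m1 <= m2)%N ->
  \sum_(m1 <= a < m2) (c + a%:R * l <= t < c + a%:R * l + l)%R%:R =
  (c + m1%:R * l <= t < c + m2%:R * l)%R%:R :> R.
Proof.
move=> l0; elim: m2 => [|m2 IH].
  rewrite leqn0 => /eqP ->; rewrite big_geq//.
  by case: leP => //= h; rewrite ltNge h.
rewrite leq_eqVlt => /orP[/eqP ->|]; last rewrite ltnS => h.
  by rewrite big_geq//; case: leP => //= h; rewrite ltNge h.
rewrite big_nat_recr//= IH//.
have h1 : c + m1%:R * l <= c + m2%:R * l by rewrite lerD2l ler_wpM2r// ler_nat.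
have -> : c + m2.+1%:R * l = c + m2%:R * l + l by rewrite -natr1; ring.
have h2 : c + m2%:R * l <= c + m2%:R * l + l by rewrite lerDl.
case: (ltP t (c + m2%:R * l)) => h3 /=.
  by rewrite (lt_le_trans h3 h2) !andbT addr0.
by rewrite andbF add0r (le_trans h1 h3).
Qed.

Lemma cell_prod n (c : 'rV[R]_n) l x :
  (cell c l x)%:R = \prod_k (c ord0 k <= x ord0 k < c ord0 k + l)%R%:R :> R.
Proof.
transitivity ((\big[andb/true]_k (c ord0 k <= x ord0 k < c ord0 k + l))%:R : R).
  by rewrite big_andE.
by apply: (big_morph (fun b : bool => b%:R : R)) => // b b'; rewrite -natrM mulnb.
Qed.

Definition subcell n m (c l : R) (a : {ffun 'I_n -> 'I_m}) : 'rV[R]_n :=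
  \row_k (c + (a k)%:R * l).

(** The indicator of the cube is a product over coordinates of sums over m steps; distributing the
    product enumerates the subcells by functions [a]. *)
Lemma cube_sum n m (c l : R) (x : 'rV[R]_n) : 0 <= l ->
  (cell (const_mx c) (m%:R * l) x)%:R =
  \sum_(a : {ffun 'I_n -> 'I_m}) (cell (subcell c l a) l x)%:R :> R.
Proof.
move=> l0; rewrite cell_prod.
under eq_bigr => k _.
  rewrite mxE -[X in (X <= _ < _)]addr0 -[X in _ + X <= _](mul0r l) -[0](mulr0n 1).
  rewrite -(sum_itv_steps c (x ord0 k) l0 (leq0n m)) big_mkord.
  over.
rewrite bigA_distr_bigA; apply: eq_bigr => a _; rewrite cell_prod.
by apply: eq_bigr => k _; rewrite mxE.
Qed.

(** With steps of length r / (2 K), the interval from -r to r has 4 K steps, and the half from -r/2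
    to r/2 consists of those numbered K to 3 K - 1. *)
Definition mid K : pred 'I_(4 * K) := fun a => (K <= a < 3 * K)%N.

Lemma midcube_sum n K (c l : R) (x : 'rV[R]_n) : 0 <= l ->
  (cell (const_mx (c + K%:R * l)) ((2 * K)%:R * l) x)%:R =
  \sum_(a in @ffun_on_mem 'I_n _ (mem (@mid K))) (cell (subcell c l a) l x)%:R :> R.
Proof.
move=> l0; rewrite cell_prod.
have h1 : (K <= 3 * K)%N by rewrite leq_pmull.
have h2 : (3 * K <= 4 * K)%N by rewrite leq_mul2r orbT.
under eq_bigr => k _.
  rewrite mxE -addrA -mulrDl -natrD (_ : (K + 2 * K)%N = (3 * K)%N); last by rewrite -mulSn.
  rewrite -(sum_itv_steps c (x ord0 k) l0 h1).
  rewrite (big_nat_widenl _ 0)// (big_nat_widen _ _ (4 * K))// big_mkord.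
  over.
rewrite bigA_distr_big; apply: eq_big => [a|a _].
  by apply/ffun_onP/ffun_onP => h k; have := h k.
by rewrite cell_prod; apply: eq_bigr => k _; rewrite mxE.
Qed.

End cube_partition.

Section kernel_partition.
Context {R : realType} (n1 n2 : nat).
Local Notation nX := n1.+1.
Local Notation nY := n2.+1.
Variables (S : mpoly.mpoly (nX + nY) R) (phi : 'rV[R]_(nX + nY) -> R).

Definition cube_kern (g : R -> R) (lam r : R) :=
  cell_kern S phi g lam (const_mx (- r)) (const_mx (- r)) (2 * r).

Definition shell K : pred ({ffun 'I_nX -> 'I_(4 * K)} * {ffun 'I_nY -> 'I_(4 * K)}) :=
  fun a => ~~ ((a.1 \in ffun_on (mem (@mid K))) && (a.2 \in ffun_on (mem (@mid K)))).

Lemma cube_kern_split K (g : R -> R) (lam r : R) z : (0 < K)%N -> 0 <= r ->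
  cube_kern g lam r z = cube_kern g lam (r / 2) z +
    \sum_(a | @shell K a) cell_kern S phi g lam (subcell (- r) (r / (2 * K%:R)) a.1)
       (subcell (- r) (r / (2 * K%:R)) a.2) (r / (2 * K%:R)) z.
Proof.
move=> K0 r0; set l := r / (2 * K%:R); have KR : 0 < K%:R :> R by rewrite ltr0n.
have l0 : 0 <= l by rewrite divr_ge0// mulr_ge0// ltW.
rewrite /cube_kern /cell_kern -mulr_suml -mulrDl; congr (_ * _).
have e1 : 2 * r = (4 * K)%:R * l by rewrite /l natrM; field; rewrite gt_eqF.
have e2 : 2 * (r / 2) = (2 * K)%:R * l by rewrite /l natrM; field; rewrite gt_eqF.
have e3 : - (r / 2) = - r + K%:R * l by rewrite /l; field; rewrite gt_eqF.
rewrite e1 e2 e3 !(@cube_sum _ _ (4 * K)%N _ _ _ l0) !(midcube_sum _ _ _ l0).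
rewrite big_distrlr /= pair_bigA /= (bigID (fun a => ~~ @shell K a)) /=; congr (_ + _).
  rewrite big_distrlr /= pair_big /=; apply: eq_bigl => a.
  by rewrite /shell negbK.
by apply: eq_bigl => a; rewrite negbK.
Qed.

(** One coordinate index outside the middle range already keeps the whole closed cell at sup
    distance r / 2 from the origin. *)
Lemma shell_cell K (r : R) a : (0 < K)%N -> 0 <= r -> @shell K a ->
  let c := row_mx (subcell (- r) (r / (2 * K%:R)) a.1) (subcell (- r) (r / (2 * K%:R)) a.2) in
  (forall z, closed_cell c (r / (2 * K%:R)) z -> in_ball r z) /\
  (forall z, closed_cell c (r / (2 * K%:R)) z -> exists k, r / 2 <= `|z ord0 k|).
Proof.
move=> K0 r0 sa c; set l := r / (2 * K%:R); have KR : 0 < K%:R :> R by rewrite ltr0n.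
have l0 : 0 <= l by rewrite divr_ge0// mulr_ge0// ltW.
have rl : r = (2 * K)%:R * l by rewrite /l natrM; field; rewrite gt_eqF.
pose b (k : 'I_(nX + nY)) := match fintype.split k with inl i => a.1 i | inr j => a.2 j end.
have cE k : c ord0 k = - r + (b k)%:R * l.
  by rewrite /c mxE /b; case: (fintype.split k) => i; rewrite mxE.
split => z zc.
  move=> k; have := zc k; rewrite cE => /andP[h1 h2]; rewrite ler_norml.
  have h3 : 0 <= (b k)%:R * l by rewrite mulr_ge0.
  have h4 : ((b k)%:R + 1) * l <= (4 * K)%:R * l by rewrite ler_wpM2r// natr1 ler_nat ltn_ord.
  apply/andP; split; first by move: h1 h3; lra.
  apply: le_trans h2 _; move: h4; rewrite mulrDl mul1r {2}rl.
  by rewrite !natrM in rl *; move: rl; lra.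
have [k kb] : exists k, ~~ mid (b k).
  move: sa; rewrite /shell negb_and => /orP[] /ffun_onP h; apply: contrapT => /forallNP H; apply: h => i.
    by have := H (lshift nY i); rewrite /b (unsplitK (inl i)) => /negP; rewrite negbK.
  by have := H (rshift nX i); rewrite /b (unsplitK (inr i)) => /negP; rewrite negbK.
exists k; have := zc k; rewrite cE => /andP[h1 h2].
move: kb; rewrite /mid negb_and -!leqNgt -ltnNge => /orP[h|h].
  have h4 : ((b k)%:R + 1) * l <= K%:R * l by rewrite ler_wpM2r// natr1 ler_nat.
  rewrite -normrN ler_normr; apply/orP; left.
  by rewrite natrM in rl; move: rl h2 h4; lra.
have h4 : (3 * K)%:R * l <= (b k)%:R * l by rewrite ler_wpM2r// ler_nat.
rewrite ler_normr; apply/orP; left.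
by rewrite natrM in h4; rewrite natrM in rl; move: rl h1 h4; lra.
Qed.

End kernel_partition.

Section dyadic_sum.
Context {R : realType}.

(** The terms grow geometrically up to about 1 and then decay, so two geometric series bound the sum
    uniformly in w and n. *)
Lemma sum_min_geometric (w q : R) n : 0 < w -> 0 < q < 1 ->
  \sum_(j < n) Num.min (w * q ^+ j) (w * q ^+ j)^-1 <= 2 / (1 - q).
Proof.
move=> w0 /andP[q0 q1]; have d0 : 0 < 1 - q by rewrite subr_gt0.
(* A majorant of the sum started at w: the full geometric series when w <= 1; when w > 1 and w q > 1
   the second expression satisfies 1 / w + G (w q) = G w exactly. *)
pose G (w : R) := if w <= 1 then w / (1 - q) else 2 / (1 - q) - q / ((1 - q) * w).
have G0 (u : R) : 0 < u -> 0 <= G u.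
  move=> u0; rewrite /G; case: ifPn => [_|]; first by rewrite divr_ge0// ltW.
  rewrite -ltNge => u1; rewrite subr_ge0 invfM mulrA ler_pdivrMr// mulrAC ler_pM2r ?invr_gt0//.
  by move: q1 u1; lra.
have GS (u : R) : 0 < u -> Num.min u u^-1 + G (u * q) <= G u.
  move=> u0; rewrite /G; case: (leP u 1) => u1.
    have uq : u * q <= 1 by apply: le_trans u1; rewrite ler_piMr ?(ltW u0) ?(ltW q1).
    rewrite uq (_ : u / (1 - q) = u + u * q / (1 - q)); last by field; rewrite gt_eqF.
    by rewrite lerD2r ge_min lexx.
  apply: (@le_trans _ _ (u^-1 + (if u * q <= 1 then u * q / (1 - q) else
     2 / (1 - q) - q / ((1 - q) * (u * q))))); first by rewrite lerD2r ge_min lexx orbT.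
  case: ifPn => [h|_]; last first.
    rewrite le_eqVlt; apply/orP; left; apply/eqP; field.
    by rewrite !gt_eqF.
  rewrite -subr_ge0.
  rewrite (_ : _ - _ = (2 * u - 1 - u * (u * q)) / ((1 - q) * u)); last by field; rewrite !gt_eqF.
  apply: divr_ge0; last by rewrite mulr_ge0// ltW.
  have := ler_wpM2l (ltW u0) h; rewrite mulr1.
  by move: u1; lra.
have H : \sum_(j < n) Num.min (w * q ^+ j) (w * q ^+ j)^-1 <= G w.
  elim: n w w0 => [|n IH] u u0; first by rewrite big_ord0; exact: G0.
  rewrite big_ord_recl expr0 mulr1.
  under eq_bigr do rewrite /= /bump /= add1n exprS mulrA.
  by apply: le_trans (GS u u0); rewrite lerD2l; apply: IH; exact: mulr_gt0.
apply: (le_trans H); rewrite /G; case: ifPn => [w1|].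
  by rewrite ler_pM2r ?invr_gt0//; move: w1; lra.
rewrite -ltNge => w1; rewrite lerBlDr lerDl divr_ge0 ?(ltW q0)// mulr_ge0// ltW//.
Qed.

Lemma le_add_geometric (x y M : R) : 0 <= M -> (forall n, x <= y + M / 2 ^+ n) -> x <= y.
Proof.
move=> M0 H; apply/ler_addgt0Pr => e e0.
have [n hn] : exists n : nat, M / e < n%:R.
  by exists (Num.bound (M / e)); apply: archi_boundP; rewrite divr_ge0// ltW.
apply: le_trans (H n) _; rewrite lerD2l ler_pdivrMr ?exprn_gt0//.
rewrite ltr_pdivrMr// mulrC in hn; apply: le_trans (ltW hn) _; apply: ler_wpM2l; first exact: ltW.
by rewrite -natrX ler_nat ltnW// ltn_expl.
Qed.

End dyadic_sum.

(** * Summation over the shells *)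

Section bilinear_estimate.
Context {R : realType} (n1 n2 e : nat).
Local Notation nX := n1.+1.
Local Notation nY := n2.+1.
Variables (S : mpoly.mpoly (nX + nY) R) (phi : 'rV[R]_(nX + nY) -> R) (R0 : R).
Hypothesis homS : homogeneous_of_degree e.+3 S.
Hypothesis rk1 : rank_one_condition S.
Hypothesis cphi : continuous phi.
Hypothesis dphi : forall v a, derivable phi a v.
Hypothesis cdphi : forall v, continuous (fun a => derive phi a v).
Hypothesis R00 : 0 < R0.
Hypothesis bphi : bmf (fun z : @rVE R nX * @rVE R nY => phi (row_mx z.1 z.2)).
Local Notation mX := (vmu (bmu R0) nX).
Local Notation mY := (vmu (bmu R0) nY).
Let finX : (mX setT < +oo)%E := vmu_fin (bmu_fin R0) nX.
Let finY : (mY setT < +oo)%E := vmu_fin (bmu_fin R0) nY.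

Let bck b lam cX cY l : bmf (cell_kern S phi (trig b) lam cX cY l).
Proof. by apply: bmf_cell_kern => //; [exact: continuous_trig|exact: trig_max]. Qed.

Lemma bform_sum_kern (I : finType) (P : pred I) (k : I -> @rVE R nX * @rVE R nY -> R) f g :
  (forall i, bmf (k i)) -> bmf f -> bmf g ->
  bform mX mY (fun z => \sum_(i | P i) k i z) f g = \sum_(i | P i) bform mX mY (k i) f g.
Proof.
move=> bk bf bg; rewrite /bform -(bmf_Rint_sum finX); last first.
  by move=> i; apply: bmfM => //; exact: bmf_op.
apply: eq_Rintegral => x _; rewrite -mulr_sumr; congr (_ * _).
rewrite -(bmf_Rint_sum finY); last by move=> i; apply: bmfM => //; exact: bmf_pair1.
by apply: eq_Rintegral => y _; rewrite mulr_suml.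
Qed.

Lemma bform_add_kern (k1 k2 : @rVE R nX * @rVE R nY -> R) f g :
  bmf k1 -> bmf k2 -> bmf f -> bmf g ->
  bform mX mY (fun z => k1 z + k2 z) f g = bform mX mY k1 f g + bform mX mY k2 f g.
Proof.
move=> b1 b2 bf bg; rewrite /bform -(bmf_RintD finX); last 2 first.
- by apply: bmfM => //; exact: bmf_op.
- by apply: bmfM => //; exact: bmf_op.
apply: eq_Rintegral => x _; rewrite -mulrDr; congr (_ * _).
rewrite -(bmf_RintD finY); last 2 first.
- by apply: bmfM => //; exact: bmf_pair1.
- by apply: bmfM => //; exact: bmf_pair1.
by apply: eq_Rintegral => y _; rewrite mulrDl.
Qed.

(** Disposes of the core left after n halvings. M depends on f, g and lam, which is harmless: they
    are fixed while n tends to infinity. *)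
Lemma bform_cube_small b lam f g : bmf f -> bmf g ->
  exists2 M, 0 <= M & forall r, 0 <= r <= R0 ->
    `|bform mX mY (cube_kern S phi (trig b) lam r) f g| <= M * r.
Proof.
move=> bf bg.
have [P P0 hP] := bmf_bound bphi; have [F F0 hF] := bmf_bound bf; have [G G0 hG] := bmf_bound bg.
pose V := \int[mY]_y (P * F).
have V0 : 0 <= V by apply: Rintegral_ge0 => y _; exact: mulr_ge0.
exists (G * V * (2 * (2 * R0) ^+ n1)).
  by rewrite !mulr_ge0// exprn_ge0// mulr_ge0// ltW.
move=> r /andP[r0 rR0]; pose c : 'rV[R]_nX := const_mx (- r).
have bop : bmf (fun x => \int[mY]_y (cube_kern S phi (trig b) lam r (x, y) * f y)).
  by apply: bmf_op => //; exact: bck.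
apply: le_trans (bmf_Rint_norm finX _) _; first exact: bmfM.
apply: (@le_trans _ _ (\int[mX]_x ((G * V) * (cell c (2 * r) x)%:R))).
  apply: (bmf_le_Rint finX).
  - by apply: bmf_norm; apply: bmfM.
  - by apply: bmfZ; exact: bmf_cell.
  move=> x; rewrite normrM -mulrA; apply: ler_pM => //.
  have bx : bmf (fun y => cube_kern S phi (trig b) lam r (x, y) * f y).
    by apply: bmfM => //; apply: bmf_pair1; exact: bck.
  apply: le_trans (bmf_Rint_norm finY bx) _.
  rewrite -(bmf_RintZr finY); last exact: bmf_cst.
  apply: (bmf_le_Rint finY); [exact: bmf_norm|by apply: bmfM; exact: bmf_cst|].
  move=> y; rewrite /cube_kern /cell_kern /kern /= !normrM !normr_nat -/c -!mulrA.
  rewrite (_ : P * (F * _) = (cell c (2 * r) x)%:R * (1 * (P * (1 * F)))); last by ring.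
  apply: ler_wpM2l => //; apply: ler_pM; rewrite ?mulr_ge0//.
    by rewrite -[leRHS]/(1%:R) ler_nat leq_b1.
  apply: ler_pM; rewrite ?mulr_ge0//; first exact: (hP (x, y)).
  by apply: ler_pM; rewrite ?trig_max.
rewrite (bmf_RintZl finX); last exact: bmf_cell.
rewrite -[leRHS]mulrA; apply: ler_wpM2l; first exact: mulr_ge0.
apply: le_trans (Rintegral_cell_le _ _ _) _; first by rewrite mulr_ge0.
rewrite exprS (_ : 2 * _ * r = 2 * r * (2 * R0) ^+ n1); last by ring.
apply: ler_wpM2l; first by rewrite mulr_ge0.
by rewrite lerXn2r ?nnegrE ?mulr_ge0// ?(ltW R00)// ler_wpM2l.
Qed.

(** Lowering both exponents to the common value s makes the bound symmetric under mu -> 1 / mu, the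
    form summed by [sum_min_geometric]. *)
Lemma powR_min_decay (mu u v s : R) : 0 < mu -> 0 <= s -> s <= u -> s <= v ->
  Num.min (powR mu u) (powR mu (- v)) <= Num.min (powR mu s) (powR mu s)^-1.
Proof.
move=> mu0 s0 su sv; rewrite -powRN.
have [mu1|mu1] := leP mu 1.
  rewrite [leRHS]min_l; last by apply: ger_powR; [rewrite mu0|move: s0; lra].
  by rewrite ge_min; apply/orP; left; apply: ger_powR; rewrite ?mu0.
rewrite [leRHS]min_r; last by apply: ler_powR; [exact: ltW|move: s0; lra].
by rewrite ge_min; apply/orP; right; apply: ler_powR; rewrite ?lerN2// ltW.
Qed.

Lemma bilinear_bound (p : R) : 1 < p ->
  scale_exp n1 n2 p * Num.max p (p / (p - 1)) < e.+3%:R ->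
  exists2 C : R, 0 < C & forall b (lam : R) (f : @rVE R nY -> R) (g : @rVE R nX -> R), lam != 0 -> bmf f -> bmf g ->
    `|bform mX mY (cube_kern S phi (trig b) lam R0) f g| <=
    C * powR `|lam| (- (scale_exp n1 n2 p / e.+3%:R)) *
      (\int[mY]_y powR `|f y| p + \int[mX]_x powR `|g x| (p / (p - 1))).
Proof.
move=> p1; set q := p / (p - 1); set m := Num.max p q; set a := scale_exp n1 n2 p => am.
have [K K0 hK] := cell_Lp homS rk1 cphi dphi cdphi R00 bphi.
have p0 : 0 < p by apply: lt_trans p1.
have m0 : 0 < m by rewrite lt_max p0.
have a0 : 0 < a.
  by rewrite /a /scale_exp ltr_pwDl// ?divr_gt0// mulr_ge0// subr_ge0 invf_le1// ltW.
pose D : R := e.+3%:R; have D0 : 0 < D by rewrite ltr0n.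
(* The hypothesis says x < 1, and k is the midpoint of x and 1; k > x yields decay for large |lam|
   r^d, k < 1 keeps the cell estimate available. *)
pose x := a * m / D; pose k := (1 + x) / 2.
have amD : 0 <= x < 1.
  by rewrite /x divr_ge0 ?mulr_ge0 ?(ltW a0) ?(ltW m0) ?(ltW D0)//= ltr_pdivrMr// mul1r.
have k01 : 0 <= k < 1 by rewrite /k; move: (x) amD => y /andP[? ?]; apply/andP; split; lra.
have [G1 G10 hG1] := hK p k p1 k01.
(* With k = 0 the cell estimate is the trivial bound, used where |lam| r^d is small. *)
have zero01 : 0 <= (0 : R) < 1 by rewrite lexx ltr01.
have [G2 G20 hG2] := hK p 0 p1 zero01.
pose G := Num.max G1 G2.
have G0 : 0 < G by rewrite lt_max G10.
(* In terms of mu = |lam| r^D, and after the common factor |lam|^(-u), the trivial bound is mu^u and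
   the oscillatory one is mu^(-v). *)
pose u := a / D; pose v := k / m - u.
have u0 : 0 < u by rewrite divr_gt0.
have v0 : 0 < v.
  rewrite /v /u subr_gt0 ltr_pdivlMr// [a / D * m]mulrAC /k; rewrite -/x; move: (x) amD => y /andP[? ?]; lra.
pose s := Num.min u v; have s0 : 0 < s by rewrite lt_min u0.
pose Nc : R := #|{: {ffun 'I_nX -> 'I_(4 * K)} * {ffun 'I_nY -> 'I_(4 * K)}}|%:R.
(* Halving r divides |lam| r^D by 2^D, hence multiplies its s-th power by [qq]. *)
pose qq : R := powR 2 (- (D * s)).
have qq01 : 0 < qq < 1.
  rewrite powR_gt0//= /qq powRN invf_lt1 ?powR_gt0//.
  have Ds : 0 < D * s by exact: mulr_gt0.
  by have := gt0_ltr_powR Ds; move/(_ 1 2); rewrite powR1; apply; rewrite ?nnegrE// ltr1n.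
have Nc1 : 0 < Nc + 1 by rewrite ltr_pwDr.
exists ((Nc + 1) * G * (2 / (1 - qq))).
  by rewrite !mulr_gt0// invr_gt0 subr_gt0; case/andP: qq01.
move=> b lam f g lam0 bf bg; set I := (\int[mY]__ _ + _); set L := `|lam|.
have I0 : 0 <= I by apply: addr_ge0; apply: Rintegral_ge0 => ? _; exact: powR_ge0.
have L0 : 0 < L by rewrite normr_gt0.
pose B r := bform mX mY (cube_kern S phi (trig b) lam r) f g.
pose W r := powR (L * r ^+ e.+3) s.
pose T r := (Nc + 1) * (G * powR L (- u) * Num.min (W r) (W r)^-1 * I).
have cellT r cX cY : 0 < r <= R0 ->
    (forall z, closed_cell (row_mx cX cY) (r / (2 * K%:R)) z -> in_ball r z) ->
    (forall z, closed_cell (row_mx cX cY) (r / (2 * K%:R)) z -> exists k, r / 2 <= `|z ord0 k|) ->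
    `|bform mX mY (cell_kern S phi (trig b) lam cX cY (r / (2 * K%:R))) f g| <=
     G * powR L (- u) * Num.min (W r) (W r)^-1 * I.
  move=> rR h1 h2; have r0 : 0 < r by case/andP: rR.
  pose mu := L * r ^+ e.+3.
  have mu0 : 0 < mu by rewrite mulr_gt0// exprn_gt0.
  have Lne : L != 0 by rewrite gt_eqF.
  have mune : mu != 0 by rewrite gt_eqF.
  have ra : powR r a = powR L (- u) * powR mu u.
    rewrite powRM ?exprn_ge0 ?(ltW L0) ?(ltW r0)// mulrA -powRD ?Lne ?implybT// addNr powRr0 mul1r.
    by rewrite -powR_mulrn ?(ltW r0)// -powRrM /u mulrC divfK// gt_eqF.
  have := hG2 b lam r cX cY lam0 rR h1 h2 f g bf bg.
  have := hG1 b lam r cX cY lam0 rR h1 h2 f g bf bg.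
  rewrite -/L -/mu -/m -/a -/I ra mul0r oppr0 powRr0 mulr1.
  rewrite -[_ * _ * powR mu (- (k / m))]mulrA -powRD ?mune ?implybT//.
  rewrite (_ : u + - (k / m) = - v); last by rewrite /v opprB.
  move: (bform _ _ _ _ _) => Z hZ1 hZ2.
  apply: (@le_trans _ _ (G * powR L (- u) * Num.min (powR mu u) (powR mu (- v)) * I)); last first.
    apply: ler_wpM2r => //; apply: ler_wpM2l; first by rewrite mulr_ge0 ?powR_ge0 ?(ltW G0).
    by apply: powR_min_decay => //; rewrite ?(ltW s0)// /s ge_min lexx ?orbT.
  have GZ H (t : R) : H <= G -> 0 <= t -> `|Z| <= H * (powR L (- u) * t) * I ->
      `|Z| <= G * powR L (- u) * t * I.
    move=> HG t0 hZ; apply: (le_trans hZ); rewrite -[G * _ * _]mulrA.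
    by apply: ler_wpM2r => //; apply: ler_wpM2r => //; rewrite mulr_ge0 ?powR_ge0.
  case: (leP (powR mu u) _) => _.
    by apply: GZ hZ2; [rewrite le_max lexx orbT|exact: powR_ge0].
  by apply: GZ hZ1; [rewrite le_max lexx|exact: powR_ge0].
have shellT r : 0 < r <= R0 -> `|B r| <= T r + `|B (r / 2)|.
  move=> rR; have r0 : 0 < r by case/andP: rR.
  have -> : B r = B (r / 2) + \sum_(a | @shell n1 n2 K a)
     bform mX mY (cell_kern S phi (trig b) lam (subcell (- r) (r / (2 * K%:R)) a.1)
       (subcell (- r) (r / (2 * K%:R)) a.2) (r / (2 * K%:R))) f g.
    have b1 : bmf (cube_kern S phi (trig b) lam (r / 2)) by exact: bck.
    have b2 (a' : {ffun 'I_nX -> 'I_(4 * K)} * {ffun 'I_nY -> 'I_(4 * K)}) :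
      bmf (cell_kern S phi (trig b) lam (subcell (- r) (r / (2 * K%:R)) a'.1)
       (subcell (- r) (r / (2 * K%:R)) a'.2) (r / (2 * K%:R))) by exact: bck.
    rewrite -(bform_sum_kern _ b2 bf bg) -(bform_add_kern b1 (bmf_sum _ _ b2) bf bg).
    by congr (bform mX mY _ f g); apply/funext => z; rewrite (cube_kern_split _ _ _ _ _ K0)// ltW.
  apply: le_trans (ler_normD _ _) _; rewrite addrC lerD2r.
  apply: le_trans (ler_norm_sum _ _ _) _.
  have Tr0 : 0 <= G * powR L (- u) * Num.min (W r) (W r)^-1 * I.
    by rewrite !mulr_ge0 ?powR_ge0 ?(ltW G0)// le_min invr_ge0 powR_ge0.
  apply: (@le_trans _ _ (\sum_(a | @shell n1 n2 K a) G * powR L (- u) * Num.min (W r) (W r)^-1 * I)).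
    apply: ler_sum => a' /(shell_cell K0 (ltW r0))[h1 h2].
    exact: cellT.
  rewrite sumr_const -[X in X <= _]mulr_natl /T ler_wpM2r//.
  by apply: (@le_trans _ _ Nc); [rewrite ler_nat max_card|rewrite lerDl].
have tele n : `|B R0| <= \sum_(j < n) T (R0 / 2 ^+ j) + `|B (R0 / 2 ^+ n)|.
  elim: n => [|n IH]; first by rewrite big_ord0 expr0 divr1 add0r.
  apply: (le_trans IH); rewrite big_ord_recr /= -addrA lerD2l.
  rewrite exprSr invfM mulrA; apply: shellT.
  rewrite divr_gt0 ?exprn_gt0//= ler_pdivrMr ?exprn_gt0// ler_peMr ?(ltW R00)//.
  by rewrite exprn_ege1// ler1n.
have WE j : W (R0 / 2 ^+ j) = W R0 * qq ^+ j.
  rewrite /W expr_div_n mulrA -exprM powRM; last 2 first.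
  - by rewrite mulr_ge0 ?exprn_ge0// ltW.
  - by rewrite invr_ge0 exprn_ge0.
  congr (_ * _); rewrite -[2 ^+ _]powR_mulrn// -powRN -powRrM -powR_mulrn ?powR_ge0// -powRrM.
  by congr (powR _ _); rewrite natrM /D; ring.
have [M M0 hM] := bform_cube_small b lam bf bg.
apply: (@le_add_geometric _ _ _ (M * R0)) => [|n]; first by rewrite mulr_ge0// ltW.
apply: le_trans (tele n) _; apply: lerD; last first.
  rewrite -mulrA; apply: hM; rewrite divr_ge0 ?exprn_ge0 ?(ltW R00)//=.
  rewrite ler_pdivrMr ?exprn_gt0// ler_peMr ?(ltW R00)//.
  by rewrite exprn_ege1// ler1n.
rewrite /T -mulr_sumr -mulr_suml -mulr_sumr.
under eq_bigr do rewrite WE.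
have := @sum_min_geometric _ (W R0) qq n (powR_gt0 _ (mulr_gt0 L0 (exprn_gt0 _ R00))) qq01.
set Sg := \sum_(_ < _) _; set Q := 2 / (1 - qq) => SQ.
rewrite [leRHS](_ : _ = (Nc + 1) * (G * powR L (- u) * Q * I)); last by ring.
apply: ler_wpM2l; first exact: ltW.
apply: ler_wpM2r => //; apply: ler_wpM2l => //.
by rewrite mulr_ge0 ?powR_ge0// ltW.
Qed.

End bilinear_estimate.

(** * Duality and the upper bound *)

Section duality.
Context {R : realType} d1 d2 (X : measurableType d1) (Y : measurableType d2).
Variables (m1 : {sigma_finite_measure set X -> \bar R})
  (m2 : {sigma_finite_measure set Y -> \bar R}).
Hypotheses (fin1 : (m1 setT < +oo)%E) (fin2 : (m2 setT < +oo)%E).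
Variable k : X * Y -> R.
Hypothesis bk : bmf k.
Variables (p D : R).
Hypotheses (p1 : 1 < p) (D0 : 0 < D).
Local Notation q := (p / (p - 1)).
Hypothesis kD : forall f g, bmf f -> bmf g ->
  `|bform m1 m2 k f g| <= D * (\int[m2]_y powR `|f y| p + \int[m1]_x powR `|g x| q).

(** Dominated convergence: at each point the truncated tail vanishes once N exceeds |f|. *)
Lemma truncation_small (f : Y -> R) : m2.-integrable setT (EFin \o f) -> forall e : R, 0 < e ->
  exists N : nat, \int[m2]_y (`|f y| * (N%:R < `|f y|)%R%:R) < e.
Proof.
move=> fi e e0; have mf : measurable_fun setT f by apply/measurable_EFinP; exact: (measurable_int _ fi).
have fi' : m2.-integrable setT (EFin \o (fun y => `|f y|)).
  by have := integrable_norm fi.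
have mN (N : nat) : measurable_fun setT (fun y => `|f y| * (N%:R < `|f y|)%R%:R).
  apply: measurable_funM; first exact: measurableT_comp.
  by case: (bmf_lt (@measurable_cst _ _ Y _ setT (N%:R : R)) (measurableT_comp (@normr_measurable R setT) mf)).
have le (N : nat) y : `|(`|f y| * (N%:R < `|f y|)%R%:R)| <= `|f y|.
  by rewrite normrM normr_id normr_nat ler_piMr// -[leRHS]/(1%:R) ler_nat leq_b1.
have iN (N : nat) : m2.-integrable setT (EFin \o (fun y => `|f y| * (N%:R < `|f y|)%R%:R)).
  apply: (le_integrable measurableT _ _ fi'); first exact/measurable_EFinP.
  by move=> y _ /=; rewrite lee_fin normr_id.
have h : ((\int[m2]_y (`|f y| * (N%:R < `|f y|)%R%:R)%:E)%E @[N --> \oo] --> (\int[m2]_y 0%E)%E).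
  apply: (@dominated_cvg _ _ _ m2 setT measurableT _ (fun=> 0%E) (fun y => (`|f y|)%:E)) => //.
  - by move=> N; apply/measurable_EFinP.
  - move=> y _; apply: cvg_near_cst.
    exists (Num.bound `|f y|) => // n /= hn.
    rewrite ltNge (_ : (`|f y| <= n%:R) = true) ?mulr0//.
    apply: le_trans (ltW (archi_boundP (normr_ge0 _))) _; by rewrite ler_nat.
  - by move=> N y _; rewrite /= lee_fin.
rewrite integral0 in h.
have /fine_cvgP[_ /cvgrPdist_lt/(_ e e0)[N _ /(_ N (leqnn N))]] := h.
rewrite /= sub0r normrN => hN; exists N.
by apply: le_lt_trans (ler_norm _) hN.
Qed.

Variable f : Y -> R.
Hypothesis mf : measurable_fun setT f.
Hypothesis fp : m2.-integrable setT (EFin \o (fun y => powR `|f y| p)).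

Let p0 : 0 < p. Proof. exact: lt_trans p1. Qed.

Lemma Lp_integrable : m2.-integrable setT (EFin \o f).
Proof.
have i1 : m2.-integrable setT (EFin \o (fun _ : Y => 1)) by apply: bmf_integrable => //; exact: bmf_cst.
apply: (le_integrable measurableT _ _ (integrableD measurableT i1 fp)).
  exact/measurable_EFinP.
move=> y _ /=; rewrite lee_fin [leRHS]ger0_norm; last by rewrite addr_ge0// powR_ge0.
have [f1|f1] := leP `|f y| 1; first by rewrite (le_trans f1)// lerDl powR_ge0.
rewrite -[leLHS](powRr1 (normr_ge0 _)); apply: le_trans (ler_powR (ltW f1) (ltW p1)) _.
by rewrite lerDr.
Qed.

Definition Uop x := \int[m2]_y (k (x, y) * f y).

Let P := s2val (cid2 (bmf_bound bk)).
Let P0 : 0 <= P. Proof. by rewrite /P; case: cid2. Qed.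
Let kP z : `|k z| <= P. Proof. by rewrite /P; case: cid2. Qed.

Lemma integrable_kerM (h : Y -> R) x : m2.-integrable setT (EFin \o h) ->
  m2.-integrable setT (EFin \o (fun y => k (x, y) * h y)).
Proof.
move=> hi; apply: (le_integrable measurableT _ _ (integrableZl measurableT P hi)).
  apply/measurable_EFinP; apply: measurable_funM; first by case: (bmf_pair1 x bk).
  by apply/measurable_EFinP; exact: (measurable_int _ hi).
by move=> y _ /=; rewrite lee_fin !normrM ler_wpM2r// (ger0_norm P0).
Qed.

Let Unorm (h : Y -> R) x : m2.-integrable setT (EFin \o h) ->
  `|\int[m2]_y (k (x, y) * h y)| <= P * \int[m2]_y `|h y|.
Proof.
move=> hi; apply: le_trans (le_normr_Rintegral measurableT (integrable_kerM x hi)) _.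
have hi' : m2.-integrable setT (EFin \o (fun y => `|h y|)) by have := integrable_norm hi.
rewrite -RintegralZl//; apply: le_Rintegral => //.
- by have := integrable_norm (integrable_kerM x hi).
- by have := integrableZl measurableT P hi'.
by move=> y _; rewrite normrM ler_wpM2r.
Qed.

Lemma bmf_Uop : bmf Uop.
Proof.
split.
  apply: (@measurable_Rintegral _ _ _ _ _ m2 (fun z => k z * f z.2)).
  apply: measurable_funM; first by case: bk.
  exact: measurableT_comp.
by exists (P * \int[m2]_y `|f y|) => x; exact: (Unorm x Lp_integrable).
Qed.

(** The bound [kD] is known for bounded f only. Truncation does not increase the L^p integral, and
    the discarded part is small in L^1, hence pairs to something small since the kernel and g are
    bounded. *)
Lemma bform_Lp g : bmf g ->
  `|\int[m1]_x (g x * Uop x)| <= D * (\int[m2]_y powR `|f y| p + \int[m1]_x powR `|g x| q).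
Proof.
move=> bg; apply/ler_addgt0Pr => e e0.
have [G G0 hG] := bmf_bound bg.
pose V := \int[m1]_x (G * P); have V0 : 0 <= V by apply: Rintegral_ge0 => x _; exact: mulr_ge0.
have [N hN] : exists N : nat, \int[m2]_y (`|f y| * (N%:R < `|f y|)%R%:R) < e / (V + 1).
  by apply: truncation_small; [exact: Lp_integrable|rewrite divr_gt0// ltr_pwDr].
pose c y : R := (~~ (N%:R < `|f y|)%R)%:R; pose fN y := f y * c y.
have bfN : bmf fN.
  split.
    apply: measurable_funM => //.
    suff [] : bmf c by [].
    have h : bmf (fun y => 1 - (N%:R < `|f y|)%R%:R : R).
      apply: bmfB; first exact: bmf_cst.
      exact: (bmf_lt (@measurable_cst _ _ Y _ setT (N%:R : R)) (measurableT_comp (@normr_measurable R setT) mf)).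
    by rewrite (_ : c = (fun y => 1 - (N%:R < `|f y|)%R%:R))//; apply/funext => y; rewrite /c; case: (_ < _); rewrite ?b2R0 ?b2R1 ?subrr ?subr0.
  exists N%:R => y; rewrite /fN /c; case: ltP => h; last by rewrite mulr1.
  by rewrite mulr0 normr0.
have iN := bmf_integrable fin2 bfN.
have bUN : bmf (fun x => \int[m2]_y (k (x, y) * fN y)) by exact: bmf_op.
have le1 : \int[m2]_y powR `|fN y| p <= \int[m2]_y powR `|f y| p.
  apply: le_Rintegral => //; first by apply: (bmf_integrable fin2); apply: bmf_powR => //; exact: ltW.
  move=> y _; rewrite /fN /c; case: ltP => h; last by rewrite mulr1.
  by rewrite mulr0 normr0 powR0 ?gt_eqF// powR_ge0.
have UB x : `|Uop x - \int[m2]_y (k (x, y) * fN y)| <= P * (e / (V + 1)).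
  have fB : m2.-integrable setT (EFin \o (fun y => f y - fN y)).
    by have := integrableB measurableT Lp_integrable iN.
  rewrite /Uop -RintegralB//; [|exact: integrable_kerM Lp_integrable|exact: integrable_kerM].
  under eq_Rintegral do rewrite -mulrBr.
  apply: le_trans (Unorm x fB) _; apply: ler_wpM2l => //.
  apply: le_trans (ltW hN); rewrite le_eqVlt; apply/orP; left; apply/eqP.
  apply: eq_Rintegral => y _; rewrite /fN /c; case: (_ < _); rewrite ?b2R0 ?b2R1 ?mulr0 ?mulr1 ?subr0//.
  by rewrite subrr normr0.
have -> : \int[m1]_x (g x * Uop x) =
   bform m1 m2 k fN g + \int[m1]_x (g x * (Uop x - \int[m2]_y (k (x, y) * fN y))).
  rewrite /bform -(bmf_RintD fin1); last 2 first.
  - exact: bmfM.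
  - by apply: bmfM => //; apply: bmfB => //; exact: bmf_Uop.
  by apply: eq_Rintegral => x _; rewrite -mulrDr addrC subrK.
apply: le_trans (ler_normD _ _) _; apply: lerD.
  apply: le_trans (kD bfN bg) _; apply: ler_wpM2l; first exact: ltW.
  by rewrite lerD2r.
have bb : bmf (fun x => g x * (Uop x - \int[m2]_y (k (x, y) * fN y))).
  by apply: bmfM => //; apply: bmfB => //; exact: bmf_Uop.
apply: le_trans (bmf_Rint_norm fin1 bb) _.
apply: (@le_trans _ _ (\int[m1]_x (G * P * (e / (V + 1))))).
  apply: (bmf_le_Rint fin1); [exact: bmf_norm|exact: bmf_cst|].
  by move=> x; rewrite normrM -mulrA; apply: ler_pM.
rewrite (bmf_RintZr fin1); last exact: bmf_cst.
rewrite -/V mulrA ler_pdivrMr ?ltr_pwDr// mulrC ler_wpM2l ?(ltW e0)//.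
by rewrite lerDl.
Qed.

(** The additive bound is tested on a multiple of sgn(U) |U|^(p-1), the extremal function of
    duality; |g|^q is then a multiple of |U|^p. Absorbing that term is legitimate because U is
    bounded, so its integral is finite. *)
Lemma Uop_Lp : \int[m1]_x powR `|Uop x| p <= powR (2 * D) p * \int[m2]_y powR `|f y| p.
Proof.
have p10 : 0 < p - 1 by rewrite subr_gt0.
have bU := bmf_Uop.
(* With this s one has D s^(q-1) = 1/2, so the term of g is absorbed. *)
pose s := powR (2 * D) (- (p - 1)).
have D20 : 0 < 2 * D by exact: mulr_gt0.
have s0 : 0 < s by exact: powR_gt0.
pose g x := s * (Num.sg (Uop x) * powR `|Uop x| (p - 1)).
have msg : measurable_fun setT (fun x => Num.sg (Uop x)).
  have h : bmf (fun x => (0 < Uop x)%R%:R - (Uop x < 0)%R%:R : R).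
    by apply: bmfB; apply: bmf_lt => //; case: bU.
  rewrite (_ : (fun x => _) = (fun x => (0 < Uop x)%R%:R - (Uop x < 0)%R%:R)); first by case: h.
  by apply/funext => x; case: sgrP => _; rewrite ?b2R0 ?b2R1 ?subrr ?subr0 ?sub0r.
have bg : bmf g.
  apply: bmfZ; apply: bmfM; last by apply: bmf_powR => //; exact: ltW.
  by split => //; exists 1 => x; rewrite normr_sg; case: (_ != _); rewrite ?b2R0 ?b2R1.
have := bform_Lp bg.
set N := \int[m1]_x powR `|Uop x| p; set A := \int[m2]_y _.
have pw x : `|Uop x| * powR `|Uop x| (p - 1) = powR `|Uop x| p.
  rewrite -[X in X * _](powRr1 (normr_ge0 _)) -powRD; first by rewrite addrC subrK.
  by rewrite addrC subrK (gt_eqF p0).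
have N0 : 0 <= N by apply: Rintegral_ge0 => x _; exact: powR_ge0.
have bUp : bmf (fun x => powR `|Uop x| p) by apply: bmf_powR => //; exact: ltW.
have -> : \int[m1]_x (g x * Uop x) = s * N.
  rewrite -(bmf_RintZl fin1)//; apply: eq_Rintegral => x _.
  have sgU : Num.sg (Uop x) * Uop x = `|Uop x| by rewrite -normrEsg.
  by rewrite /g -pw -{2}sgU; ring.
have q0 : q != 0 by rewrite mulf_neq0// ?invr_eq0 gt_eqF.
have -> : \int[m1]_x powR `|g x| q = powR s q * N.
  rewrite -(bmf_RintZl fin1)//; apply: eq_Rintegral => x _.
  rewrite /g normrM (gtr0_norm s0) powRM ?(ltW s0)//; congr (_ * _).
  rewrite normrM normr_sg (ger0_norm (powR_ge0 _ _)).
  have [U0|U0] := eqVneq (Uop x) 0.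
    by rewrite b2R0 mul0r U0 normr0 !powR0// gt_eqF.
  by rewrite b2R1 mul1r -powRrM mulrC divfK// gt_eqF.
have sq : D * powR s q = s / 2.
  rewrite [in RHS]/s /s -powRrM (_ : - (p - 1) * q = - (p - 1) - 1); last by field; rewrite gt_eqF.
  rewrite powRD; last by rewrite (gt_eqF D20) implybT.
  by rewrite powRN powR_inv1 ?(ltW D20)//; field; rewrite gt_eqF ?powR_gt0//= gt_eqF.
rewrite mulrDr mulrA sq ger0_norm; last by rewrite mulr_ge0// ltW.
move=> h; have h2 : s * N <= 2 * D * A by rewrite -mulrA; move: h; lra.
rewrite -(@ler_pM2l _ s)//; apply: (le_trans h2).
rewrite mulrA /s -powRD; last by rewrite (gt_eqF D20) implybT.
by rewrite (_ : - (p - 1) + p = 1) ?powRr1 ?(ltW D20)//; ring.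
Qed.

End duality.

Section lebesgue_cube.
Context {R : realType} (rho : R).
Local Notation mu := (@lebesgue_measure R).
Local Open Scope ereal_scope.

Definition cube n (x : 'rV[R]_n) : bool := cell (const_mx (- rho)%R) (2 * rho)%R x.

Lemma cube_rVcons n t (v : 'rV[R]_n) :
  cube (rVcons t v) = (- rho <= t < rho)%R && cube v.
Proof.
rewrite /cube -rVins0 cell_rVins mxE (_ : - rho + 2 * rho = rho)%R; last by ring.
by congr (_ && cell _ _ _); apply/rowP => k; rewrite !mxE.
Qed.

(** The estimates use the restricted finite measure and the statement uses Lebesgue measure; the
    indicator of the cube is the density relating them. *)
Lemma ge0_integral_vmu_bmu n (F : @rVE R n -> \bar R) : measurable_fun setT F ->
  (forall x, 0 <= F x) ->
  \int[vmu (bmu rho) n]_x F x = \int[vmu mu n]_x (F x * ((cube x)%:R)%:E).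
Proof.
have mc m : measurable_fun setT (fun x : @rVE R m => ((cube x)%:R : R)%:E).
  by apply/measurable_EFinP; case: (bmf_cell (const_mx (- rho)%R : 'rV[R]_m) (2 * rho)%R).
have c0 m (x : @rVE R m) : 0 <= ((cube x)%:R : R)%:E by rewrite lee_fin.
elim: n F => [|n IH] F mF F0.
  apply: eq_integral => x _; rewrite (_ : cube x = true) ?b2R1 ?mule1//.
  by apply/forallP => -[].
have mFt t : measurable_fun setT (fun v : @rVE R n => F (rVcons t v)).
  by apply: (measurableT_comp mF); exact: measurable_rVcons.
have mFc : measurable_fun setT (fun x : @rVE R n.+1 => F x * ((cube x)%:R : R)%:E).
  exact: emeasurable_funM.
have Fc0 x : 0 <= F x * ((cube x)%:R : R)%:E by exact: mule_ge0.
rewrite (ge0_integral_vmuS (bmu rho) mF F0) (ge0_integral_vmuS mu mFc Fc0).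
under eq_integral do rewrite IH//.
rewrite ge0_integral_bmu; last 2 first.
- pose G (z : measurableTypeR R * @rVE R n) := F (rVcons2 z) * ((cube z.2)%:R : R)%:E.
  apply: (@measurable_fun_fubini_tonelli_F _ _ _ _ _ (vmu mu n) G).
    apply: emeasurable_funM; first exact: (measurableT_comp mF (@measurable_rVcons2 R n)).
    exact: (measurableT_comp (mc n) measurable_snd).
  by move=> z; exact: mule_ge0.
- by move=> x; apply: integral_ge0 => v _; exact: mule_ge0.
rewrite integral_mkcond; apply: eq_integral => t _; rewrite patchE.
have -> : (t \in (`[(- rho)%R, rho[%classic : set R)) = (- rho <= t < rho)%R.
  by apply/idP/idP; rewrite inE/= in_itv.
under [RHS]eq_integral do rewrite cube_rVcons.
case: (_ <= _ < _)%R => //=.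
by under eq_integral do rewrite b2R0 mule0; rewrite integral0.
Qed.

Lemma le_integral_vmu_bmu n (F : @rVE R n -> \bar R) : measurable_fun setT F ->
  (forall x, 0 <= F x) ->
  \int[vmu (bmu rho) n]_x F x <= \int[vmu mu n]_x F x.
Proof.
move=> mF F0; rewrite ge0_integral_vmu_bmu//; apply: ge0_le_integral => //.
- by move=> x _; rewrite mule_ge0// lee_fin.
- apply: emeasurable_funM => //.
  by apply/measurable_EFinP; case: (bmf_cell (const_mx (- rho)%R : 'rV[R]_n) (2 * rho)%R).
- by move=> x _; case: (cube x); rewrite ?b2R0 ?b2R1 ?mule1 ?mule0.
Qed.

Lemma ge0_integral_supp n (F : @rVE R n -> \bar R) : measurable_fun setT F ->
  (forall x, 0 <= F x) -> (forall x, ~~ cube x -> F x = 0) ->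
  \int[vmu (bmu rho) n]_x F x = \int[vmu mu n]_x F x.
Proof.
move=> mF F0 Fs; rewrite ge0_integral_vmu_bmu//; apply: eq_integral => x _.
by case: (boolP (cube x)) => [|/Fs ->]; rewrite ?b2R0 ?b2R1 ?mule1 ?mule0.
Qed.

Lemma integral_supp n (F : @rVE R n -> R) :
  (vmu (bmu rho) n).-integrable setT (EFin \o F) -> (forall x, ~~ cube x -> F x = 0%R) ->
  (vmu mu n).-integrable setT (EFin \o F) /\
  Rintegral (vmu mu n) setT F = Rintegral (vmu (bmu rho) n) setT F.
Proof.
move=> iF Fs; have mF := measurable_int _ iF; split.
  apply/integrableP; split => //; have /integrableP[_] := iF.
  rewrite ge0_integral_supp//; first exact: measurableT_comp.
  by move=> x /Fs /= ->; rewrite normr0.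
have s1 x : ~~ cube x -> (EFin \o F)^\+ x = 0.
  by move=> /Fs h; rewrite funeposE /= h maxxx.
have s2 x : ~~ cube x -> (EFin \o F)^\- x = 0.
  by move=> /Fs h; rewrite funenegE /= h oppr0 maxxx.
have E1 := ge0_integral_supp (measurable_funepos mF) (fun x => funepos_ge0 _ x) s1.
have E2 := ge0_integral_supp (measurable_funeneg mF) (fun x => funeneg_ge0 _ x) s2.
apply: (congr1 fine).
transitivity (\int[vmu mu n]_x (EFin \o F)^\+ x - \int[vmu mu n]_x (EFin \o F)^\- x).
  exact: integralE.
by rewrite -E1 -E2; symmetry; exact: integralE.
Qed.

End lebesgue_cube.

Section modulus.
Context {R : realType}.
Implicit Types a b : R.

Lemma cmod_ge0 a b : 0 <= cmod a b. Proof. exact: sqrtr_ge0. Qed.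

Lemma cmod_le a b : cmod a b <= `|a| + `|b|.
Proof.
rewrite -[leRHS]ger0_norm ?addr_ge0// -sqrtr_sqr ler_wsqrtr//.
rewrite sqrrD !real_normK ?num_real// -addrA [X in _ <= _ + X]addrC addrA lerDl.
by rewrite mulrn_wge0// mulr_ge0.
Qed.

Lemma ler_cmodl a b : `|a| <= cmod a b.
Proof. by rewrite -sqrtr_sqr ler_wsqrtr// lerDl sqr_ge0. Qed.

Lemma ler_cmodr a b : `|b| <= cmod a b.
Proof. by rewrite -sqrtr_sqr ler_wsqrtr// lerDr sqr_ge0. Qed.

Lemma measurable_cmod d (T : measurableType d) (f g : T -> R) :
  measurable_fun setT f -> measurable_fun setT g ->
  measurable_fun setT (fun x => cmod (f x) (g x)).
Proof.
move=> mf mg; apply: (measurableT_comp (continuous_measurable_fun (@sqrt_continuous R))).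
by apply: measurable_funD; apply: measurable_funX.
Qed.

Lemma powR_add_le (p a b : R) : 0 <= p -> 0 <= a -> 0 <= b ->
  powR (a + b) p <= powR 2 p * (powR a p + powR b p).
Proof.
move=> p0; wlog ab : a b / a <= b.
  move=> H a0 b0; have [ab|/ltW ba] := leP a b; first exact: H.
  by rewrite addrC [in leRHS]addrC; exact: H.
move=> a0 b0; apply: (@le_trans _ _ (powR (2 * b) p)).
  by apply: ge0_ler_powR; rewrite ?nnegrE ?addr_ge0 ?mulr_ge0//; move: ab; lra.
by rewrite powRM// ler_wpM2l ?powR_ge0// lerDr powR_ge0.
Qed.

End modulus.

(** * The upper bound for complex functions *)

Section upper_bound.
Context {R : realType} (n1 n2 e : nat).
Local Notation nX := n1.+1.
Local Notation nY := n2.+1.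
Variables (S : mpoly.mpoly (nX + nY) R) (phi : 'rV[R]_(nX + nY) -> R) (R0 : R).
Hypothesis homS : homogeneous_of_degree e.+3 S.
Hypothesis rk1 : rank_one_condition S.
Hypothesis cphi : continuous phi.
Hypothesis dphi : forall v a, derivable phi a v.
Hypothesis cdphi : forall v, continuous (fun a => derive phi a v).
Hypothesis R00 : 0 < R0.
Hypothesis bphi : bmf (fun z : @rVE R nX * @rVE R nY => phi (row_mx z.1 z.2)).
Hypothesis sphi : forall x y, ~~ (cube R0 x && cube R0 y) -> phi (row_mx x y) = 0.
Local Notation mu := (@lebesgue_measure R).
Local Notation mX := (vmu (bmu R0) nX).
Local Notation mY := (vmu (bmu R0) nY).
Let finX : (mX setT < +oo)%E := vmu_fin (bmu_fin R0) nX.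
Let finY : (mY setT < +oo)%E := vmu_fin (bmu_fin R0) nY.
Local Notation ck b lam := (cube_kern S phi (trig b) lam R0).

Lemma bmf_cube_kern b lam : bmf (ck b lam).
Proof. by apply: bmf_cell_kern => //; [exact: continuous_trig|exact: trig_max]. Qed.

Lemma cube_kernE b lam x y :
  ck b lam (x, y) = phi (row_mx x y) * trig b (lam * peval S (row_mx x y)).
Proof.
rewrite /cube_kern /cell_kern /= /kern /= -!/(cube R0 _) -natrM mulnb.
by case: (boolP (_ && _)) => [|/sphi ->]; rewrite ?b2R0 ?b2R1 ?mul1r ?mul0r.
Qed.

Lemma cube_kern_out b lam x y : ~~ (cube R0 x && cube R0 y) -> ck b lam (x, y) = 0.
Proof. by move=> h; rewrite cube_kernE (sphi h) mul0r. Qed.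

Local Notation U b lam f := (Uop mY (ck b lam) f).

(** The real and imaginary parts of T f differ by the choice of cosine or sine and by a sign s, so
    one identity serves both. As phi vanishes off the cube, the Lebesgue integral equals the one
    over the restricted measure. *)
Lemma riint_Uop b1 b2 lam s (f1 f2 : @rVE R nY -> R) x :
  mY.-integrable setT (EFin \o f1) -> mY.-integrable setT (EFin \o f2) ->
  riint nY (fun y => phi (row_mx x y) * (trig b1 (lam * peval S (row_mx x y)) * f1 y +
     s * (trig b2 (lam * peval S (row_mx x y)) * f2 y))) = U b1 lam f1 x + s * U b2 lam f2 x.
Proof.
move=> i1 i2.
have j1 := integrable_kerM (bmf_cube_kern b1 lam) x i1.
have j2 := integrable_kerM (bmf_cube_kern b2 lam) x i2.
have j2s := integrableZl measurableT s j2.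
pose F y := ck b1 lam (x, y) * f1 y + s * (ck b2 lam (x, y) * f2 y).
have -> : (fun y => phi (row_mx x y) * (trig b1 (lam * peval S (row_mx x y)) * f1 y +
     s * (trig b2 (lam * peval S (row_mx x y)) * f2 y))) = F.
  by apply/funext => y; rewrite /F !cube_kernE; ring.
have iF : mY.-integrable setT (EFin \o F) by have := integrableD measurableT j1 j2s.
have sF y : ~~ cube R0 y -> F y = 0.
  by move=> h; rewrite /F !cube_kern_out ?(negbTE h) ?andbF// !mul0r mulr0 addr0.
have [iF' E] := integral_supp iF sF.
transitivity (Rintegral mY setT F); first by apply: etrans E; exact: riintE.
transitivity (\int[mY]_y (ck b1 lam (x, y) * f1 y) + \int[mY]_y (s * (ck b2 lam (x, y) * f2 y))).
  exact: RintegralD.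
congr (_ + _); exact: RintegralZl.
Qed.

Lemma Tre_Uop lam (fr fi : @rVE R nY -> R) x :
  mY.-integrable setT (EFin \o fr) -> mY.-integrable setT (EFin \o fi) ->
  Tre lam S phi fr fi x = U true lam fr x - U false lam fi x.
Proof.
move=> i1 i2; rewrite -[X in _ - X]mul1r -mulNr -(riint_Uop _ _ _ _ _ i1 i2) /Tre.
by congr (riint nY _); apply/funext => y; rewrite mulN1r.
Qed.

Lemma Tim_Uop lam (fr fi : @rVE R nY -> R) x :
  mY.-integrable setT (EFin \o fr) -> mY.-integrable setT (EFin \o fi) ->
  Tim lam S phi fr fi x = U false lam fr x + U true lam fi x.
Proof.
move=> i1 i2; rewrite -[X in _ + X]mul1r -(riint_Uop _ _ _ _ _ i1 i2) /Tim.
by congr (riint nY _); apply/funext => y; rewrite mul1r.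
Qed.

Lemma Uop_out b lam f x : ~~ cube R0 x -> U b lam f x = 0.
Proof.
move=> h; rewrite /Uop; under eq_Rintegral do rewrite cube_kern_out ?(negbTE h)// mul0r.
by rewrite /Rintegral integral0.
Qed.

Lemma lint_bound (p : R) : 1 < p ->
  scale_exp n1 n2 p * Num.max p (p / (p - 1)) < e.+3%:R ->
  exists2 C : R, 0 < C & forall (lam : R) (fr fi : @rVE R nY -> R), lam != 0 ->
    measurable_fun setT fr -> measurable_fun setT fi ->
    (lint nY (fun y => (powR (cmod (fr y) (fi y)) p)%:E) < +oo)%E ->
    (lint nX (fun x => (powR (cmod (Tre lam S phi fr fi x) (Tim lam S phi fr fi x)) p)%:E) <=
    (powR (C * powR `|lam| (- (scale_exp n1 n2 p / e.+3%:R))) p)%:E *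
     lint nY (fun y => (powR (cmod (fr y) (fi y)) p)%:E))%E.
Proof.
move=> p1 hp; have [C0 C00 hC] := bilinear_bound homS rk1 cphi dphi cdphi R00 bphi p1 hp.
have p0 : 0 < p by apply: lt_trans p1.
(* Duality doubles [C0], two successive splittings under the p-th power cost 2 each, and the four
   resulting terms account for 4^(1/p). *)
exists (8 * powR 4 p^-1 * C0); first by rewrite !mulr_gt0// powR_gt0.
move=> lam fr fi lam0 mr mi; set A := lint nY _ => Aoo.
pose D := C0 * powR `|lam| (- (scale_exp n1 n2 p / e.+3%:R)).
have D0 : 0 < D by rewrite mulr_gt0// powR_gt0// normr_gt0.
have mc : measurable_fun setT (fun y => (powR (cmod (fr y) (fi y)) p)%:E).
  apply/measurable_EFinP; apply: (measurableT_comp (measurable_powR p)).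
  exact: measurable_cmod.
have A0 : A = (\int[vmu mu nY]_y (powR (cmod (fr y) (fi y)) p)%:E)%E.
  by apply: lintE => // y; rewrite lee_fin powR_ge0.
have hA (h : @rVE R nY -> R) : measurable_fun setT h -> (forall y, `|h y| <= cmod (fr y) (fi y)) ->
    mY.-integrable setT (EFin \o (fun y => powR `|h y| p)) /\
    ((\int[mY]_y powR `|h y| p)%:E <= A)%E.
  move=> mh hle.
  have mhp : measurable_fun setT (fun y => (powR `|h y| p)%:E).
    apply/measurable_EFinP; apply: (measurableT_comp (measurable_powR p)).
    exact: measurableT_comp.
  have le1 : (\int[mY]_y (powR `|h y| p)%:E <= A)%E.
    apply: (@le_trans _ _ (\int[mY]_y (powR (cmod (fr y) (fi y)) p)%:E)%E).
      apply: ge0_le_integral => //.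
      by move=> y _; rewrite lee_fin ge0_ler_powR ?nnegrE ?cmod_ge0// ltW.
    by rewrite A0; apply: le_integral_vmu_bmu => // y; rewrite lee_fin powR_ge0.
  have ih : mY.-integrable setT (EFin \o (fun y => powR `|h y| p)).
    apply/integrableP; split => //; apply: le_lt_trans Aoo; apply: le_trans le1.
    by under eq_integral do rewrite /= ger0_norm ?powR_ge0//.
  split => //; apply: le_trans le1; rewrite /Rintegral fineK//.
  exact: integrable_fin_num.
have [ir Ar] := hA fr mr (fun y => ler_cmodl _ _).
have [ii Ai] := hA fi mi (fun y => ler_cmodr _ _).
have jr := Lp_integrable finY p1 mr ir; have ji := Lp_integrable finY p1 mi ii.
have kD b f g (bf : bmf f) (bg : bmf g) := hC b lam f g lam0 bf bg.
have bU b (f : @rVE R nY -> R) (mf : measurable_fun setT f) i := bmf_Uop finY (bmf_cube_kern b lam) p1 mf i.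
pose V1 x := U true lam fr x - U false lam fi x.
pose V2 x := U false lam fr x + U true lam fi x.
pose Q x := powR 2 p * powR 2 p * (powR `|U true lam fr x| p + powR `|U false lam fi x| p +
   (powR `|U false lam fr x| p + powR `|U true lam fi x| p)).
have bV1 : bmf V1 by apply: bmfB; exact: bU.
have bV2 : bmf V2 by apply: bmfD; exact: bU.
have bp b (f : @rVE R nY -> R) : measurable_fun setT f -> mY.-integrable setT (EFin \o (fun y => powR `|f y| p)) ->
   bmf (fun x => powR `|U b lam f x| p).
  by move=> mf i; apply: bmf_powR; [exact: ltW|exact: bU].
have bQ : bmf Q by apply: bmfZ; apply: bmfD; apply: bmfD; exact: bp.
have VQ x : powR (cmod (V1 x) (V2 x)) p <= Q x.
  have p00 : 0 <= p := ltW p0.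
  have tri (a b c : R) : c <= `|a| + `|b| -> 0 <= c ->
      powR c p <= powR 2 p * (powR `|a| p + powR `|b| p).
    move=> h c0; apply: le_trans (powR_add_le p00 (normr_ge0 _) (normr_ge0 _)).
    by rewrite ge0_ler_powR ?nnegrE ?addr_ge0.
  apply: le_trans (tri _ _ _ (cmod_le _ _) (cmod_ge0 _ _)) _.
  rewrite /Q -mulrA; apply: ler_wpM2l; first exact: powR_ge0.
  rewrite mulrDr; apply: lerD; apply: tri => //.
    exact: ler_normB.
  exact: ler_normD.
have mV : measurable_fun setT (fun x => (powR (cmod (V1 x) (V2 x)) p)%:E).
  apply/measurable_EFinP; apply: (measurableT_comp (measurable_powR p)).
  by apply: measurable_cmod; [case: bV1|case: bV2].
rewrite (_ : (fun x => _) = (fun x => (powR (cmod (V1 x) (V2 x)) p)%:E)); last first.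
  by apply/funext => x; rewrite Tre_Uop// Tim_Uop.
rewrite lintE//; last by move=> x; rewrite lee_fin powR_ge0.
rewrite -(@ge0_integral_supp _ R0)//; last 2 first.
- by move=> x; rewrite lee_fin powR_ge0.
- move=> x h; rewrite /V1 /V2 !Uop_out// subr0 addr0 /cmod expr0n /= addr0 sqrtr0.
  by rewrite powR0// gt_eqF.
apply: (@le_trans _ _ (\int[mX]_x Q x)%:E).
  rewrite (bmf_EFin_Rint finX bQ); apply: ge0_le_integral => //.
  - by move=> x _; rewrite lee_fin powR_ge0.
  - by apply/measurable_EFinP; case: bQ.
  - by move=> x _; rewrite lee_fin.
have Afin : A \is a fin_num.
  by rewrite ge0_fin_numE// A0 integral_ge0// => y _; rewrite lee_fin powR_ge0.
have hU b (f : @rVE R nY -> R) : measurable_fun setT f ->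
    mY.-integrable setT (EFin \o (fun y => powR `|f y| p)) ->
    ((\int[mY]_y powR `|f y| p)%:E <= A)%E ->
    \int[mX]_x powR `|U b lam f x| p <= powR (2 * D) p * fine A.
  move=> mf i fA; apply: le_trans (Uop_Lp finX finY (bmf_cube_kern b lam) p1 D0 (kD b) mf i) _.
  by apply: ler_wpM2l; [exact: powR_ge0|rewrite -lee_fin (fineK Afin)].
have e1 := hU true fr mr ir Ar; have e2 := hU false fr mr ir Ar.
have e3 := hU true fi mi ii Ai; have e4 := hU false fi mi ii Ai.
have b1 := bp true fr mr ir; have b2 := bp false fi mi ii.
have b3 := bp false fr mr ir; have b4 := bp true fi mi ii.
rewrite -[A](fineK Afin) -EFinM lee_fin.
have -> : \int[mX]_x Q x = powR 2 p * powR 2 p *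
    (\int[mX]_x powR `|U true lam fr x| p + \int[mX]_x powR `|U false lam fi x| p +
    (\int[mX]_x powR `|U false lam fr x| p + \int[mX]_x powR `|U true lam fi x| p)).
  apply: etrans (bmf_RintZl finX _ (bmfD (bmfD b1 b2) (bmfD b3 b4))) _; congr (_ * _).
  apply: etrans (bmf_RintD finX (bmfD b1 b2) (bmfD b3 b4)) _.
  by congr (_ + _); exact: bmf_RintD.
have -> : powR (8 * powR 4 p^-1 * C0 * powR `|lam| (- (scale_exp n1 n2 p / e.+3%:R))) p =
   powR 2 p * powR 2 p * (4 * powR (2 * D) p).
  rewrite -mulrA -/D (_ : 8 * _ * D = 2 * (2 * (powR 4 p^-1 * (2 * D)))); last by ring.
  have D2 : 0 <= 2 * D by rewrite mulr_ge0// ltW.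
  have D4 : 0 <= powR 4 p^-1 * (2 * D) by rewrite mulr_ge0 ?powR_ge0.
  have D8 : 0 <= 2 * (powR 4 p^-1 * (2 * D)) by rewrite mulr_ge0.
  rewrite (powRM _ _ D8)// (powRM _ _ D4)// (powRM _ (powR_ge0 _ _) D2).
  by rewrite -powRrM mulVf ?gt_eqF// powRr1// mulrA.
rewrite -[leRHS]mulrA; apply: ler_wpM2l; first by rewrite mulr_ge0 ?powR_ge0.
rewrite (_ : 4 * powR (2 * D) p * fine A = powR (2 * D) p * fine A + powR (2 * D) p * fine A +
  (powR (2 * D) p * fine A + powR (2 * D) p * fine A)); last by ring.
exact: (lerD (lerD e1 e4) (lerD e2 e3)).
Qed.

End upper_bound.

(** * The lower bound *)

Section support.
Context {R : realType}.

Lemma ler_coord_norm n (z : 'rV[R]_n) k : `|z ord0 k| <= `|z|.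
Proof. by rewrite [leRHS]/Num.norm /= mx_normrE; exact: (le_bigmax _ (fun i => `|z i.1 i.2|) (ord0, k)). Qed.

Lemma compact_support_cube n (phi : 'rV[R]_n -> R) : compact_support phi ->
  exists2 R0 : R, 0 < R0 & forall (z : 'rV[R]_n) k, R0 <= `|z ord0 k| -> phi z = 0.
Proof.
move=> /compact_bounded[M [Mr hM]]; exists (`|M| + 2); first by rewrite ltr_wpDl.
move=> z k zk; apply: contrapT => /eqP pz.
have := hM (`|M| + 1) _ z (@subset_closure _ [set z | phi z != 0] z pz); rewrite /= => h.
have {h} := h (le_lt_trans (ler_norm M) (ltr_pwDr ltr01 (lexx _))).
move=> /(le_trans (ler_coord_norm z k)) /(le_trans zk).
by rewrite lerD2l; lra.
Qed.

Lemma cube_row_mx rho n1 n2 (x : 'rV[R]_n1) (y : 'rV[R]_n2) :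
  ~~ (cube rho x && cube rho y) -> exists k, rho <= `|row_mx x y ord0 k|.
Proof.
have cE n (w : 'rV[R]_n) : ~~ cube rho w -> exists k, rho <= `|w ord0 k|.
  rewrite negb_forall => /existsP[k]; rewrite mxE => hk; exists k.
  rewrite leNgt; apply: contra hk; rewrite ltr_norml => /andP[h1 h2].
  by rewrite (ltW h1)/=; move: h2; lra.
rewrite negb_and => /orP[] /cE[k hk].
  by exists (lshift n2 k); rewrite row_mxEl.
by exists (rshift n1 k); rewrite row_mxEr.
Qed.

Lemma in_ball_cube rho n1 n2 (x : 'rV[R]_n1) (y : 'rV[R]_n2) :
  cube rho x -> cube rho y -> in_ball rho (row_mx x y).
Proof.
have cE n (w : 'rV[R]_n) k : cube rho w -> `|w ord0 k| <= rho.
  move=> /forallP/(_ k); rewrite mxE => /andP[h1 h2]; rewrite ler_norml h1/=.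
  by move: h2; lra.
by move=> hx hy k; case: (split_ordP k) => i ->; rewrite ?row_mxEl ?row_mxEr; exact: cE.
Qed.

Lemma bmf_compact_support n1 n2 (phi : 'rV[R]_(n1 + n2) -> R) :
  continuous phi -> compact_support phi ->
  bmf (fun z : @rVE R n1 * @rVE R n2 => phi (row_mx z.1 z.2)).
Proof.
move=> cphi sphi; split.
  exact: (measurableT_comp (continuous_measurable_rV cphi) (@measurable_row_mx _ n1 n2)).
have [R0 R00 hR0] := compact_support_cube sphi.
have [B B0 hB] := continuous_ball_bound R0 cphi.
exists B => -[x y] /=; have [h|/cube_row_mx[k /hR0 ->]] := boolP (cube R0 x && cube R0 y).
  by case/andP: h => hx hy; apply: hB; exact: in_ball_cube.
by rewrite normr0 ltW.
Qed.

Lemma near_in_ball n (P : 'rV[R]_n -> Prop) : (\forall z \near (0 : 'rV[R]_n), P z) ->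
  exists2 e : R, 0 < e & forall z, in_ball e z -> P z.
Proof.
move=> /nbhs_ballP[e /= e0 eP]; exists (e / 2); first by rewrite divr_gt0.
move=> z hz; apply: eP; split => // i j; rewrite ord1 /ball/= mxE sub0r normrN.
by apply: le_lt_trans (hz j) _; rewrite ltr_pdivrMr// ltr_pMr// ltr1n.
Qed.

Lemma Rintegral_cube (rho : R) n : 0 < rho ->
  \int[vmu (bmu rho) n]_x (cube rho x)%:R = (2 * rho) ^+ n :> R.
Proof.
move=> r0; elim: n => [|n IH].
  have bc := bmf_cell (const_mx (- rho) : 'rV[R]_0) (2 * rho).
  rewrite /Rintegral integral_dirac ?diracT ?mul1e/= ?expr0//; last first.
    by apply/measurable_EFinP; case: bc.
  by rewrite (_ : cube rho _ = true) ?b2R1//; apply/forallP => -[].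
rewrite (bmf_Rint_rVins (bmu_fin rho) ord0); last exact: bmf_cell.
under eq_Rintegral do under eq_Rintegral do rewrite rVins0 cube_rVcons -mulnb natrM.
have bi : bmf (fun t : measurableTypeR R => (- rho <= t < rho)%R%:R : R).
  have := bmf_itv (- rho) (2 * rho).
  by rewrite (_ : - rho + 2 * rho = rho)//; ring.
under eq_Rintegral do rewrite (bmf_RintZr (bmu_fin rho) _ bi).
rewrite (bmf_RintZl (vmu_fin (bmu_fin rho) n)); last exact: bmf_cell.
rewrite IH exprS; congr (_ * _).
have e2 : rho = - rho + 2 * rho by ring.
transitivity (\int[bmu rho]_t ((- rho <= t < - rho + 2 * rho)%R%:R * (1 : R))).
  by rewrite -e2; apply: eq_Rintegral => t _; rewrite mulr1.
rewrite Rintegral_bmu_indic// ?mulr_gt0 -?e2//.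
have hm : @lebesgue_measure R `[(- rho), rho]%classic = (2 * rho)%:E.
  rewrite lebesgue_measure_itv /= lte_fin gtrN// -EFinB opprK.
  by congr EFin; ring.
rewrite Rintegral_cst// mul1r; exact: (congr1 fine hm).
Qed.

End support.

Lemma powR_homogeneity (R : realType) (c t p a u v : R) : 0 < c -> 0 < t -> a * p + u = u * p + v ->
  powR (c * powR t a) p * powR t u = powR (c * powR t u) p * powR t v.
Proof.
move=> c0 t0 e; have tD x y : powR t x * powR t y = powR t (x + y).
  by rewrite powRD// (gt_eqF t0) implybT.
by rewrite !powRM ?powR_ge0 ?(ltW c0)// -!powRrM -!mulrA !tD e.
Qed.

Section lower_bound.
Context {R : realType} (nX nY d : nat).
Variables (S : mpoly.mpoly (nX + nY) R) (phi : 'rV[R]_(nX + nY) -> R) (p : R).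
Hypothesis homS : homogeneous_of_degree d S.
Hypothesis d0 : (0 < d)%N.
Hypothesis p0 : 0 < p.
Hypothesis cphi : continuous phi.
Hypothesis sphi : compact_support phi.
Hypothesis phi0 : \forall z \near (0 : 'rV[R]_(nX + nY)), phi z != 0.
Local Notation mu := (@lebesgue_measure R).

(** Near 0 continuity keeps phi close to phi 0, whose sign is [sg], and while |lam| r^d is small the
    phase stays where the cosine is at least 1/2; the kernel then cannot cancel. *)
Lemma kernel_lower_bound : exists c sg del : R, [/\ 0 < c, `|sg| = 1, 0 < del &
  forall (lam r : R) z, 0 < r <= del -> `|lam| * r ^+ d <= del ^+ d -> in_ball r z ->
    c <= sg * (phi z * cos (lam * peval S z))].
Proof.
have [C C0 hC] := peval_homogeneous_bound homS.
pose sg : R := Num.sg (phi 0); pose c : R := `|phi 0| / 2.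
have p00 : phi 0 != 0 by exact: (nbhs_singleton phi0).
have c0 : 0 < c by rewrite divr_gt0// normr_gt0.
have [e1 e10 h1] : exists2 e : R, 0 < e & forall z, in_ball e z -> `|phi 0 - phi z| < c.
  by apply: near_in_ball; have /cvgrPdist_lt/(_ c c0) := @cphi 0.
have [e2 e20 h2] : exists2 e : R, 0 < e & forall t, `|t| < e -> 2^-1 <= cos t :> R.
  have /cvgrPdist_lt/(_ 2^-1) := @continuous_cos R 0; rewrite cos0 => /(_ _)[|e /= e0 he].
    by rewrite invr_gt0.
  exists e => // t te; have := he t; rewrite /= sub0r normrN => /(_ te).
  by rewrite ltr_norml => /andP[_]; lra.
have sg1 : `|sg| = 1 by rewrite normr_sg p00.
(* The bound 1 makes del^d <= del, [e1] controls phi, and the last term keeps the phase, at most C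
   del, below [e2]. *)
pose del : R := Num.min 1 (Num.min e1 (e2 / (C + 1))).
have C1 : 0 < C + 1 by rewrite ltr_wpDl.
have del0 : 0 < del by rewrite !lt_min ltr01 e10 divr_gt0.
exists (c / 2), sg, del; split => //; first exact: divr_gt0.
move=> lam r z /andP[r0 rd] lr zr.
have dle1 : del <= 1 by rewrite ge_min lexx.
have dle2 : del <= e1 by rewrite !ge_min lexx orbT.
have dle3 : del <= e2 / (C + 1) by rewrite !ge_min lexx !orbT.
have hp : c <= sg * phi z.
  have z1 : in_ball e1 z by move=> k; exact: le_trans (zr k) (le_trans rd dle2).
  have e : `|phi 0| = sg * phi 0 by rewrite normrEsg.
  have : sg * (phi 0 - phi z) <= c.
    apply: le_trans (ler_norm _) _; rewrite normrM sg1 mul1r; exact: ltW (h1 _ z1).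
  by rewrite mulrBr -e /c; lra.
have hcos : 2^-1 <= cos (lam * peval S z).
  apply: h2; rewrite normrM.
  apply: (@le_lt_trans _ _ (C * del)).
    apply: (@le_trans _ _ (C * (`|lam| * r ^+ d))).
      by rewrite mulrCA; apply: ler_wpM2l => //; exact: hC.
    apply: ler_wpM2l => //; apply: (le_trans lr).
    by rewrite -[leRHS]expr1; apply: ler_wiXn2l => //; rewrite ltW.
  apply: (@lt_le_trans _ _ ((C + 1) * del)).
    by rewrite ltr_pM2r// ltrDl.
  by rewrite mulrC -ler_pdivlMr.
rewrite mulrA; apply: ler_pM => //; first exact: ltW.
Qed.

Local Notation gam := (gamma_exp nX nY d p).

(** For f the indicator of the cube of half-side r, |T f| is at least c (2 r)^nY on a cube of volume
    (2 r)^nX, so the ratio of the p-norms is at least c (2 r)^a with a = nX / p + nY / p'. *)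
Lemma lint_lower_bound : exists2 c : R, 0 < c & forall lam : R, 1 <= `|lam| ->
  exists (f : @rVE R nY -> R) (V : R), [/\ measurable_fun setT f, 0 < V,
    lint nY (fun y => (powR (cmod (f y) 0) p)%:E) = V%:E &
    ((powR (c * powR `|lam| (- gam)) p * V)%:E <=
     lint nX (fun x => (powR (cmod (Tre lam S phi f (fun=> 0%R) x)
       (Tim lam S phi f (fun=> 0%R) x)) p)%:E))%E].
Proof.
have [c [sg [del [c0 sg1 del0 hk]]]] := kernel_lower_bound.
pose a : R := gam * d%:R.
exists (c * powR (2 * del) a); first by rewrite mulr_gt0// powR_gt0// mulr_gt0.
move=> lam lam1; pose L := `|lam|; have L0 : 0 < L by apply: lt_le_trans lam1.
have dR : d%:R != 0 :> R by rewrite pnatr_eq0 -lt0n.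
(* The largest r allowed by |lam| r^d <= del^d; |lam| >= 1 ensures r <= del, and (2 r)^a is then
   proportional to |lam|^(-a/d). *)
pose r := del * powR L (- d%:R^-1).
have r0 : 0 < r by rewrite mulr_gt0// powR_gt0.
have rdel : r <= del.
  rewrite /r ler_piMr ?(ltW del0)// powRN invf_le1 ?powR_gt0//.
  by rewrite -[leLHS](powRr0 L); apply: ler_powR => //; rewrite invr_ge0.
have lamr : L * r ^+ d <= del ^+ d.
  rewrite /r exprMn -[powR L _ ^+ d]powR_mulrn ?powR_ge0// -powRrM mulNr mulVf// powR_inv1 ?(ltW L0)//.
  by rewrite mulrCA mulfV ?gt_eqF// mulr1.
have r20 : 0 < 2 * r by rewrite mulr_gt0.
pose f (y : @rVE R nY) : R := (cube r y)%:R.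
have bcube n : bmf (fun x : @rVE R n => (cube r x)%:R : R) by exact: bmf_cell.
have lintc n : (\int[vmu mu n]_x ((cube r x)%:R)%:E = ((2 * r) ^+ n)%:E)%E.
  rewrite -(@ge0_integral_supp _ r)//.
  - by rewrite -(bmf_EFin_Rint (vmu_fin (bmu_fin r) n) (bcube n)) Rintegral_cube.
  - by apply/measurable_EFinP; case: (bcube n).
  - by move=> x /negbTE ->.
exists f, ((2 * r) ^+ nY); split.
- by case: (bcube nY).
- exact: exprn_gt0.
- rewrite -lintc lintE.
  + apply: eq_integral => y _; congr EFin; rewrite /f /cmod [0 ^+ 2]expr0n /= addr0 sqrtr_sqr normr_nat.
    by case: (cube r y); rewrite ?powR1// powR0// gt_eqF.
  + apply/measurable_EFinP; apply: (measurableT_comp (measurable_powR p)).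
    by apply: measurable_cmod => //; case: (bcube nY).
  + by move=> y; rewrite lee_fin powR_ge0.
have mS : measurable_fun setT (fun z : @rVE R nX * @rVE R nY => lam * peval S (row_mx z.1 z.2)).
  apply: measurable_funM => //.
  have mp : measurable_fun setT (peval S : @rVE R (nX + nY) -> R).
    by apply: continuous_measurable_rV; exact: continuous_peval.
  exact: (measurableT_comp mp (@measurable_row_mx _ nX nY)).
have bphi := bmf_compact_support cphi sphi.
have btrig b : bmf (fun z : @rVE R nX * @rVE R nY => trig b (lam * peval S (row_mx z.1 z.2))).
  split; last by exists 1 => z; exact: trig_max.
  exact: (measurableT_comp (continuous_measurable_fun (@continuous_trig _ b)) mS).
have bf : bmf f by exact: bcube.
have bf2 : bmf (fun z : @rVE R nX * @rVE R nY => f z.2) by exact: bmf_snd.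
pose F1 (z : @rVE R nX * @rVE R nY) := phi (row_mx z.1 z.2) *
    (cos (lam * peval S (row_mx z.1 z.2)) * f z.2 - sin (lam * peval S (row_mx z.1 z.2)) * 0).
pose F2 (z : @rVE R nX * @rVE R nY) := phi (row_mx z.1 z.2) *
    (sin (lam * peval S (row_mx z.1 z.2)) * f z.2 + cos (lam * peval S (row_mx z.1 z.2)) * 0).
have bF1 : bmf F1.
  apply: bmfM => //; apply: bmfB; apply: bmfM => //; [exact: (btrig true)|exact: (btrig false)|exact: bmf_cst].
have bF2 : bmf F2.
  apply: bmfM => //; apply: bmfD; apply: bmfM => //; [exact: (btrig false)|exact: (btrig true)|exact: bmf_cst].
have mT1 : measurable_fun setT (fun x : @rVE R nX => Tre lam S phi f (fun=> 0) x).
  by apply: (@measurable_riint _ nY _ _ F1); case: bF1.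
have mT2 : measurable_fun setT (fun x : @rVE R nX => Tim lam S phi f (fun=> 0) x).
  by apply: (@measurable_riint _ nY _ _ F2); case: bF2.
have mT : measurable_fun setT (fun x : @rVE R nX => (powR (cmod (Tre lam S phi f (fun=> 0) x)
    (Tim lam S phi f (fun=> 0) x)) p)%:E).
  apply/measurable_EFinP; apply: (measurableT_comp (measurable_powR p)).
  exact: measurable_cmod.
pose m := c * (2 * r) ^+ nY.
have m0 : 0 < m by rewrite mulr_gt0// exprn_gt0.
have hT (x : @rVE R nX) : cube r x -> m <= `|Tre lam S phi f (fun=> 0) x|.
  move=> cx.
  have bFx := bmf_pair1 x bF1.
  have iFx := bmf_integrable (vmu_fin (bmu_fin r) nY) bFx.
  have sFx (y : @rVE R nY) : ~~ cube r y -> F1 (x, y) = 0.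
    by move=> /negbTE h; rewrite /F1 /f /= h b2R0 !mulr0 subrr mulr0.
  have [iFx' E] := integral_supp iFx sFx.
  have -> : Tre lam S phi f (fun=> 0) x = \int[vmu (bmu r) nY]_y F1 (x, y).
    by apply: etrans E; exact: (riintE iFx').
  have h1 : \int[vmu (bmu r) nY]_y (c * (cube r y)%:R) = m.
    by apply: etrans (bmf_RintZl (vmu_fin (bmu_fin r) nY) _ (bcube nY)) _; rewrite Rintegral_cube.
  have h2 := bmf_RintZl (vmu_fin (bmu_fin r) nY) sg bFx.
  have h3 (t : R) : sg * t <= `|t|.
    by apply: le_trans (ler_norm _) _; rewrite normrM sg1 mul1r.
  apply: le_trans (h3 _); rewrite -h1 -h2.
  have bL : bmf (fun y : @rVE R nY => c * (cube r y)%:R) by exact: bmfZ.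
  have bR : bmf (fun y : @rVE R nY => sg * F1 (x, y)) by exact: bmfZ.
  apply: (bmf_le_Rint (vmu_fin (bmu_fin r) nY) bL bR).
  move=> y; rewrite /F1 /f /= mulr0 subr0; case: (boolP (cube r y)) => cy; last first.
    by rewrite b2R0 !mulr0.
  by rewrite b2R1 !mulr1; apply: hk (in_ball_cube cx cy); rewrite ?r0.
rewrite lintE//; last by move=> x; rewrite lee_fin powR_ge0.
apply: (@le_trans _ _ (\int[vmu mu nX]_x ((powR m p)%:E * ((cube r x)%:R)%:E))%E); last first.
  apply: ge0_le_integral => //.
  - by move=> x _; rewrite -EFinM lee_fin mulr_ge0 ?powR_ge0.
  - by apply: emeasurable_funM => //; apply/measurable_EFinP; case: (bcube nX).
  - move=> x _; rewrite -EFinM lee_fin; case: (boolP (cube r x)) => cx; last by rewrite b2R0 mulr0 powR_ge0.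
    rewrite b2R1 mulr1; apply: ge0_ler_powR; rewrite ?nnegrE ?(ltW p0) ?(ltW m0) ?cmod_ge0//.
    exact: le_trans (hT x cx) (ler_cmodl _ _).
have mcX : measurable_fun setT (fun x : @rVE R nX => ((cube r x)%:R : R)%:E).
  by apply/measurable_EFinP; case: (bcube nX).
rewrite ge0_integralZl//; last by rewrite lee_fin powR_ge0.
rewrite lintc -EFinM lee_fin le_eqVlt; apply/orP; left; apply/eqP.
have e1 : powR (2 * del) a * powR L (- gam) = powR (2 * r) a.
  have D2 : 0 <= 2 * del by rewrite mulr_ge0// ltW.
  rewrite /r [2 * (del * _)]mulrA (powRM _ D2 (powR_ge0 _ _)) -powRrM; congr (_ * powR _ _).
  by rewrite /a; field.
rewrite -mulrA e1 /m -!powR_mulrn ?(ltW r20)//; apply: powR_homogeneity => //.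
by rewrite /a /gamma_exp; field; rewrite dR gt_eqF.
Qed.

End lower_bound.

Section Lpnorm_facts.
Context {R : realType}.

Lemma lint_ge0 n (F : 'rV[R]_n -> \bar R) : (forall z, 0 <= F z)%E -> (0 <= lint n F)%E.
Proof.
elim: n F => [|n IH] F F0 /=; first exact: F0.
by apply: integral_ge0 => t _; apply: IH => v; exact: F0.
Qed.

Lemma poweR_scale (p a : R) (A : \bar R) : 0 < p -> 0 <= a -> (0 <= A)%E ->
  poweR ((powR a p)%:E * A)%E p^-1 = (a%:E * poweR A p^-1)%E.
Proof.
move=> p0 a0 A0; rewrite poweRM ?lee_fin ?powR_ge0// poweR_EFin -powRrM mulfV ?gt_eqF// powRr1//.
Qed.

Lemma poweR_lty (p : R) (A : \bar R) : 0 < p -> (0 <= A)%E -> (poweR A p^-1 < +oo)%E -> (A < +oo)%E.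
Proof.
move=> p0; case: A => [r||] //= _; first by rewrite !ltry.
by rewrite ifF//; apply/eqP => h; move: p0; rewrite -invr_gt0 h ltxx.
Qed.

Lemma le_poweRV (p : R) (A B : \bar R) : 0 < p -> (0 <= A)%E -> (A <= B)%E ->
  (poweR A p^-1 <= poweR B p^-1)%E.
Proof.
move=> p0 A0 AB; apply: gt0_ler_poweR => //; rewrite ?invr_ge0 ?(ltW p0)// in_itv/= leey andbT//.
exact: le_trans AB.
Qed.

(** With a = A / p + B / p' one has a p = A + B (p - 1) and a p' = A / (p - 1) + B: the upper
    endpoint yields a p < D, the lower one yields a p' < D and p > 1. Since D > A + B, the
    denominator D - B is positive. *)
Lemma exponent_range (D A B p : R) : 0 < A -> 0 < B -> A + B < D ->
  (D - B + A) / (D - B) < p < (D - A + B) / B ->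
  1 < p /\ (A / p + B * (1 - p^-1)) * Num.max p (p / (p - 1)) < D.
Proof.
move=> A0 B0 ABD /andP[].
have DB : 0 < D - B by lra.
rewrite ltr_pdivrMr// ltr_pdivlMr// => h1 h2.
have p1 : 1 < p by rewrite -(ltr_pM2r DB); move: h1; lra.
have p0 : 0 < p by lra.
have p10 : 0 < p - 1 by lra.
split => //; rewrite maxEle; case: ifP => _.
  rewrite (_ : _ * _ = (A + B * (p - 1)) / (p - 1)); last by field; rewrite !gt_eqF.
  by rewrite ltr_pdivrMr//; move: h1; nra.
rewrite (_ : _ * _ = A + B * (p - 1)); last by field; rewrite gt_eqF.
by move: h2; nra.
Qed.

End Lpnorm_facts.

Theorem theorem3p1 (R : realType) (nX nY d : nat)
    (S : mpoly.mpoly (nX + nY) R) (phi : 'rV[R]_(nX + nY) -> R) :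
  (0 < nX)%N -> (0 < nY)%N ->
  homogeneous_of_degree d S -> (nX + nY < d)%N ->
  smooth phi -> compact_support phi ->
  rank_one_condition S ->
  forall p : R,
    (d%:R - nY%:R + nX%:R) / (d%:R - nY%:R) < p < (d%:R - nX%:R + nY%:R) / nY%:R ->
    (exists C : R, forall lam : R, lam != 0 ->
       forall fr fi : 'rV[R]_nY -> R, borel_fun fr -> borel_fun fi ->
       (Lpnorm p fr fi < +oo)%E ->
       (Lpnorm p (Tre lam S phi fr fi) (Tim lam S phi fr fi)
          <= (C * powR `|lam| (- gamma_exp nX nY d p))%:E * Lpnorm p fr fi)%E)
    /\
    ((\forall z \near (0 : 'rV[R]_(nX + nY)), phi z != 0) ->
     exists c : R, 0 < c /\ exists L : R, forall lam : R, L <= `|lam| ->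
       exists fr fi : 'rV[R]_nY -> R, [/\ borel_fun fr, borel_fun fi,
         (0%R%:E < Lpnorm p fr fi)%E, (Lpnorm p fr fi < +oo)%E &
         ((c * powR `|lam| (- gamma_exp nX nY d p))%:E * Lpnorm p fr fi
            <= Lpnorm p (Tre lam S phi fr fi) (Tim lam S phi fr fi))%E]).
Proof.
case: nX S phi => [//|n1] S phi; case: nY S phi => [//|n2] S phi _ _.
(* nX + nY >= 2 forces d >= 3; writing d = e + 3 gives the second and third derivatives of S the
   degrees e + 1 and e without truncated subtraction. *)
move=> homS de; have d3 : (2 < d)%N by apply: leq_trans de; rewrite addSn addnS.
case: d d3 de homS => [//|[//|[//|e]]] _ de homS.
move=> smphi sphi rk1 p hp.
have dR : n1.+1%:R + n2.+1%:R < e.+3%:R :> R by rewrite -natrD ltr_nat.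
have nX0 : 0 < n1.+1%:R :> R by rewrite ltr0n.
have nY0 : 0 < n2.+1%:R :> R by rewrite ltr0n.
have [p1 hs] := exponent_range nX0 nY0 dR hp.
have p0 : 0 < p by apply: lt_trans p1.
have [cphi dvphi] := smphi 1%N.
have pos n (u v : 'rV[R]_n -> R) : (0 <= lint n (fun z => (powR (cmod (u z) (v z)) p)%:E))%E.
  by apply: lint_ge0 => z; rewrite lee_fin powR_ge0.
split.
  have dphi v a : derivable phi a v by case: (dvphi v).
  have cdphi v : continuous (fun a => derive phi a v) by case: (dvphi v).
  have bphi := bmf_compact_support cphi sphi.
  have [R0 R00 hR0] := compact_support_cube sphi.
  have sp x y : ~~ (cube R0 x && cube R0 y) -> phi (row_mx x y) = 0.
    by move=> /cube_row_mx[k]; exact: hR0.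
  have gE : gamma_exp n1.+1 n2.+1 e.+3 p = scale_exp n1 n2 p / e.+3%:R.
    by rewrite /gamma_exp /scale_exp mulrDl; congr (_ + _); rewrite mulrAC.
  have [C C0 hC] := lint_bound homS rk1 cphi dphi cdphi R00 bphi sp p1 hs.
  exists C => lam lam0 fr fi /borel_funE mr /borel_funE mi fin.
  rewrite /Lpnorm gE -poweR_scale//; last by rewrite mulr_ge0 ?powR_ge0// ltW.
  apply: le_poweRV => //; apply: hC => //.
  exact: poweR_lty fin.
move=> phi0.
have [c c0 hc] := lint_lower_bound homS (isT : (0 < e.+3)%N) p0 cphi sphi phi0.
exists c; split => //; exists 1 => lam lam1.
have [f [V [mf V0 fV TV]]] := hc lam lam1.
exists f, (fun=> 0); split.
- exact/borel_funE.
- by apply/borel_funE; exact: measurable_cst.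
- by rewrite /Lpnorm fV poweR_EFin lte_fin powR_gt0.
- by rewrite /Lpnorm fV poweR_EFin ltry.
rewrite /Lpnorm fV -poweR_scale//; last 2 first.
- by rewrite mulr_ge0 ?powR_ge0// ltW.
- by rewrite lee_fin ltW.
apply: le_poweRV => //; by rewrite -EFinM lee_fin mulr_ge0 ?powR_ge0// ltW.
Qed.
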